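(* Let $p,q\geq 2$ be coprime integers. There exists a sequence $(\delta_t)_{t\geq 1}$ of positive numbers with $\sum_{t=1}^\infty\delta_t<\infty$ such that the following holds: if $(V_t)_{t\ge 1}$ is any sequence of functions $V_t:\mathbb{Z}^2\to\mathbb{R}$ such that $V_t$ is $(p^t,q^t)$-periodic and $\|V_t\|_\infty\leq\delta_t$ for every $t\geq 1$, then the spectrum of $$\Delta+\sum_{t=1}^\infty V_t$$ is an interval.
   Context: A function $V:\mathbb{Z}^2\to\mathbb{R}$ is $(a,b)$-periodic if $V(n_1+a,n_2)=V(n_1,n_2)=V(n_1,n_2+b)$ for all $(n_1,n_2)\in\mathbb{Z}^2$. The discrete Laplacian on $\ell^2(\mathbb{Z}^2)$ is $\Delta u(n)=\sum_{j=1}^{2}\big(u(n-b_j)+u(n+b_j)\big)$, with $b_1,b_2$ the standard basis of $\mathbb{Z}^2$; potentials act on $\ell^2(\mathbb{Z}^2)$ by multiplication. $\|V\|_\infty=\sup_n|V(n)|$. *)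

(* Defs.v *)
From mathcomp Require Import all_boot all_order all_algebra.
From mathcomp Require Import all_classical all_reals all_analysis.
From mathcomp Require Export complex.

Set Implicit Arguments.
Unset Strict Implicit.
Unset Printing Implicit Defensive.

Import Order.TTheory GRing.Theory Num.Theory.
Import numFieldNormedType.Exports.

Local Open Scope classical_set_scope.
Local Open Scope ring_scope.
Local Open Scope complex_scope.

Notation Z2 := (int * int)%type.

Definition ab_periodic (R : realType) (a b : nat) (V : Z2 -> R) : Prop :=
  forall n1 n2 : int,
    V (n1 + a%:Z, n2) = V (n1, n2) /\ V (n1, n2) = V (n1, n2 + b%:Z).

(* Extended-real valued, so that an unbounded V has norm +oo (the real-valued
   [sup] would return a default value there). *)
Definition supnorm (R : realType) (V : Z2 -> R) : \bar R :=
  ereal_sup (range (fun n => `|V n|%:E)).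

Section l2_space.
Variable R : realType.
Local Notation C := R[i].

Definition sqr_sum (u : Z2 -> C) : \bar R :=
  (\esum_(n in [set: Z2]) (ComplexField.Normc.normc (u n) ^+ 2)%:E)%E.

Definition l2 : set (Z2 -> C) := [set u | (sqr_sum u < +oo)%E].

(* Meaningful only for [u] in [l2]. *)
Definition l2norm (u : Z2 -> C) : R := Num.sqrt (fine (sqr_sum u)).

(* An operator on l2 is represented by a map defined on all sequences; only
   its values on [l2] are constrained or used. *)
Definition bounded_operator (A : (Z2 -> C) -> (Z2 -> C)) : Prop :=
  [/\ forall u, l2 u -> l2 (A u),
      forall (c : C) u v, l2 u -> l2 v ->
        A (fun n => c * u n + v n) = (fun n => c * A u n + A v n)
    & exists M : R, forall u, l2 u -> l2norm (A u) <= M * l2norm u].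

Definition resolvent_set (A : (Z2 -> C) -> (Z2 -> C)) : set C :=
  [set z | exists B : (Z2 -> C) -> (Z2 -> C),
     bounded_operator B /\
     forall u, l2 u ->
       B (fun n => A u n - z * u n) = u /\
       (fun n => A (B u) n - z * B u n) = u].

Definition spectrum (A : (Z2 -> C) -> (Z2 -> C)) : set C :=
  ~` resolvent_set A.

Definition laplacian (u : Z2 -> C) : Z2 -> C := fun n =>
  (u (n.1 - 1, n.2) + u (n.1 + 1, n.2)) +
  (u (n.1, n.2 - 1) + u (n.1, n.2 + 1)).

Definition schrodinger (V : Z2 -> R) (u : Z2 -> C) : Z2 -> C := fun n =>
  laplacian u n + (V n)%:C * u n.

(* The empty set satisfies [is_interval], hence the second condition. *)
Definition is_real_interval (S : set C) : Prop :=
  exists I : set R,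
    [/\ is_interval I, I !=set0 & S = (fun x : R => x%:C) @` I].

End l2_space.

(* Main.v *)
(* For a potential of period (a, b), write H(x, y) for the Bloch operator at
   quasi-momentum (x, y); after a gauge change it acts on functions on the torus
   Z/a x Z/b, with hopping phases e^(+-ix) and e^(+-iy). Expanding det(H - E) over
   permutations gives a Laurent polynomial in e^(ix), e^(iy) whose Newton polygon
   is contained in the diamond |i| + |j| <= ab; since total displacements are
   multiples of a and b, coprimality leaves only the four vertices (with
   coefficients of modulus 1) on its boundary. For one variable large this forces
   distinct roots in the other one, so the discriminant is not identically zero,
   and det(H - E) cannot keep a constant sign when its zero set is infinite.

   Call a periodic potential good if, for every E strictly between the bottom and
   the top of the spectrum, det(H - E) has infinitely many zeros on the real torus.
   Goodness passes to multiples of the period. By the sign change it is stable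
   under small perturbations having the larger coprime period: at an interior
   energy the two signs persist, and near a spectral edge one uses a
   quasi-momentum where H - E is definite. Compactness makes the size of the
   perturbation uniform, which gives the sequence delta inductively, starting from
   the zero potential of period (1, 1).

   For the limit operator, an energy with test functions on both sides of its
   quadratic form has, for all good enough periodic approximants, a bounded Bloch
   solution; damping it by a slowly decaying exponential gives approximate
   eigenfunctions, so the energy is in the spectrum. The bottom of a periodic
   spectrum is compared across scales and with l2 by replacing a function by the
   square root of the sum of its squares over the period lattice, which does not
   increase the form at quasi-momentum (pi, pi). *)
Require Import Defs.
From HB Require Import structures.
From mathcomp Require Import all_boot all_order all_fingroup all_algebra.
From mathcomp Require Import all_classical all_reals all_analysis.
From mathcomp Require Import complex ring lra zify.

Set Implicit Arguments.
Unset Strict Implicit.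
Unset Printing Implicit Defensive.

Import Order.TTheory GRing.Theory Num.Theory.
Import numFieldNormedType.Exports.

Local Open Scope classical_set_scope.
Local Open Scope ring_scope.
Local Open Scope complex_scope.

(** * Laurent sums supported in a Newton diamond *)

(** The obstacle is that an infinite zero set is not stable by itself: for the zero potential of
    period (2, 2) at energy 0 the determinant is (2 cos x + 2 cos y)^2 (2 cos x - 2 cos y)^2, which
    a small checkerboard potential makes positive. Only a sign change survives, and coprimality is
    what produces one. The link is that a real trigonometric polynomial of constant sign has zero
    derivative at each of its zeros, so the Laurent polynomial has a double root there; a nonzero
    resultant allows this for finitely many values of one coordinate only, and exchanging the
    variables settles the other. Conversely, two nonempty disjoint open sets are always separated by
    an infinite set, which turns signs back into zeros. Eigenvalues are never ordered: being
    strictly inside the spectrum means that the form takes both signs. Each [delta] must be fixed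
    before any potential is known, so each step has to be uniform in the earlier potentials and in
    the energy, including energies outside the spectrum, which a perturbation may move inside. *)

Lemma normr_exprz (F : numFieldType) (z : F) (k : int) : `|z ^ k| = `|z| ^ k.
Proof. by case: k => k; rewrite ?NegzE -?exprnN -?exprnP ?normfV normrX. Qed.

Section Laurent.
Variables (C : numClosedFieldType) (X : finType) (c : X -> C) (n : nat).
Hypothesis n_gt0 : (0 < n)%N.

(* The Newton polygon lies in the diamond |i| + |j| <= n, whose boundary carries no
   monomial besides its vertices; those at (n, 0) and (0, n) have simple
   coefficients of modulus 1. *)
Definition diamond (i j : X -> int) : Prop :=
  [/\ forall h, (`|i h| + `|j h| <= n)%N,
      forall h, c h != 0 -> (`|i h| + `|j h|)%N = n -> (i h == 0) || (j h == 0),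
      exists h0, [/\ i h0 = n%:Z, `|c h0| = 1 & forall h, i h = n%:Z -> h = h0]
    & exists h0, [/\ j h0 = n%:Z, `|c h0| = 1 & forall h, j h = n%:Z -> h = h0]].

(** One power of [rho] is gained away from the vertices. Negative exponents only help because [x]
    and [y] are at least 1; with two positive exponents, [i + j = n] would be a boundary point that
    is not a vertex. *)
Lemma monomial_bound (i j : int) (x y : C) (rho : C) :
  1 <= x -> 1 <= y -> x <= rho -> y <= rho ->
  (`|i| + `|j| <= n)%N -> ((`|i| + `|j|)%N = n -> (i == 0) || (j == 0)) ->
  i != n -> j != n ->
  x ^ i * y ^ j <= rho ^+ n.-1.
Proof.
move=> x1 y1 xr yr hij he hin hjn.
have r1 : 1 <= rho by exact: le_trans xr.
have x0 : 0 < x by exact: lt_le_trans x1.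
have y0 : 0 < y by exact: lt_le_trans y1.
have le1 (t : C) (k : int) : 1 <= t -> k <= 0 -> t ^ k <= 1.
  move=> t1; case: k => [k|k] hk.
    by have -> : k = 0%N by lia.
  rewrite NegzE -exprnN invf_le1 ?exprn_ege1 //.
  by rewrite exprn_gt0 // (lt_le_trans _ t1).
have mono (k l : nat) : (k <= l)%N -> rho ^+ k <= rho ^+ l.
  by move=> kl; apply: ler_weXn2l.
have rle (t : C) (k : nat) : 1 <= t -> t <= rho -> t ^+ k <= rho ^+ k.
  by move=> t1 tr; rewrite lerXn2r // nnegrE (le_trans ler01) // .
have pz (t : C) k : 0 < t -> 0 <= t ^ k by move=> ht; rewrite ltW ?exprz_gt0.
have [i0|i0] := lerP i 0; have [j0|j0] := lerP j 0.
- apply: (@le_trans _ _ 1); last exact: exprn_ege1.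
  by rewrite mulr_ile1 ?pz ?le1.
- case: j j0 hij he hjn => // j j0 hij he hjn.
  apply: (@le_trans _ _ (y ^+ j)).
    by rewrite -[leRHS]mul1r ler_pM ?pz ?le1.
  apply: (le_trans (rle _ _ y1 yr)); apply: mono; lia.
- case: i i0 hij he hin => // i i0 hij he hin.
  apply: (@le_trans _ _ (x ^+ i)).
    by rewrite -[leRHS]mulr1 ler_pM ?pz ?le1.
  apply: (le_trans (rle _ _ x1 xr)); apply: mono; lia.
- case: i i0 hij he hin => // i i0 hij he hin.
  case: j j0 hij he hjn => // j j0 hij he hjn.
  apply: (@le_trans _ _ (rho ^+ i * rho ^+ j)).
    by rewrite ler_pM ?rle // exprn_ge0 ?ltW.
  rewrite -exprD; apply: mono.
  have : (i + j)%N != n by apply/eqP => E; move: (he E) i0 j0; lia.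
  lia.
Qed.

(** The second equation is the Euler derivative in [z], so the two together say that [z] is a double
    root. With [rho] the larger of [|z|] and [r], the derivative bounds [|z| ^+ n] by
    [K * rho ^+ n.-1]; the first equation then bounds [r ^+ n] by twice that. *)
Lemma laurent_estimate (i j : X -> int) (z r : C) :
  diamond i j -> 1 <= `|z| -> 1 <= r ->
  \sum_h c h * z ^ i h * r ^ j h = 0 ->
  \sum_h (i h)%:~R * (c h * z ^ i h * r ^ j h) = 0 ->
  r <= 2 * \sum_h `|c h|.
Proof.
move=> [hd he [h0 [ih0 ch0 u0]] [h2 [jh2 ch2 u2]]] z1 r1 eq1 eq2.
set K := \sum_h _.
have ih2 : i h2 = 0 by move: (hd h2); rewrite jh2; lia.
have jh0 : j h0 = 0 by move: (hd h0); rewrite ih0; lia.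
have h02 : h2 != h0 by apply/eqP => E; move: ih0; rewrite -E ih2; lia.
have r0 : 0 < r by exact: lt_le_trans r1.
have rE : `|r| = r by rewrite ger0_norm ?ltW.
pose m := n.-1.
have nE : n = m.+1 by rewrite /m prednK.
have [rho [rho1 zr rr rhoE]] : exists rho : C,
    [/\ 1 <= rho, `|z| <= rho, r <= rho &
       (r <= `|z| /\ rho = `|z|) \/ (`|z| <= r /\ rho = r)].
  have rr : r \is Num.real by rewrite ger0_real ?ltW.
  have zz : `|z| \is Num.real by exact: normr_real.
  case: (real_leP zz rr) => h.
    by exists r; split => //; right.
  by exists `|z|; split => //; [exact: ltW | left; rewrite ltW].
have rhom0 : 0 <= rho ^+ m by rewrite exprn_ge0 // (le_trans ler01).
pose rest h := (h != h0) && (h != h2).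
have bnd h : rest h -> `|c h * z ^ i h * r ^ j h| <= `|c h| * rho ^+ m.
  move=> /andP[n0 n2]; case: (eqVneq (c h) 0) => [->|cn0].
    by rewrite !mul0r normr0 mul0r.
  rewrite !normrM -mulrA ler_wpM2l // !normr_exprz rE.
  apply: monomial_bound => //; first exact: he.
    by apply: contra n0 => /eqP/u0 ->.
  by apply: contra n2 => /eqP/u2 ->.
have bK : \sum_(h | rest h) `|c h * z ^ i h * r ^ j h| <= K * rho ^+ m.
  rewrite /K mulr_suml [leRHS](bigID rest) /= ler_wpDr //.
    by apply: sumr_ge0 => h _; rewrite mulr_ge0.
  exact: ler_sum.
(* The factor [i h] kills the vertex monomial [r ^+ n], and the common bound [|i h| <= n] cancels
   against the factor [n] of the vertex monomial [z ^+ n]. *)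
have bz : `|z| ^+ n <= K * rho ^+ m.
  move: eq2; rewrite (bigD1 h0) //= (bigD1 h2) //= ih2 mul0r add0r ih0 jh0.
  rewrite expr0z mulr1 => /eqP; rewrite addr_eq0 => /eqP/(congr1 Num.norm).
  rewrite normrN !normrM ch0 mul1r normr_exprz => E.
  have nn : `|(n%:Z)%:~R : C| = n%:R by rewrite -pmulrn normr_nat.
  have : n%:R * `|z| ^+ n <= n%:R * (K * rho ^+ m).
    rewrite -{1}nn E; apply: (le_trans (ler_norm_sum _ _ _)).
    apply: (@le_trans _ _ (\sum_(h | rest h) n%:R * `|c h * z ^ i h * r ^ j h|)).
      apply: ler_sum => h _; rewrite [leLHS]normrM ler_wpM2r //.
      by rewrite -intr_norm -[ `|_| ]/(Posz `|i h|%N) -pmulrn ler_nat; move: (hd h); lia.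
    by rewrite -mulr_sumr ler_wpM2l // ler0n.
  by rewrite ler_pM2l // ltr0n.
have K0 : 0 <= K by apply: sumr_ge0.
have final x : 1 <= x -> rho = x -> x ^+ n <= 2 * K * rho ^+ m -> x <= 2 * K.
  move=> x1 ->; rewrite nE exprS ler_pM2r //.
  by rewrite exprn_gt0 // (lt_le_trans _ x1).
have K2 : K <= 2 * K by rewrite mulr2n mulrDl mul1r lerDl.
have bz2 : `|z| ^+ n <= 2 * K * rho ^+ m.
  by apply: (le_trans bz); rewrite ler_wpM2r.
case: rhoE => [[rz E]|[zr' E]].
  by apply: (le_trans rz); exact: final.
apply: final => //.
move: eq1; rewrite (bigD1 h2) //= (bigD1 h0) 1?eq_sym //= ih2 ih0 jh0 jh2.
rewrite !expr0z !mulr1 => /eqP; rewrite addr_eq0 => /eqP/(congr1 Num.norm).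
rewrite normrN !normrM ch2 mul1r normr_exprz rE -exprnP => ->.
apply: (le_trans (ler_normD _ _)); rewrite mulrDl mulrDl mul1r lerD //.
  by rewrite normrM ch0 mul1r normr_exprz.
apply: le_trans bK; apply: (le_trans (ler_norm_sum _ _ _)).
by apply/eqP/eqP; rewrite le_eqVlt; apply/orP; left; apply/eqP; apply: eq_bigl => h; rewrite /rest andbC.
Qed.

End Laurent.

Section Laurent.
Variables (C : numClosedFieldType) (X : finType) (c : X -> C) (n : nat).
Hypothesis n_gt0 : (0 < n)%N.

(** [P] is the resultant in [z] of the polynomial obtained after multiplication by [(z * w) ^+ n]
    and of its derivative. The second diamond serves the case [|z| < 1], where [z] is replaced by
    its inverse. *)
Lemma double_root_finite (i j : X -> int) :
  diamond c n i j -> diamond c n (fun h => - i h) j ->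
  exists2 P : {poly C}, P != 0 &
    forall z w, z != 0 -> w != 0 ->
      \sum_h c h * z ^ i h * w ^ j h = 0 ->
      \sum_h (i h)%:~R * (c h * z ^ i h * w ^ j h) = 0 -> root P w.
Proof.
move=> D1 D2.
have hd h : (`|i h| + `|j h| <= n)%N by case: D1 => + _ _ _; apply.
pose e (k : int) : nat := absz (k + n%:Z).
pose F : {poly {poly C}} := \sum_h (c h *: 'X^(e (j h))) *: 'X^(e (i h)).
pose G w : {poly C} := \sum_h (c h * w ^+ e (j h)) *: 'X^(e (i h)).
have FG w : map_poly (horner_eval w) F = G w.
  rewrite /F /G rmorph_sum; apply: eq_bigr => h _ /=.
  by rewrite map_polyZ map_polyXn /= horner_evalE hornerZ hornerXn.
have ez (z : C) k : z != 0 -> (`|k| <= n)%N -> z ^+ e k = z ^+ n * z ^ k.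
  move=> z0 kn; rewrite (exprnP z (e k)) /e gez0_abs; last by lia.
  by rewrite expfzDr // mulrC.
have Gz (z w : C) : z != 0 -> w != 0 ->
    (G w).[z] = (z * w) ^+ n * \sum_h c h * z ^ i h * w ^ j h.
  move=> z0 w0; rewrite /G horner_sum mulr_sumr; apply: eq_bigr => h _.
  rewrite hornerZ hornerXn !ez // ?exprMn; first by ring.
    by move: (hd h); lia.
  by move: (hd h); lia.
(* Product rule for the Euler derivative: the factor [z ^+ n] adds [n] times the value, which
   vanishes along with it at a double root. *)
have G'z (z w : C) : z != 0 -> w != 0 ->
    z * (G w)^`().[z] = (z * w) ^+ n *
    (\sum_h (i h)%:~R * (c h * z ^ i h * w ^ j h)
       + n%:R * \sum_h c h * z ^ i h * w ^ j h).
  move=> z0 w0; rewrite /G raddf_sum horner_sum mulr_sumr mulr_sumr -big_split mulr_sumr.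
  apply: eq_bigr => h _ /=.
  rewrite linearZ /= derivXn hornerZ hornerMn hornerXn.
  have -> : z * (c h * w ^+ e (j h) * (z ^+ (e (i h)).-1 *+ e (i h))) =
     (e (i h))%:R * c h * w ^+ e (j h) * z ^+ e (i h).
    case: (e (i h)) => [|k]; first by rewrite mulr0n !mul0r !mulr0.
    rewrite -mulr_natr exprS /=; ring.
  have -> : (e (i h))%:R = (i h)%:~R + n%:R :> C.
    rewrite !pmulrn /e gez0_abs ?intrD //; move: (hd h); lia.
  rewrite !ez // ?exprMn; first by ring.
    by move: (hd h); lia.
  by move: (hd h); lia.
case: (D1) => _ he [h0 [ih0 ch0 u0]] [h2 [jh2 ch2 u2]].
case: (D2) => _ _ [h1 [ih1 ch1 u1]] _.
have jh0 : j h0 = 0 by move: (hd h0); rewrite ih0; lia.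
have jh1 : j h1 = 0 by move: (hd h1); lia.
have c0 : c h0 != 0 by rewrite -normr_eq0 ch0 oner_eq0.
have c1 : c h1 != 0 by rewrite -normr_eq0 ch1 oner_eq0.
(* Only the vertex [(n, 0)] reaches degree [2 * n] in [z], so the leading coefficient is a monomial
   in [w]. It survives at every [w != 0], which lets the resultant commute with evaluation. *)
have F2n : F`_(2 * n) = c h0 *: 'X^n.
  rewrite /F coef_sum (bigD1 h0) //= big1 ?addr0.
    by rewrite coefZ coefXn ih0 jh0 /e (_ : _ == _) ?mulr1 ?add0r //; lia.
  move=> h hh0; rewrite coefZ coefXn (_ : _ == _ = false) ?mulr0 //.
  apply/negP => /eqP E; move/eqP: hh0; apply; apply: u0.
  by move: E (hd h); rewrite /e; lia.
have Fbig k : (2 * n < k)%N -> F`_k = 0.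
  move=> kn; rewrite /F coef_sum big1 // => h _.
  rewrite coefZ coefXn (_ : _ == _ = false) ?mulr0 //.
  by apply/negP => /eqP E; move: E (hd h) kn; rewrite /e; lia.
have cX0 : c h0 *: 'X^n != 0 :> {poly C} by rewrite scaler_eq0 negb_or c0 -size_poly_gt0 size_polyXn.
have sF : size F = (2 * n).+1.
  apply/eqP; rewrite eqn_leq; apply/andP; split.
    by apply/leq_sizeP => k /Fbig.
  by rewrite ltnNge; apply: contra cX0 => /leq_sizeP/(_ _ (leqnn _)) <-; rewrite F2n.
have lF : lead_coef F = c h0 *: 'X^n by rewrite lead_coefE sF /= F2n.
have sF' : size F^`() = (2 * n)%N.
  rewrite size_poly_eq sF //= prednK ?muln_gt0 // F2n -mulr_natl mulf_neq0 //.
  by rewrite -polyC_natr polyC_eq0 pnatr_eq0; lia.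
have lF' : lead_coef F^`() = (2 * n)%:R * (c h0 *: 'X^n).
  rewrite lead_coefE sF' coef_deriv prednK ?muln_gt0 // F2n.
  by rewrite mulr_natl.
have lw w : w != 0 -> (c h0 *: 'X^n : {poly C}).[w] != 0.
  by move=> w0; rewrite hornerZ hornerXn mulf_neq0 // expf_neq0.
have res w : w != 0 ->
   (resultant F F^`()).[w] = resultant (G w) (G w)^`().
  move=> w0; rewrite -FG deriv_map -map_resultant //=.
  - by rewrite lF horner_evalE lw.
  -
  rewrite lF' horner_evalE hornerM -polyC_natr hornerC mulf_neq0 ?lw //.
  by rewrite pnatr_eq0; lia.
have G0 w : w != 0 -> G w != 0.
  move=> w0; apply: contra (lw w w0) => /eqP E.
  by rewrite -F2n -horner_evalE -coef_map FG E coef0.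
exists (resultant F F^`()); last first.
  move=> z w z0 w0 e1 e2; rewrite rootE res // resultant_eq0.
  rewrite ltnNge; apply/negP => /size1_polyC E.
  have r1 : root (G w) z by rewrite rootE Gz // e1 mulr0.
  have r2 : root (G w)^`() z.
    rewrite rootE -(mulrI_eq0 _ (mulfI z0)) G'z // e1 e2 mulr0 addr0 mulr0 //.
  have : root (gcdp (G w) (G w)^`()) z by rewrite root_gcd r1 r2.
  rewrite E rootC => /eqP E0; move: E; rewrite E0 polyC0 => /eqP.
  by rewrite gcdp_eq0 (negPf (G0 w w0)).
apply/eqP => P0.
pose K := \sum_h `|c h|.
have K0 : 0 <= K by apply: sumr_ge0.
(* Just beyond the bound of [laurent_estimate]: at [w = r] no double root can exist, so the
   resultant is nonzero there. *)
pose r : C := 2 * K + 1.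
have r1 : 1 <= r by rewrite lerDr mulr_ge0.
have r0 : r != 0 by rewrite gt_eqF // (lt_le_trans _ r1).
have := res r r0; rewrite P0 horner0 => /esym/eqP; rewrite resultant_eq0 => sg.
have /closed_rootP[z] : size (gcdp (G r) (G r)^`()) != 1 by rewrite neq_ltn sg orbT.
rewrite root_gcd => /andP[/eqP rz /eqP rz'].
(* The constant coefficient of [G r] comes from the vertex [(-n, 0)] alone and is therefore
   nonzero. *)
have z0 : z != 0.
  apply/eqP => zz; move: rz; rewrite zz /G horner_sum (bigD1 h1) //= big1 ?addr0.
    rewrite hornerZ hornerXn {2}/e (_ : i h1 = - n%:Z) ?addNr ?expr0; last by lia.
    by rewrite mulr1 => /eqP; rewrite mulf_eq0 (negPf c1) expf_eq0 (negPf r0) andbF.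
  move=> h hh; rewrite hornerZ hornerXn expr0n (_ : _ == _ = false) ?mulr0 //.
  apply/negP => /eqP E; move/eqP: hh; apply; apply: u1.
  by move: E (hd h); rewrite /e; lia.
have nz : (z * r) ^+ n != 0 by rewrite expf_neq0 // mulf_neq0.
have e1 : \sum_h c h * z ^ i h * r ^ j h = 0.
  by apply: (mulfI nz); rewrite -Gz // rz mulr0.
have e2 : \sum_h (i h)%:~R * (c h * z ^ i h * r ^ j h) = 0.
  apply: (mulfI nz); have := G'z z r z0 r0; rewrite rz' mulr0 e1 mulr0 addr0 => <-.
  by rewrite mulr0.
suff : r <= 2 * K by rewrite gerDl ler10.
have zr : `|z| \is Num.real by exact: normr_real.
have [z1|z1] := real_leP (@real1 C) zr; first exact: (laurent_estimate n_gt0 D1 z1).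
apply: (@laurent_estimate _ _ c n n_gt0 (fun h => - i h) j z^-1) => //.
- by rewrite normfV invf_ge1 ?normr_gt0 // ltW.
- by rewrite -[RHS]e1; apply: eq_bigr => h _; rewrite exprz_inv opprK.
- rewrite -[RHS]oppr0 -[in RHS]e2 -sumrN; apply: eq_bigr => h _.
  by rewrite exprz_inv opprK mulrNz mulNr.
Qed.

End Laurent.

(** * Angles and the unit circle *)

Section Circle.
Variable R : realType.
Implicit Types x y : R.

Definition expi x : R[i] := cos x +i* sin x.

Lemma expi0 : expi 0 = 1.
Proof. by rewrite /expi cos0 sin0. Qed.

Lemma expiD x y : expi (x + y) = expi x * expi y.
Proof. by rewrite /expi cosD sinD; simpc; congr (_ +i* _); ring. Qed.

Lemma expiN x : expi (- x) = (expi x)^*.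
Proof. by rewrite /expi cosN sinN. Qed.

Lemma expi_mulN x : expi x * expi (- x) = 1.
Proof. by rewrite -expiD subrr expi0. Qed.

Lemma expi_neq0 x : expi x != 0.
Proof. by apply/eqP => h; have := expi_mulN x; rewrite h mul0r => /esym/eqP; rewrite oner_eq0. Qed.

Lemma normc_expi x : ComplexField.Normc.normc (expi x) = 1.
Proof. by rewrite /= cos2Dsin2 sqrtr1. Qed.

Lemma expi_int x (k : int) : expi (k%:~R * x) = expi x ^ k.
Proof.
case: k => k; last first.
  rewrite NegzE -exprnN mulrNz mulNr; apply: (mulfI (expi_neq0 (k.+1%:~R * x))).
  rewrite expi_mulN -pmulrn; elim: k.+1 => [|n IH]; first by rewrite mul0r expi0 expr0 invr1 mulr1.
  rewrite -addn1 natrD mulrDl mul1r expiD exprD expr1 invfM mulrACA -IH mul1r.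
  by rewrite mulfV // expi_neq0.
rewrite -pmulrn -exprnP; elim: k => [|n IH]; first by rewrite mul0r expi0 expr0.
by rewrite -addn1 natrD mulrDl mul1r expiD exprD expr1 IH.
Qed.

Lemma expi_sum (I : Type) (s : seq I) (P : pred I) (f : I -> R) :
  expi (\sum_(k <- s | P k) f k) = \prod_(k <- s | P k) expi (f k).
Proof. by apply: (big_morph expi expiD expi0). Qed.

Lemma expi_inj_near x y : `|x - y| <= pi -> expi x = expi y -> x = y.
Proof.
move=> xy E; apply/eqP; rewrite -subr_eq0 -normr_eq0; apply/eqP.
have : expi (x - y) = 1 by rewrite expiD E expi_mulN.
case=> c1 _; apply: cos_inj; rewrite ?in_itv /= ?lexx ?pi_ge0 ?normr_ge0 //=.
by rewrite cos_norm c1 cos0.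
Qed.

(* Infinite sets are those containing arbitrarily long duplicate-free sequences, the
   form in which they are compared with the roots of a polynomial. *)
Definition many (A : set R[i]) : Prop :=
  forall N, exists s : seq R[i], [/\ uniq s, size s = N & forall z, z \in s -> A z].

Lemma many_sub (A B : set R[i]) : A `<=` B -> many A -> many B.
Proof. by move=> AB mA N; have [s [us ss sA]] := mA N; exists s; split => // z /sA/AB. Qed.

Lemma many_arc (A : set R[i]) x : (\forall y \near x, A (expi y)) -> many A.
Proof.
move=> /nbhs_ballP[d /= d0 hd] N.
(* The first bound keeps the points in the ball, the second keeps them within [pi] of each other,
   where [expi] is injective. *)
pose e := Num.min (d / 2) (pi / 2 : R).
have e0 : 0 < e by rewrite lt_min !divr_gt0 ?pi_gt0.
have ed : e < d by rewrite gt_min ltr_pdivrMr // ltr_pMr // ltr1n.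
have ep : e <= pi / 2 by rewrite ge_min lexx orbT.
pose f (k : nat) : R := x + e / k.+1%:R.
have k1 k : 0 < e / k.+1%:R <= e.
  by rewrite divr_gt0 //= ler_piMr ?(ltW e0) // invf_le1 ?ltr0Sn // (ler_nat R 1 k.+1).
exists [seq expi (f k) | k <- iota 0 N]; split.
- rewrite map_inj_uniq ?iota_uniq // => k l /expi_inj_near E.
  have : f k = f l.
    apply: E; rewrite /f; have /andP[a b] := k1 k; have /andP[c f'] := k1 l.
    rewrite opprD addrACA subrr add0r ler_norml.
    by move: (e / _) (e / _) (pi : R) a b c f' ep => u w p *; apply/andP; split; lra.
  move=> /addrI /(mulfI (lt0r_neq0 e0)) /invr_inj /eqP.
  by rewrite eqr_nat eqSS => /eqP.
- by rewrite size_map size_iota.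
- move=> z /mapP[k _ ->]; apply: hd; rewrite /ball /= /f opprD addrA subrr sub0r normrN.
  by have /andP[a b] := k1 k; rewrite gtr0_norm // (le_lt_trans b).
Qed.

Lemma many_roots (A : set R[i]) (P : {poly R[i]}) :
  many A -> P != 0 -> exists2 z, A z & ~~ root P z.
Proof.
move=> mA P0; have [s [us ss sA]] := mA (size P).
have [/allP al|/allPn[z zs rz]] := boolP (all (root P) s); last by exists z => //; exact: sA.
by have := max_poly_roots P0 (introT allP al) us; rewrite ss ltnn.
Qed.

(** A subset of the torus is infinite exactly when one of its two coordinate projections is. This
    form is used because a resultant in one variable controls only the other coordinate. *)
Definition many_lines (Z : R -> R -> Prop) : Prop :=
  many [set z | exists x y, z = expi y /\ Z x y] \/
  many [set z | exists x y, z = expi x /\ Z x y].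

Lemma many_lines_sub (Z Z' : R -> R -> Prop) :
  (forall x y, Z x y -> Z' x y) -> many_lines Z -> many_lines Z'.
Proof.
by move=> h [] m; [left|right]; apply: many_sub m => z [x [y [-> /h Zxy]]]; exists x, y.
Qed.

Lemma line_separation (N P : set R) (x0 x1 : R) :
  (forall x, N x -> ~ P x) ->
  (forall x, N x -> \forall x' \near x, N x') ->
  (forall x, P x -> \forall x' \near x, P x') ->
  N x0 -> P x1 -> exists x, ~ N x /\ ~ P x.
Proof.
move=> dis oN oP N0 P1; apply: contrapT => /forallNP none.
pose f (x : R) : R := if `[< P x >] then 1 else - 1.
have fP x : P x -> f x = 1 by rewrite /f => h; rewrite asboolT.
have fN x : N x -> f x = -1 by move=> /dis h; rewrite /f asboolF.
have NP x : N x \/ P x by apply: contrapT => /not_orP h; exact: (none x).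
have cf : continuous f.
  move=> x; change (f @ x --> f x); have [h|h] := NP x.
    rewrite (fN _ h); apply: cvg_near_cst; near=> y; apply/fN; near: y; exact: oN.
  by rewrite (fP _ h); apply: cvg_near_cst; near=> y; apply/fP; near: y; exact: oP.
have key a b : a <= b -> Num.min (f a) (f b) <= 0 <= Num.max (f a) (f b) -> False.
  move=> ab /(IVT ab (continuous_subspaceT cf)) [c _].
  have [/fN->|/fP->] := NP c; lra.
have [h|/ltW h] := leP x0 x1; apply: (key _ _ h); rewrite (fN _ N0) (fP _ P1).
  by rewrite ge_min le_max; apply/andP; split; apply/orP; [left|right]; lra.
by rewrite ge_min le_max; apply/andP; split; apply/orP; [right|left]; lra.
Unshelve. all: by end_near. Qed.

Lemma many_lines_separation (N P : R -> R -> Prop) x0 y0 x1 y1 :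
  (forall x y, N x y -> ~ P x y) ->
  (forall x y, N x y -> \forall x' \near x, N x' y) ->
  (forall x y, N x y -> \forall y' \near y, N x y') ->
  (forall x y, P x y -> \forall x' \near x, P x' y) ->
  (forall x y, P x y -> \forall y' \near y, P x y') ->
  N x0 y0 -> P x1 y1 -> many_lines (fun x y => ~ N x y /\ ~ P x y).
Proof.
move=> dis Nx Ny Px Py N0 P1.
have hor x x' y : N x y -> P x' y -> many_lines (fun x y => ~ N x y /\ ~ P x y).
  move=> n p; left; apply: (@many_arc _ y); near=> y'.
  have [|||||z hz] := @line_separation (N ^~ y') (P ^~ y') x x'; first by move=> t; exact: dis.
  - by move=> t; exact: Nx.
  - by move=> t; exact: Px.
  - by near: y'; exact: Ny.
  - by near: y'; exact: Py.
  - by exists z, y'.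
have ver x y y' : N x y -> P x y' -> many_lines (fun x y => ~ N x y /\ ~ P x y).
  move=> n p; right; apply: (@many_arc _ x); near=> x'.
  have [|||||z hz] := @line_separation (N x') (P x') y y'; first by move=> t; exact: dis.
  - by move=> t; exact: Ny.
  - by move=> t; exact: Py.
  - by near: x'; exact: Nx.
  - by near: x'; exact: Px.
  - by exists x', z.
(* If [(x, y0)] lies in [N], the vertical line through [x] meets both sets; if it lies in [P], the
   horizontal line through [y0] does. Otherwise a whole segment of the line at height [y0] near [x1]
   avoids both sets. *)
have [[x [p [n|n]]]|none] := pselect (exists x, P x y1 /\ (N x y0 \/ P x y0)).
- exact: ver n p.
- exact: hor N0 n.
right; apply: (@many_arc _ x1); near=> x; exists x, y0; split => //.
have px : P x y1 by near: x; exact: Px.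
by split=> h; apply: none; exists x; split => //; [left|right].
Unshelve. all: by end_near. Qed.

End Circle.

(** * The Bloch operator on a finite torus *)

(* The five terms of the operator: 0 is the potential, 1/2 (resp. 3/4) are the
   forward/backward hops in the first (resp. second) direction. *)
Notation hop := 'I_5.
Definition hop1 (o : hop) : int := nth 0 [:: 0; 1; -1; 0; 0] o.
Definition hop2 (o : hop) : int := nth 0 [:: 0; 0; 0; 1; -1] o.

Section Torus.
Variables (R : realType) (T : finType) (s1 s2 : {perm T}).
Local Notation C := R[i].
Local Notation n := #|T|.
Implicit Types (v : T -> R) (x y : R) (phi : T -> C).

Definition hop_perm (o : hop) : {perm T} :=
  nth 1%g [:: 1; s1; s1^-1; s2; s2^-1]%g o.

Definition hop_weight (o : hop) (t : R) : R := if o == 0 then t else 1.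

Lemma sum_hop (V : nmodType) (f : hop -> V) :
  \sum_o f o = f 0 + f 1 + f (inord 2) + f (inord 3) + f (inord 4).
Proof.
rewrite !big_ord_recl big_ord0 addr0 !addrA.
by congr (f _ + f _ + f _ + f _ + f _); apply: val_inj; rewrite /= ?inordK.
Qed.

Definition bloch v x y phi (m : T) : C :=
  (v m)%:C * phi m + (expi x * phi (s1 m) + expi (- x) * phi (s1^-1 m)%g)
                   + (expi y * phi (s2 m) + expi (- y) * phi (s2^-1 m)%g).

Definition bloch_mx v x y : 'M[C]_n := \matrix_(k, l)
  \sum_(o : hop) (hop_weight o (v (enum_val k)))%:C
      * expi ((hop1 o)%:~R * x + (hop2 o)%:~R * y)
      * (enum_val l == hop_perm o (enum_val k))%:R.

Lemma bloch_sum v x y phi m : bloch v x y phi m =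
  \sum_(o : hop) (hop_weight o (v m))%:C
     * expi ((hop1 o)%:~R * x + (hop2 o)%:~R * y) * phi (hop_perm o m).
Proof.
rewrite sum_hop /bloch /hop_weight /hop1 /hop2 /hop_perm /= !inordK //=.
rewrite perm1 !mul0r !addr0 !add0r expi0 !mul1r !mulr1 !mulN1r -!addrA.
by rewrite -!val_eqE /= !inordK //= !mul1r.
Qed.

Lemma bloch_mxE v x y phi k :
  \sum_l bloch_mx v x y k l * phi (enum_val l) = bloch v x y phi (enum_val k).
Proof.
rewrite bloch_sum; under eq_bigr do rewrite mxE mulr_suml.
rewrite exchange_big; apply: eq_bigr => o _ /=.
rewrite (bigD1 (enum_rank (hop_perm o (enum_val k)))) //= enum_rankK eqxx mulr1.
rewrite big1 ?addr0 // => l hl; rewrite (_ : _ == _ = false) ?mulr0 ?mul0r //.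
by apply/negP => /eqP E; move/eqP: hl; apply; rewrite -E enum_valK.
Qed.

Definition hops := {ffun 'I_n -> hop}.
Definition total1 (h : hops) : int := \sum_k hop1 (h k).
Definition total2 (h : hops) : int := \sum_k hop2 (h k).
(** The expansion runs over the choice of a hop in each row rather than over permutations alone:
    when a period is 1 or 2, distinct hops have the same target, and the permutation does not
    determine the displacement. At most one [s] contributes. *)
Definition hop_sign (h : hops) : R := \sum_(s : 'S_n) (-1) ^+ s *
  \prod_k (enum_val (s k) == hop_perm (h k) (enum_val k))%:R.
Definition hop_coef v (h : hops) : R :=
  hop_sign h * \prod_k hop_weight (h k) (v (enum_val k)).

(** Only cosines appear because the matrix is Hermitian and its determinant real; the identification
    is [bloch_det_re], and [bloch_det_im] records that the sines cancel. *)
Definition bloch_det v x y : R := \sum_(h : hops)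
  hop_coef v h * cos ((total1 h)%:~R * x + (total2 h)%:~R * y).

Lemma bloch_det_expand v x y : \det (bloch_mx v x y) =
  \sum_(h : hops) (hop_coef v h)%:C * expi ((total1 h)%:~R * x + (total2 h)%:~R * y).
Proof.
rewrite /determinant.
under eq_bigr do (under eq_bigr do rewrite mxE; rewrite bigA_distr_bigA mulr_sumr).
rewrite exchange_big; apply: eq_bigr => h _ /=.
have -> : expi ((total1 h)%:~R * x + (total2 h)%:~R * y) =
    \prod_k expi ((hop1 (h k))%:~R * x + (hop2 (h k))%:~R * y).
  rewrite -expi_sum; congr expi.
  by rewrite big_split /= -!mulr_suml /total1 /total2 !rmorph_sum.
rewrite /hop_coef rmorphM rmorph_prod /hop_sign rmorph_sum !mulr_suml.
apply: eq_bigr => s _; rewrite !big_split /= rmorphM rmorph_prod rmorphXn rmorphN1.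
rewrite -!mulrA; congr (_ * _); rewrite mulrA mulrC; congr (_ * _).
by apply: eq_bigr => k _; rewrite rmorph_nat.
Qed.

Lemma bloch_mx_conj v x y : map_mx conjc (bloch_mx v x y) = (bloch_mx v x y)^T.
Proof.
have cE (a t : R) (b : bool) : (a%:C * expi t * b%:R)^* = a%:C * expi (- t) * b%:R.
  by rewrite expiN; case: b; rewrite /expi; simpc.
apply/matrixP => k l; rewrite !mxE rmorph_sum.
rewrite (eq_bigr _ (fun o _ => cE _ _ _)).
rewrite !sum_hop /=.
rewrite /hop_weight /hop1 /hop2 /hop_perm -!val_eqE /= !inordK //=.
rewrite !mul0r !addr0 !add0r !mul1r !mulN1r !oppr0 !opprK.
have E (s : {perm T}) (a b : T) : (a == s b) = (b == (s^-1 a)%g).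
  by apply/eqP/eqP => [->|->]; rewrite ?permK ?permKV.
rewrite !perm1 (E s1 (enum_val k)) (E s2 (enum_val k)) (E s1^-1 (enum_val k))%g (E s2^-1 (enum_val k))%g !invgK.
rewrite (eq_sym (enum_val l) (enum_val k)).
have [->|kl] := eqVneq (enum_val k) (enum_val l); last by rewrite !mulr0; ring.
by ring.
Qed.

Lemma bloch_det_re v x y : \det (bloch_mx v x y) = ((bloch_det v x y)%:C : C).
Proof.
have re : complex.Re (\det (bloch_mx v x y)) = bloch_det v x y.
  rewrite bloch_det_expand /bloch_det.
  rewrite (big_morph (@complex.Re R) (id1 := 0) (op1 := +%R)) //; last by case=> a b [].
  by apply: eq_bigr => h _ /=; rewrite mul0r subr0.
have : (\det (bloch_mx v x y))^* = \det (bloch_mx v x y).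
  by rewrite -det_map_mx bloch_mx_conj det_tr.
rewrite -re; case: (\det _) => a b [] /= hb; congr (_ +i* _); lra.
Qed.

Lemma bloch_det_im v x y : \sum_(h : hops)
  hop_coef v h * sin ((total1 h)%:~R * x + (total2 h)%:~R * y) = 0.
Proof.
have := congr1 (@complex.Im R) (bloch_det_re v x y); rewrite bloch_det_expand /=.
rewrite (big_morph (@complex.Im R) (id1 := 0) (op1 := +%R)) //; last by case=> a b [].
by move=> E; rewrite -[RHS]E; apply: eq_bigr => h _ /=; rewrite mul0r addr0.
Qed.

Lemma bloch_det0P v x y : bloch_det v x y = 0 <->
  exists phi, (exists m, phi m != 0) /\ forall m, bloch v x y phi m = 0.
Proof.
split=> [D0|[phi [[m m0] h]]].
  have : \det (bloch_mx v x y)^T == 0 by rewrite det_tr bloch_det_re D0.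
  case/det0P=> w w0 wM; exists (fun m => w 0 (enum_rank m)); split.
    have [k wk] : exists k, w 0 k != 0.
      by apply/existsP; apply: contraNT w0 => /existsPn h; apply/eqP/rowP => k; rewrite mxE; apply/eqP; move: (h k); rewrite negbK.
    by exists (enum_val k); rewrite enum_valK.
  move=> m; rewrite -(enum_rankK m) -bloch_mxE.
  move/rowP/(_ (enum_rank m)): wM; rewrite !mxE => E; rewrite -[RHS]E.
  by apply: eq_bigr => l _; rewrite enum_valK mulrC [_^T _ _]mxE.
apply/eqP; rewrite -(inj_eq (@complexI R)) -bloch_det_re -det_tr.
apply/det0P; exists (\row_k phi (enum_val k)).
  apply: contra m0 => /eqP/rowP/(_ (enum_rank m)).
  by rewrite !mxE enum_rankK => ->.
apply/rowP => k; rewrite !mxE -[RHS](h (enum_val k)) -bloch_mxE.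
by apply: eq_bigr => l _; rewrite [_^T _ _]mxE [(\row__ _) _ _]mxE mulrC.
Qed.

End Torus.

(** * Sign changes of the Bloch determinant *)

Section TrigSum.
Variables (R : realType) (X : finType) (c : X -> R) (i : X -> int) (t : X -> R).

Lemma is_derive_cos_sum (x : R) :
  is_derive x 1 (fun x => \sum_h c h * cos ((i h)%:~R * x + t h))
    (- \sum_h (i h)%:~R * (c h * sin ((i h)%:~R * x + t h))).
Proof.
rewrite -sumrN; elim: (index_enum X) => [|h s IH].
  by under eq_fun do rewrite big_nil; rewrite big_nil; exact: is_derive_cst.
under eq_fun do rewrite big_cons; rewrite big_cons; apply: is_deriveD.
have aff : is_derive x 1 (fun x : R => (i h)%:~R * x + t h) (i h)%:~R.
  by apply: is_derive_eq; rewrite addr0 /GRing.scale /= mulr1.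
by apply: is_derive_eq; rewrite /GRing.scale /=; ring.
Qed.

Lemma is_derive_sin_sum (x : R) :
  is_derive x 1 (fun x => \sum_h c h * sin ((i h)%:~R * x + t h))
    (\sum_h (i h)%:~R * (c h * cos ((i h)%:~R * x + t h))).
Proof.
elim: (index_enum X) => [|h s IH].
  by under eq_fun do rewrite big_nil; rewrite big_nil; exact: is_derive_cst.
under eq_fun do rewrite big_cons; rewrite big_cons; apply: is_deriveD.
have aff : is_derive x 1 (fun x : R => (i h)%:~R * x + t h) (i h)%:~R.
  by apply: is_derive_eq; rewrite addr0 /GRing.scale /= mulr1.
by apply: is_derive_eq; rewrite /GRing.scale /=; ring.
Qed.

End TrigSum.

Section DoubleRoot.
Variables (R : realType) (X : finType) (c : X -> R).
Local Notation C := R[i].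
Local Notation g i j := (fun x y => \sum_h c h * cos ((i h)%:~R * x + (j h)%:~R * y)).

Lemma expi_monomial (i j : X -> int) x y h :
  ((c h)%:C * expi x ^ i h * expi y ^ j h : C) =
  (c h * cos ((i h)%:~R * x + (j h)%:~R * y)) +i*
  (c h * sin ((i h)%:~R * x + (j h)%:~R * y)).
Proof.
by rewrite -!expi_int -mulrA -expiD /expi; simpc.
Qed.

Lemma Re_sum (I : finType) (f : I -> C) : complex.Re (\sum_h f h) = \sum_h complex.Re (f h).
Proof. by apply: (big_morph (@complex.Re R) (id1 := 0) (op1 := +%R)) => // -[a b] []. Qed.

Lemma Im_sum (I : finType) (f : I -> C) : complex.Im (\sum_h f h) = \sum_h complex.Im (f h).
Proof. by apply: (big_morph (@complex.Im R) (id1 := 0) (op1 := +%R)) => // -[a b] []. Qed.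

(* At a zero of a real nonnegative trigonometric polynomial, its derivative
   vanishes too, so that the Laurent polynomial has a double root. *)
Lemma nonneg_double_root (i j : X -> int) x y :
  (forall x, \sum_h c h * sin ((i h)%:~R * x + (j h)%:~R * y) = 0) ->
  (forall x, 0 <= g i j x y) -> g i j x y = 0 ->
  \sum_h (c h)%:C * expi x ^ i h * expi y ^ j h = 0 /\
  \sum_h (i h)%:~R * ((c h)%:C * expi x ^ i h * expi y ^ j h) = 0.
Proof.
move=> im0 ge0 eq0.
have dc := is_derive_cos_sum c i (fun h => (j h)%:~R * y).
have ds := is_derive_sin_sum c i (fun h => (j h)%:~R * y) x.
have d0 : is_derive x 1 (g i j ^~ y) 0.
  apply: (@derive1_at_min _ _ (x - 1) (x + 1)); first by lra.
  - by move=> t _; have [] := dc t.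
  - by rewrite in_itv /=; apply/andP; split; lra.
  - by move=> t _; rewrite eq0.
have e1 : \sum_h (i h)%:~R * (c h * sin ((i h)%:~R * x + (j h)%:~R * y)) = 0.
  by case: (dc x) => _; case: d0 => _ -> /esym/eqP; rewrite oppr_eq0 => /eqP.
have e2 : \sum_h (i h)%:~R * (c h * cos ((i h)%:~R * x + (j h)%:~R * y)) = 0.
  case: ds => _ <-; have -> : (fun x => \sum_h c h * sin ((i h)%:~R * x + (j h)%:~R * y)) = cst 0.
    by apply/funext => t; exact: im0.
  by rewrite derive_cst.
under eq_bigr do rewrite expi_monomial.
under [X in _ /\ X = _]eq_bigr do rewrite expi_monomial.
split; apply/eqP; rewrite eq_complex Re_sum Im_sum /=.
  by rewrite eq0 im0 !eqxx.
apply/andP; split; apply/eqP.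
  rewrite -[RHS]e2; apply: eq_bigr => h _.
  have -> : ((i h)%:~R : C) = ((i h)%:~R : R)%:C by rewrite rmorph_int.
  by rewrite /= mul0r subr0.
rewrite -[RHS]e1; apply: eq_bigr => h _.
have -> : ((i h)%:~R : C) = ((i h)%:~R : R)%:C by rewrite rmorph_int.
by rewrite /= mul0r addr0.
Qed.

Lemma nonneg_not_many (n : nat) (i j : X -> int) : (0 < n)%N ->
  diamond (fun h => (c h)%:C) n i j ->
  diamond (fun h => (c h)%:C) n (fun h => - i h) j ->
  (forall x y, \sum_h c h * sin ((i h)%:~R * x + (j h)%:~R * y) = 0) ->
  (forall x y, 0 <= g i j x y) ->
  ~ many [set z | exists x y, z = expi y /\ g i j x y = 0].
Proof.
move=> n0 D1 D2 im0 ge0 mZ.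
have [P P0 hP] := double_root_finite n0 D1 D2.
have [z [x [y [-> gxy]]]] := many_roots mZ P0.
have [e1 e2] := nonneg_double_root (im0^~ y) (ge0 ^~ y) gxy.
by rewrite (hP _ _ (expi_neq0 x) (expi_neq0 y) e1 e2).
Qed.

(** Each of the two projections in [many_lines] takes one resultant, and each resultant takes two
    diamonds, one for the variable and one for its inverse. *)
Lemma nonneg_not_many_lines (n : nat) (i j : X -> int) : (0 < n)%N ->
  diamond (fun h => (c h)%:C) n i j ->
  diamond (fun h => (c h)%:C) n (fun h => - i h) j ->
  diamond (fun h => (c h)%:C) n j i ->
  diamond (fun h => (c h)%:C) n (fun h => - j h) i ->
  (forall x y, \sum_h c h * sin ((i h)%:~R * x + (j h)%:~R * y) = 0) ->
  (forall x y, 0 <= g i j x y) -> ~ many_lines (fun x y => g i j x y = 0).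
Proof.
move=> n0 D1 D2 D3 D4 im0 ge0 [].
  exact: (nonneg_not_many n0 D1 D2).
move=> m; apply: (nonneg_not_many n0 D3 D4).
- by move=> x y; rewrite -[RHS](im0 y x); apply: eq_bigr => h _; rewrite addrC.
- by move=> x y; apply: le_trans (ge0 y x) _; apply/eqP/eqP; rewrite le_eqVlt; apply/orP; left; apply/eqP; apply: eq_bigr => h _; rewrite addrC.
- apply: many_sub m => z [x [y [-> e]]]; exists y, x; split => //.
  by rewrite -[RHS]e; apply: eq_bigr => h _; rewrite addrC.
Qed.

End DoubleRoot.

(** * The vertices of the Newton diamond *)

Section Vertices.
Variables (R : realType) (T : finType) (s1 s2 : {perm T}).
Local Notation C := R[i].
Local Notation n := #|T|.
Implicit Types (v : T -> R).

Lemma hop_sum_le (h : hops T) : (`|total1 h| + `|total2 h| <= n)%N.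
Proof.
have key : `|total1 h| + `|total2 h| <= \sum_(k < n) (1 : int).
  apply: (@le_trans _ _ (\sum_k (`|hop1 (h k)| + `|hop2 (h k)|))).
    by rewrite big_split lerD //= ler_norm_sum.
  by apply: ler_sum => k _; case: (h k) => -[|[|[|[|[|]]]]].
by move: key; rewrite sumr_const card_ord; lia.
Qed.

(** Each of the [n] rows contributes at most 1 to the displacement, so reaching [n] forces the same
    hop in every row. *)
Lemma hop_sum_vertex (d : hop -> int) (o0 : hop) (h : hops T) :
  (forall o, d o <= 1) -> (forall o, d o = 1 -> o = o0) ->
  \sum_k d (h k) = n%:Z -> h = [ffun=> o0].
Proof.
move=> d1 do0 E; apply/ffunP => k; rewrite ffunE; apply: do0.
have : \sum_k (1 - d (h k)) = 0.
  by rewrite sumrB E sumr_const card_ord; lia.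
move/eqP; rewrite psumr_eq0; last by move=> l _; rewrite subr_ge0.
by move/allP/(_ k (mem_index_enum _)) => /=; rewrite subr_eq0 => /eqP.
Qed.

(** Only the permutation induced by the hop itself is compatible with a constant assignment, and the
    potential does not enter, which leaves a sign. *)
Lemma hop_coef_const v (o : hop) : o != 0 ->
  `|(hop_coef s1 s2 v [ffun=> o])%:C : C| = 1.
Proof.
move=> o0.
rewrite /hop_coef big1 ?mulr1; last first.
  by move=> k _; rewrite ffunE /hop_weight (negPf o0).
have inj : injective (fun k : 'I_n => enum_rank (hop_perm s1 s2 o (enum_val k))).
  by move=> k l /enum_rank_inj/perm_inj/enum_val_inj.
pose s0 := perm inj.
rewrite /hop_sign (bigD1 s0) //= [X in _ + X]big1; last first.
  move=> s ss0; apply/eqP; rewrite mulf_eq0; apply/orP; right.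
  have [k hk] : exists k, s k != s0 k.
    by apply/existsP; apply: contraNT ss0 => /existsPn h; apply/eqP/permP => k; apply/eqP; move: (h k); rewrite negbK.
  apply/prodf_eq0; exists k => //; rewrite ffunE.
  have -> : (enum_val (s k) == hop_perm s1 s2 o (enum_val k)) = false => //.
  by apply/negP => /eqP E; case/negP: hk; rewrite permE -E enum_valK.
rewrite addr0 big1 ?mulr1; last by move=> k _; rewrite permE ffunE enum_rankK eqxx.
rewrite rmorphXn rmorphN1 normrX normrN1 expr1n //.
Qed.

(* A hop assignment with nonzero sign is a permutation, so summing the
   coordinate displacements over all sites gives 0 modulo the period. *)
Lemma hop_sign_dvd (f : T -> nat) (d : hop -> int) (a : nat) (h : hops T) :
  (forall o m, (a %| (f (hop_perm s1 s2 o m))%:Z - (f m)%:Z - d o)%Z) ->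
  hop_sign R s1 s2 h != 0 -> (a %| \sum_k d (h k))%Z.
Proof.
move=> hf; rewrite /hop_sign => S0.
have [s hs] : exists s : 'S_n, forall k, enum_val (s k) = hop_perm s1 s2 (h k) (enum_val k).
  apply: contrapT => /forallNP none; move/eqP: S0; apply; apply: big1 => s _.
  have [k hk] : exists k, enum_val (s k) != hop_perm s1 s2 (h k) (enum_val k).
    apply: contrapT => /forallNP h'; apply: (none s) => k; apply/eqP.
    by move/negP: (h' k); rewrite negbK.
  apply/eqP; rewrite mulf_eq0; apply/orP; right.
  by apply/prodf_eq0; exists k => //; rewrite (negPf hk).
have -> : \sum_k d (h k) = - \sum_k ((f (hop_perm s1 s2 (h k) (enum_val k)))%:Z - (f (enum_val k))%:Z - d (h k)).
  rewrite sumrB sumrB; under [X in _ = - (X - _ - _)]eq_bigr do rewrite -hs.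
  by rewrite -(reindex_inj (P := predT) (F := fun k : 'I_n => (f (enum_val k))%:Z) (@perm_inj _ s)) subrr sub0r opprK.
by rewrite rpredN; apply: rpred_sum => k _; exact: hf.
Qed.

End Vertices.

Section Signs.
Variables (R : realType) (T : finType) (s1 s2 : {perm T}) (a b : nat) (f1 f2 : T -> nat).
Hypotheses (cardT : #|T| = (a * b)%N) (a_gt0 : (0 < a)%N) (b_gt0 : (0 < b)%N).
Hypothesis ab : coprime a b.
Hypothesis hf1 : forall o m, (a %| (f1 (hop_perm s1 s2 o m))%:Z - (f1 m)%:Z - hop1 o)%Z.
Hypothesis hf2 : forall o m, (b %| (f2 (hop_perm s1 s2 o m))%:Z - (f2 m)%:Z - hop2 o)%Z.
Local Notation C := R[i].
Local Notation D := (bloch_det s1 s2).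
Implicit Types (v : T -> R).

Lemma total_edge v (h : hops T) : hop_coef s1 s2 v h != 0 ->
  (`|total1 h| + `|total2 h|)%N = #|T| -> (total1 h == 0) || (total2 h == 0).
Proof.
rewrite mulf_eq0 negb_or => /andP[s0 _].
have := hop_sign_dvd hf1 s0; have := hop_sign_dvd hf2 s0.
rewrite -/(total1 h) -/(total2 h) cardT /dvdz /=.
move: (total1 h) (total2 h) => i j /dvdnP[k kj] /dvdnP[l li].
rewrite kj li => E.
(* From [l * a + k * b = a * b] one gets [l * a = (a - k) * b], so coprimality applies; then [l] is
   a multiple of [b] with [l * a <= a * b], hence 0 or [b]. *)
have : (b %| l)%N.
  rewrite -(@Gauss_dvdr b a l) ?(coprime_sym b) //.
  by apply/dvdnP; exists (a - k)%N; rewrite mulnBl (mulnC a l); lia.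
move=> /dvdnP[m lm]; move: E; rewrite lm => E.
case: m => [|[|m]] in lm E; first by apply/orP; left; lia.
- by apply/orP; right; move: E; rewrite mul1n mulnC; lia.
- by move: E a_gt0 b_gt0; nia.
Qed.

Lemma diamonds v : let c h := (hop_coef s1 s2 v h)%:C in
  [/\ diamond c #|T| (@total1 T) (@total2 T),
      diamond c #|T| (fun h => - total1 h) (@total2 T),
      diamond c #|T| (@total2 T) (@total1 T) &
      diamond c #|T| (fun h => - total2 h) (@total1 T)].
Proof.
have c0 h : (hop_coef s1 s2 v h)%:C != 0 :> C -> hop_coef s1 s2 v h != 0.
  by apply: contra => /eqP ->.
have V1 : exists h0 : hops T, [/\ total1 h0 = #|T|%:Z, `|(hop_coef s1 s2 v h0)%:C : C| = 1
     & forall h, total1 h = #|T|%:Z -> h = h0].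
  exists [ffun=> 1]; split; last by move=> h; apply: hop_sum_vertex => -[[|[|[|[|[|]]]]]] // ? _; exact: val_inj.
    by rewrite /total1; under eq_bigr do rewrite ffunE /hop1 /=; rewrite sumr_const card_ord; lia.
  exact: hop_coef_const.
have V2 : exists h0 : hops T, [/\ - total1 h0 = #|T|%:Z, `|(hop_coef s1 s2 v h0)%:C : C| = 1
     & forall h, - total1 h = #|T|%:Z -> h = h0].
  exists [ffun=> inord 2]; split.
  - by rewrite /total1; under eq_bigr do rewrite ffunE /hop1 inordK //=; rewrite sumr_const card_ord; lia.
  - by apply: hop_coef_const; rewrite -val_eqE /= inordK.
  - by move=> h; rewrite /total1 -sumrN; apply: (@hop_sum_vertex _ (fun o => - hop1 o)) => -[[|[|[|[|[|]]]]]] // ? _; apply: val_inj; rewrite /= inordK.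
have V3 : exists h0 : hops T, [/\ total2 h0 = #|T|%:Z, `|(hop_coef s1 s2 v h0)%:C : C| = 1
     & forall h, total2 h = #|T|%:Z -> h = h0].
  exists [ffun=> inord 3]; split.
  - by rewrite /total2; under eq_bigr do rewrite ffunE /hop2 inordK //=; rewrite sumr_const card_ord; lia.
  - by apply: hop_coef_const; rewrite -val_eqE /= inordK.
  - by move=> h; apply: hop_sum_vertex => -[[|[|[|[|[|]]]]]] // ? _; apply: val_inj; rewrite /= inordK.
have V4 : exists h0 : hops T, [/\ - total2 h0 = #|T|%:Z, `|(hop_coef s1 s2 v h0)%:C : C| = 1
     & forall h, - total2 h = #|T|%:Z -> h = h0].
  exists [ffun=> inord 4]; split.
  - by rewrite /total2; under eq_bigr do rewrite ffunE /hop2 inordK //=; rewrite sumr_const card_ord; lia.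
  - by apply: hop_coef_const; rewrite -val_eqE /= inordK.
  - by move=> h; rewrite /total2 -sumrN; apply: (@hop_sum_vertex _ (fun o => - hop2 o)) => -[[|[|[|[|[|]]]]]] // ? _; apply: val_inj; rewrite /= inordK.
have hs := @hop_sum_le T.
split; split => //= h.
- by move=> /c0; exact: total_edge.
- by rewrite abszN.
- by move=> /c0 ch; rewrite abszN oppr_eq0; exact: total_edge ch.
- by rewrite addnC.
- by move=> /c0 ch; rewrite addnC orbC; exact: total_edge ch.
- by rewrite abszN addnC.
- by move=> /c0 ch; rewrite abszN oppr_eq0 addnC orbC; exact: total_edge ch.
Qed.

Lemma card_gt0 : (0 < #|T|)%N.
Proof. by rewrite cardT muln_gt0 a_gt0. Qed.

Lemma bloch_det_signs v : many_lines (fun x y => D v x y = 0) ->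
  (exists x y, D v x y < 0) /\ (exists x y, 0 < D v x y).
Proof.
move=> Z; have [D1 D2 D3 D4] := diamonds v; split; apply: contrapT => /forallNP h.
  apply: (nonneg_not_many_lines card_gt0 D1 D2 D3 D4) Z; first by move=> x y; exact: bloch_det_im.
  by move=> x y; rewrite leNgt; apply/negP => hxy; apply: (h x); exists y.
have dN i j : diamond (fun h => (hop_coef s1 s2 v h)%:C : C) #|T| i j ->
     diamond (fun h => (- hop_coef s1 s2 v h)%:C : C) #|T| i j.
  case=> p1 p2 [h0 [q1 q2 q3]] [h2 [r1 r2 r3]]; split => //.
  - by move=> k; rewrite rmorphN oppr_eq0; exact: p2.
  - by exists h0; split => //; rewrite rmorphN normrN.
  - by exists h2; split => //; rewrite rmorphN normrN.
apply: (nonneg_not_many_lines card_gt0 (dN _ _ D1) (dN _ _ D2) (dN _ _ D3) (dN _ _ D4)).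
- move=> x y; under eq_bigr do rewrite mulNr.
  by rewrite sumrN bloch_det_im oppr0.
- move=> x y; under eq_bigr do rewrite mulNr.
  rewrite sumrN oppr_ge0 leNgt; apply/negP => hxy; apply: (h x); exists y; exact: hxy.
- apply: many_lines_sub Z => x y E; under eq_bigr do rewrite mulNr.
  by rewrite sumrN -/(bloch_det s1 s2 v x y) E oppr0.
Qed.

(** An identically zero determinant would have infinitely many zeros, and [bloch_det_signs] would
    then give it negative values. *)
Lemma bloch_det_neq0 v : exists x y, D v x y != 0.
Proof.
apply: contrapT => /forallNP none.
have D0 x y : D v x y = 0.
  by apply/eqP; apply: contrapT => /negP h; apply: (none x); exists y.
have [[x [y]]] : (exists x y, D v x y < 0) /\ (exists x y, 0 < D v x y).
  apply: bloch_det_signs; left; apply: (@many_arc _ _ 0); near=> y.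
  by exists 0, y.
by rewrite D0 ltxx.
Unshelve. all: by end_near. Qed.

End Signs.

(** * Positivity of the Bloch form *)

Section ComplexDot.
Variable R : realType.
Local Notation C := R[i].
Implicit Types z w : C.

Definition nsq z : R := complex.Re z ^+ 2 + complex.Im z ^+ 2.
Definition rdot z w : R := complex.Re z * complex.Re w + complex.Im z * complex.Im w.
(** With [rdot] as real part, this is the imaginary part of [z] times the conjugate of [w]. *)
Definition rcross z w : R := complex.Im z * complex.Re w - complex.Re z * complex.Im w.

Lemma nsq_ge0 z : 0 <= nsq z.
Proof. by rewrite addr_ge0 // sqr_ge0. Qed.

Lemma nsq_eq0 z : (nsq z == 0) = (z == 0).
Proof.
by case: z => a b; rewrite eq_complex /nsq /= paddr_eq0 ?sqr_ge0 // !sqrf_eq0.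
Qed.

Lemma nsqE z : nsq z = ComplexField.Normc.normc z ^+ 2.
Proof. by case: z => a b; rewrite /nsq /= sqr_sqrtr // addr_ge0 ?sqr_ge0. Qed.

Lemma nsqM z w : nsq (z * w) = nsq z * nsq w.
Proof. by rewrite !nsqE ComplexField.Normc.normcM exprMn. Qed.

Lemma rdotzz z : rdot z z = nsq z.
Proof. by rewrite /rdot /nsq !expr2. Qed.

Lemma rdotC z w : rdot z w = rdot w z.
Proof. by rewrite /rdot; ring. Qed.

Lemma rdotDr z w w' : rdot z (w + w') = rdot z w + rdot z w'.
Proof. by case: z w w' => [a b] [c d] [e f]; rewrite /rdot /=; ring. Qed.

Lemma rdot_le z w : `|rdot z w| <= (nsq z + nsq w) / 2.
Proof.
case: z w => [a b] [c d]; rewrite ler_norml /rdot /nsq /=.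
have := (sqr_ge0 (a - c), sqr_ge0 (b - d), sqr_ge0 (a + c), sqr_ge0 (b + d)).
by rewrite !expr2 => -[[[]]] *; apply/andP; split; lra.
Qed.

Lemma rcross_le z w : `|rcross z w| <= (nsq z + nsq w) / 2.
Proof.
case: z w => [a b] [c d]; rewrite ler_norml /rcross /nsq /=.
have := (sqr_ge0 (a - d), sqr_ge0 (b - c), sqr_ge0 (a + d), sqr_ge0 (b + c)).
by rewrite !expr2 => -[[[]]] *; apply/andP; split; lra.
Qed.

Lemma rdot_expi z w (x : R) :
  rdot z (expi x * w) = cos x * rdot z w + sin x * rcross z w.
Proof. by case: z w => [a b] [c d]; rewrite /rdot /rcross /expi /=; ring. Qed.

Lemma nsq_expi (x : R) z : nsq (expi x * z) = nsq z.
Proof. by rewrite nsqM nsqE normc_expi expr1n mul1r. Qed.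

Lemma rdot_expiJ (x : R) z w : rdot (expi x * z) w = rdot z (expi (- x) * w).
Proof.
case: z w => [a b] [c d]; rewrite /rdot /expi /= cosN sinN; ring.
Qed.

Lemma rdot_ge_norm (x : R) z w : - (Num.sqrt (nsq z) * Num.sqrt (nsq w)) <= rdot z (expi x * w).
Proof.
suff : rdot z (expi x * w) ^+ 2 <= nsq z * nsq w.
  move=> h; rewrite -sqrtrM ?nsq_ge0 // lerNl.
  rewrite (le_trans _ (ler_wsqrtr h)) // sqrtr_sqr -normrN ler_norm //.
rewrite -(nsq_expi x w); case: z (expi x * w) => [a b] [c d]; rewrite /rdot /nsq /=.
by have := sqr_ge0 (a * d - b * c); rewrite !expr2; lra.
Qed.

Lemma mx_bound (n : nat) (A : 'M[C]_n) : exists2 B : R, 0 <= B &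
  forall f : 'I_n -> C, \sum_k nsq (\sum_l A k l * f l) <= B * \sum_l nsq (f l).
Proof.
pose nc (z : C) := ComplexField.Normc.normc z.
have nc0 z : 0 <= nc z by case: z => a b; exact: sqrtr_ge0.
exists (\sum_k (\sum_l nc (A k l)) ^+ 2); first by apply: sumr_ge0 => k _; exact: sqr_ge0.
move=> f; rewrite mulr_suml; apply: ler_sum => k _.
set S := \sum_l nsq _.
have S0 : 0 <= S by apply: sumr_ge0 => l _; exact: nsq_ge0.
have fS l : nc (f l) <= Num.sqrt S.
  rewrite -(ler_pXn2r (ltn0Sn 1)) ?nnegrE ?sqrtr_ge0 // sqr_sqrtr // -nsqE.
  by rewrite /S (bigD1 l) //= lerDl; apply: sumr_ge0 => i _; exact: nsq_ge0.
rewrite nsqE -[leRHS]/(_ * S) -[X in _ <= _ * X](sqr_sqrtr S0) -exprMn ler_pXn2r ?nnegrE ?nc0 //; last first.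
  by rewrite mulr_ge0 ?sqrtr_ge0 ?sumr_ge0.
rewrite -/(nc _) mulr_suml.
apply: (@le_trans _ _ (\sum_l nc (A k l * f l))).
  elim/big_ind2: _ => //; first by rewrite /nc ComplexField.Normc.normc0.
  by move=> x1 x2 y1 y2 h1 h2; rewrite (le_trans (le_normcD _ _)) // lerD.
by apply: ler_sum => l _; rewrite /nc ComplexField.Normc.normcM ler_wpM2l.
Qed.

End ComplexDot.

Section Forms.
Variables (R : realType) (T : finType) (s1 s2 : {perm T}).
Local Notation C := R[i].
Implicit Types (v : T -> R) (x y : R) (phi psi : T -> C).
Local Notation bloch := (bloch s1 s2).
Local Notation D := (bloch_det s1 s2).

Definition norm2 phi : R := \sum_m nsq (phi m).
Definition form v x y phi : R := \sum_m rdot (phi m) (bloch v x y phi m).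

Lemma norm2_ge0 phi : 0 <= norm2 phi.
Proof. by apply: sumr_ge0 => m _; exact: nsq_ge0. Qed.

Lemma sum_perm (s : {perm T}) (f : T -> R) : \sum_m f (s m) = \sum_m f m.
Proof. by rewrite [RHS](reindex_inj (@perm_inj _ s)). Qed.

Lemma formE v x y phi : form v x y phi = \sum_m v m * nsq (phi m)
  + 2 * \sum_m rdot (phi m) (expi x * phi (s1 m))
  + 2 * \sum_m rdot (phi m) (expi y * phi (s2 m)).
Proof.
have bwd (s : {perm T}) t : \sum_m rdot (phi m) (expi (- t) * phi (s^-1 m)%g) =
    \sum_m rdot (phi m) (expi t * phi (s m)).
  rewrite -(sum_perm s); apply: eq_bigr => m _.
  by rewrite permK -[LHS]rdot_expiJ rdotC.
have -> : form v x y phi = \sum_m rdot (phi m) ((v m)%:C * phi m) +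
   (\sum_m rdot (phi m) (expi x * phi (s1 m)) + \sum_m rdot (phi m) (expi (- x) * phi (s1^-1 m)%g)) +
   (\sum_m rdot (phi m) (expi y * phi (s2 m)) + \sum_m rdot (phi m) (expi (- y) * phi (s2^-1 m)%g)).
  by rewrite -!big_split; apply: eq_bigr => m _; rewrite /= -!rdotDr.
rewrite !bwd !mulr2n !mulrDl !mul1r.
congr (_ + _ + _); apply: eq_bigr => m _.
by case: (phi m) => a b; rewrite /rdot /nsq /=; ring.
Qed.

Lemma bloch_sym v x y phi psi :
  \sum_m rdot (bloch v x y phi m) (psi m) = \sum_m rdot (phi m) (bloch v x y psi m).
Proof.
have mv (s : {perm T}) t : \sum_m rdot (expi t * phi (s m)) (psi m) =
    \sum_m rdot (phi m) (expi (- t) * psi (s^-1 m)%g).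
  rewrite -[RHS](sum_perm s); apply: eq_bigr => m _.
  by rewrite permK rdot_expiJ.
have split_bloch f g t u : \sum_m rdot (f m) (bloch v t u g m) =
   \sum_m rdot (f m) ((v m)%:C * g m) +
   (\sum_m rdot (f m) (expi t * g (s1 m)) + \sum_m rdot (f m) (expi (- t) * g (s1^-1 m)%g)) +
   (\sum_m rdot (f m) (expi u * g (s2 m)) + \sum_m rdot (f m) (expi (- u) * g (s2^-1 m)%g)).
  by rewrite -!big_split; apply: eq_bigr => m _; rewrite /= -!rdotDr.
under eq_bigr do rewrite rdotC.
rewrite !split_bloch.
have mv' (s : {perm T}) t : \sum_m rdot (psi m) (expi t * phi (s m)) =
    \sum_m rdot (phi m) (expi (- t) * psi (s^-1 m)%g).
  by rewrite -mv; apply: eq_bigr => m _; rewrite rdotC.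
rewrite !mv' !opprK !invgK; congr (_ + _ + _); [|exact: addrC|exact: addrC].
apply: eq_bigr => m _.
by case: (phi m) (psi m) => a b [c d]; rewrite /rdot /=; ring.
Qed.

Definition trig_dist x x' : R := `|cos x - cos x'| + `|sin x - sin x'|.

(** By [rdot_expi] each hopping sum is linear in the cosine and sine of its angle, with coefficients
    at most [norm2 phi] in absolute value. *)
Lemma form_perturb v v' x x' y y' d phi : (forall m, v m - d <= v' m) ->
  form v x y phi - (d + 2 * (trig_dist x x' + trig_dist y y')) * norm2 phi
    <= form v' x' y' phi.
Proof.
move=> hd; rewrite !formE.
have half (s : {perm T}) t t' :
   \sum_m rdot (phi m) (expi t * phi (s m)) - trig_dist t t' * norm2 phi <=
   \sum_m rdot (phi m) (expi t' * phi (s m)).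
  rewrite lerBlDl -lerBlDr -sumrB.
  have -> : norm2 phi = \sum_m (nsq (phi m) + nsq (phi (s m))) / 2.
    by rewrite -mulr_suml big_split /= (sum_perm s (fun m => nsq (phi m))) -/(norm2 _); field.
  rewrite mulr_sumr; apply: ler_sum => m _; rewrite !rdot_expi.
  have h1 := rdot_le (phi m) (phi (s m)); have h2 := rcross_le (phi m) (phi (s m)).
  set A := rdot _ _ in h1 *; set B := rcross _ _ in h2 *.
  have -> : cos t * A + sin t * B - (cos t' * A + sin t' * B) =
    (cos t - cos t') * A + (sin t - sin t') * B by ring.
  rewrite /trig_dist [leRHS]mulrDl; apply: (le_trans (ler_norm _)).
  by apply: (le_trans (ler_normD _ _)); rewrite !normrM lerD // ler_wpM2l.
have := half s1 x x'; have := half s2 y y'.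
have : \sum_m v m * nsq (phi m) - d * norm2 phi <= \sum_m v' m * nsq (phi m).
  rewrite mulr_sumr -sumrB; apply: ler_sum => m _.
  by rewrite -mulrBl ler_wpM2r ?nsq_ge0.
lra.
Qed.

Definition posdef v x y := exists2 c : R, 0 < c & forall phi, c * norm2 phi <= form v x y phi.
Definition notpos v x y := exists phi, form v x y phi < 0.

Lemma notpos_posdef v x y : notpos v x y -> ~ posdef v x y.
Proof.
move=> [phi h] [c c0 hc]; have := hc phi; rewrite leNgt => /negP; apply.
by rewrite (lt_le_trans h) // mulr_ge0 ?norm2_ge0 // ltW.
Qed.

Lemma trig_dist_near x (e : R) : 0 < e -> \forall x' \near x, trig_dist x x' < e.
Proof.
move=> e0; have : trig_dist x x' @[x' --> x] --> trig_dist x x.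
  by apply: cvgD; apply: cvg_norm; apply: cvgB; [exact: cvg_cst|exact: continuous_cos|exact: cvg_cst|exact: continuous_sin].
rewrite /trig_dist !subrr normr0 addr0 => /cvgr_lt; exact.
Qed.

Lemma trig_distC x x' : trig_dist x x' = trig_dist x' x.
Proof. by rewrite /trig_dist distrC [`|sin x - _|]distrC. Qed.

Lemma trig_distxx x : trig_dist x x = 0.
Proof. by rewrite /trig_dist !subrr normr0 addr0. Qed.

Lemma posdef_near v v' x x' y y' c d : 
  (forall phi, c * norm2 phi <= form v x y phi) -> (forall m, v m - d <= v' m) ->
  d + 2 * (trig_dist x x' + trig_dist y y') < c -> posdef v' x' y'.
Proof.
move=> hc hd dc; exists (c - (d + 2 * (trig_dist x x' + trig_dist y y'))).
  by rewrite subr_gt0.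
move=> phi; rewrite mulrBl; apply: le_trans (form_perturb _ _ _ _ phi hd).
by rewrite lerB.
Qed.

Lemma posdef_openx v x y : posdef v x y -> \forall x' \near x, posdef v x' y.
Proof.
move=> [c c0 hc]; near=> x'; apply: (posdef_near hc (d := 0)).
  by move=> m; rewrite subr0.
rewrite trig_distxx add0r addr0.
have : trig_dist x x' < c / 2 by near: x'; apply: trig_dist_near; rewrite divr_gt0.
lra.
Unshelve. all: by end_near. Qed.

Lemma posdef_openy v x y : posdef v x y -> \forall y' \near y, posdef v x y'.
Proof.
move=> [c c0 hc]; near=> y'; apply: (posdef_near hc (d := 0)).
  by move=> m; rewrite subr0.
rewrite trig_distxx add0r add0r.
have : trig_dist y y' < c / 2 by near: y'; apply: trig_dist_near; rewrite divr_gt0.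
lra.
Unshelve. all: by end_near. Qed.

Lemma notpos_near v x y phi : form v x y phi < 0 -> exists2 e : R, 0 < e &
  forall x' y', trig_dist x x' + trig_dist y y' < e -> form v x' y' phi < 0.
Proof.
move=> f0; have n0 := norm2_ge0 phi.
pose e := - form v x y phi / (4 * (norm2 phi + 1)).
have e0 : 0 < e by rewrite divr_gt0 ?oppr_gt0 // mulr_gt0 // ltr_wpDl.
exists e => // x' y' h.
have := @form_perturb v v x' x y' y 0 phi (fun m => eq_ind_r (fun t => t <= v m) (lexx _) (subr0 _)).
rewrite (trig_distC x') (trig_distC y') add0r => h'.
have he : e * (norm2 phi + 1) = - form v x y phi / 4.
  by rewrite /e; field; rewrite gt_eqF // ltr_wpDl.
have : (trig_dist x x' + trig_dist y y') * norm2 phi <= e * (norm2 phi + 1).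
  rewrite ler_pM ?addr_ge0 ?normr_ge0 //; first by rewrite ltW.
  by rewrite lerDl.
lra.
Qed.

Lemma notpos_openx v x y : notpos v x y -> \forall x' \near x, notpos v x' y.
Proof.
move=> [phi /notpos_near[e e0 h]]; near=> x'; exists phi; apply: h.
by rewrite trig_distxx addr0; near: x'; exact: trig_dist_near.
Unshelve. all: by end_near. Qed.

Lemma notpos_openy v x y : notpos v x y -> \forall y' \near y, notpos v x y'.
Proof.
move=> [phi /notpos_near[e e0 h]]; near=> y'; exists phi; apply: h.
by rewrite trig_distxx add0r; near: y'; exact: trig_dist_near.
Unshelve. all: by end_near. Qed.

Lemma sum_enum_val (f : T -> R) : \sum_m f m = \sum_(k < #|T|) f (enum_val k).
Proof. by rewrite (reindex (@enum_val _ T)) //=; exact/onW_bij/enum_val_bij. Qed.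

Lemma bloch_lin v x y phi psi (s : R) m :
  bloch v x y (fun m => phi m + s%:C * psi m) m = bloch v x y phi m + s%:C * bloch v x y psi m.
Proof. by rewrite /bloch; ring. Qed.

(* For a nonnegative invertible Hermitian H, the inequality form(phi - s H phi) >= 0
   with s small bounds |H phi|^2, hence |phi|^2, by a multiple of form(phi). *)
Lemma psd_posdef v x y : ~ notpos v x y -> D v x y != 0 -> posdef v x y.
Proof.
move=> psd D0.
have fge0 phi : 0 <= form v x y phi.
  by rewrite leNgt; apply/negP => h; apply: psd; exists phi.
have [B B0 hB] := mx_bound (bloch_mx s1 s2 v x y).
have nH phi : norm2 (bloch v x y phi) <= B * norm2 phi.
  rewrite /norm2 !sum_enum_val (le_trans _ (hB _)) // ler_sum // => k _.
  by rewrite bloch_mxE.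
have U : bloch_mx s1 s2 v x y \in unitmx.
  by rewrite unitmxE bloch_det_re unitfE; apply: contra D0 => /eqP/complexI ->.
have [K K0 hK] := mx_bound (invmx (bloch_mx s1 s2 v x y)).
have nK phi : norm2 phi <= K * norm2 (bloch v x y phi).
  rewrite /norm2 !sum_enum_val (le_trans _ (hK _)) // ler_sum // => k _.
  apply/eqP/eqP; rewrite le_eqVlt; apply/orP; left; apply/eqP; congr nsq.
  pose w : 'cV[C]_#|T| := \col_k phi (enum_val k).
  have : invmx (bloch_mx s1 s2 v x y) *m (bloch_mx s1 s2 v x y *m w) = w.
    by rewrite mulmxA mulVmx // mul1mx.
  move/matrixP/(_ k 0); rewrite [RHS]mxE => <-; rewrite [LHS]mxE; apply: eq_bigr => l _.
  rewrite [(_ *m w) _ _]mxE -bloch_mxE; congr (_ * _).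
  by apply: eq_bigr => j _; rewrite [w _ _]mxE.
(* [rdot_le] bounds the form by half of [norm2 psi] plus half of the squared norm of its image,
   hence by [A * norm2 psi]; the small step is then [s = A^-1]. *)
pose A := (1 + B) / 2.
have A0 : 0 < A by rewrite divr_gt0 // ltr_pwDl.
have fle psi : form v x y psi <= A * norm2 psi.
  apply: (@le_trans _ _ ((norm2 psi + norm2 (bloch v x y psi)) / 2)).
    rewrite /form /norm2 -big_split /= mulr_suml ler_sum // => m _.
    exact: le_trans (ler_norm _) (rdot_le _ _).
  by rewrite /A; have := nH psi; lra.
have main phi : norm2 (bloch v x y phi) <= A * form v x y phi.
  set psi := bloch v x y phi.
  have := fge0 (fun m => phi m + (- A^-1)%:C * psi m).
  have -> : form v x y (fun m => phi m + (- A^-1)%:C * psi m) =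
    form v x y phi - 2 * A^-1 * norm2 psi + A^-1 ^+ 2 * form v x y psi.
    have sy := bloch_sym v x y phi psi.
    have -> : form v x y (fun m => phi m + (- A^-1)%:C * psi m) =
      \sum_m (rdot (phi m) (bloch v x y phi m) - A^-1 * rdot (phi m) (bloch v x y psi m)
        - A^-1 * nsq (psi m) + A^-1 ^+ 2 * rdot (psi m) (bloch v x y psi m)).
      apply: eq_bigr => m _; rewrite bloch_lin -/psi.
      case: (phi m) (psi m) (bloch v x y psi m) => [a b] [c d] [e f].
      by rewrite /rdot /nsq /=; ring.
    rewrite big_split sumrB sumrB /= -!mulr_sumr -sy.
    under [X in _ - A^-1 * X - _]eq_bigr do rewrite rdotzz.
    by rewrite /form /norm2; ring.
  have : A^-1 ^+ 2 * form v x y psi <= A^-1 * norm2 psi.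
    have := fle psi; rewrite -(ler_pM2l (exprn_gt0 2 (_ : 0 < A^-1))) ?invr_gt0 // => h.
    by apply: (le_trans h); rewrite mulrA expr2 -(mulrA A^-1) mulVf ?mulr1 // gt_eqF.
  move=> h1 h2; have : A^-1 * norm2 psi <= form v x y phi by lra.
  by rewrite ler_pdivrMl.
have AK : 0 < A * (K + 1) by rewrite mulr_gt0 // ltr_wpDl.
exists (A * (K + 1))^-1; first by rewrite invr_gt0.
move=> phi; rewrite ler_pdivrMl //.
apply: (le_trans (nK phi)).
rewrite (mulrC A) -mulrA ler_pM ?norm2_ge0 //.
by rewrite lerDl.
Qed.

End Forms.

(** * Stability of infinite zero sets *)

Section Low.
Variables (R : realType) (T : finType) (s1 s2 : {perm T}).
Local Notation C := R[i].
Implicit Types (v : T -> R) (x y : R) (phi psi : T -> C).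
Local Notation bloch := (bloch s1 s2).
Local Notation D := (bloch_det s1 s2).
Local Notation form := (form s1 s2).

(* The form of the operator at quasi-momentum (pi, pi), where its infimum over all
   quasi-momenta is attained, takes a negative value. *)
Definition low v : Prop := exists f : T -> R,
  \sum_m v m * f m ^+ 2 - 2 * \sum_m f m * f (s1 m) - 2 * \sum_m f m * f (s2 m) < 0.

Lemma low_notpos v : low v -> notpos s1 s2 v pi pi.
Proof.
move=> [f hf]; exists (fun m => (f m)%:C); rewrite formE.
have E (s : {perm T}) : \sum_m rdot (f m)%:C (expi pi * (f (s m))%:C) = - \sum_m f m * f (s m).
  rewrite -sumrN; apply: eq_bigr => m _.
  by rewrite /rdot /expi cospi sinpi /=; ring.
rewrite !E !mulrN; apply: le_lt_trans hf; rewrite !lerD // ler_sum // => m _.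
by rewrite /nsq /= expr0n addr0.
Qed.

(** Diamagnetic inequality: replacing [phi] by its modulus and both phases by -1 keeps the potential
    term and can only lower the hopping terms. *)
Lemma not_low_psd v x y : ~ low v -> ~ notpos s1 s2 v x y.
Proof.
move=> nl [phi h]; apply: nl; exists (fun m => Num.sqrt (nsq (phi m))).
apply: le_lt_trans h; rewrite formE.
have E (s : {perm T}) t : - \sum_m Num.sqrt (nsq (phi m)) * Num.sqrt (nsq (phi (s m)))
    <= \sum_m rdot (phi m) (expi t * phi (s m)).
  by rewrite -sumrN ler_sum // => m _; exact: rdot_ge_norm.
have := E s1 x; have := E s2 y.
have -> : \sum_m v m * Num.sqrt (nsq (phi m)) ^+ 2 = \sum_m v m * nsq (phi m).
  by apply: eq_bigr => m _; rewrite sqr_sqrtr // nsq_ge0.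
lra.
Qed.

(** By Cauchy-Schwarz the hopping terms are at most 4 times the squared norm of [f]. This is what
    confines the relevant energies to a bounded window. *)
Lemma low_bound v : low v -> exists m, v m < 4.
Proof.
move=> [f]; apply: contraPP => /forallNP h; apply/negP; rewrite -leNgt.
have cs (s : {perm T}) : 2 * \sum_m f m * f (s m) <= 2 * \sum_m f m ^+ 2.
  have -> : 2 * \sum_m f m ^+ 2 = \sum_m (f m ^+ 2 + f (s m) ^+ 2).
    by rewrite big_split /= (sum_perm s (fun m => f m ^+ 2)); ring.
  rewrite mulr_sumr ler_sum // => m _.
  by have := sqr_ge0 (f m - f (s m)); rewrite !expr2; lra.
have : 4 * \sum_m f m ^+ 2 <= \sum_m v m * f m ^+ 2.
  rewrite mulr_sumr ler_sum // => m _; rewrite ler_wpM2r ?sqr_ge0 //.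
  by rewrite leNgt; apply/negP => /h.
have := cs s1; have := cs s2; lra.
Qed.

Lemma cvg_bloch_det (I : Type) (F : set_system I) (v : I -> T -> R) (x y : I -> R) v0 x0 y0 :
  Filter F -> (forall m, v i m @[i --> F] --> v0 m) -> x i @[i --> F] --> x0 -> y i @[i --> F] --> y0 ->
  D (v i) (x i) (y i) @[i --> F] --> D v0 x0 y0.
Proof.
move=> FF hv hx hy; rewrite /bloch_det.
apply: (cvg_big add_continuous (Ff := fun h i => _)) => h _.
apply: cvgM; last first.
  have hl : (total1 h)%:~R * x i + (total2 h)%:~R * y i @[i --> F] -->
      (total1 h)%:~R * x0 + (total2 h)%:~R * y0.
    by apply: cvgD; apply: cvgM => //; exact: cvg_cst.
  exact: (cvg_comp _ _ hl (@continuous_cos R _)).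
rewrite /hop_coef; apply: cvgM; first exact: cvg_cst.
apply: (cvg_big mul_continuous (Ff := fun k i => _)) => k _.
by rewrite /hop_weight; case: ifP => _ //; exact: cvg_cst.
Qed.

Definition close_to v (e : R) := [set v' | forall m, `|v' m - v m| < e].

Lemma bloch_det_robust v x y (P : R -> Prop) : (\forall t \near D v x y, P t) ->
  exists2 e : R, 0 < e & forall v', close_to v e v' -> P (D v' x y).
Proof.
move=> hP.
pose F := filter_from [set e : R | 0 < e] (close_to v).
have FF : Filter F.
  apply: filter_from_filter; first by exists 1 => /=.
  move=> e e' /= e0 e0'; exists (Num.min e e'); first by rewrite /= lt_min e0.
  by move=> v' h; split=> m; have := h m; rewrite lt_min => /andP[].
have hv m : v' m @[v' --> F] --> v m.
  apply/cvgrPdist_lt => e e0; exists e => // v' /(_ m).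
  by rewrite distrC.
have hD : D v' x y @[v' --> F] --> D v x y.
  by apply: (@cvg_bloch_det _ F id (cst x) (cst y)) => //; exact: cvg_cst.
by have [e e0 h] := hD _ hP; exists e.
Qed.

(** Adding [pi] to both quasi-momenta reverses the hopping, so the operator becomes the opposite of
    the one for [- v]. The top of the spectrum is thereby treated as a bottom. *)
Lemma many_lines_shift_pi v : many_lines (fun x y => D (fun m => - v m) x y = 0) ->
  many_lines (fun x y => D v x y = 0).
Proof.
have piE (t : R) : expi (t + pi) = - expi t.
  by rewrite expiD /expi cospi sinpi; simpc.
have mE t : expi (- (t + pi)) = - expi (- t) :> C.
  by rewrite !expiN piE rmorphN.
have tr x y : D (fun m => - v m) x y = 0 -> D v (x + pi) (y + pi) = 0.
  move=> /bloch_det0P[phi [p0 h]]; apply/bloch_det0P; exists phi; split => // m.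
  rewrite -oppr0 -(h m) /bloch !piE !mE rmorphN; ring.
have mn (A B : set C) : (forall z, A z -> B (- z)) -> many A -> many B.
  move=> AB mA N; have [s [us ss sA]] := mA N; exists [seq - z | z <- s]; split.
  - by rewrite map_inj_uniq //; exact: oppr_inj.
  - by rewrite size_map.
  - by move=> z /mapP[w /sA/AB wB ->].
by case=> m; [left|right]; apply: mn m => z [x [y [-> /tr e]]]; exists (x + pi), (y + pi); rewrite piE.
Qed.

Hypothesis signs : forall v, many_lines (fun x y => D v x y = 0) ->
  (exists x y, D v x y < 0) /\ (exists x y, 0 < D v x y).
Hypothesis det_neq0 : forall v, exists x y, D v x y != 0.

Lemma signs_many_lines v x y x' y' : D v x y < 0 -> 0 < D v x' y' ->
  many_lines (fun x y => D v x y = 0).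
Proof.
move=> h1 h2.
have cx a b : D v a' b @[a' --> a] --> D v a b.
  by apply: (@cvg_bloch_det _ (nbhs a) (fun=> v) id (cst b)); [move=> m|..]; try exact: cvg_cst.
have cy a b : D v a b' @[b' --> b] --> D v a b.
  by apply: (@cvg_bloch_det _ (nbhs b) (fun=> v) (cst a) id); [move=> m|..]; try exact: cvg_cst.
apply: (many_lines_sub _ (many_lines_separation (N := fun x y => D v x y < 0) (P := fun x y => 0 < D v x y) _ _ _ _ _ h1 h2)).
- by move=> a b [/negP]; rewrite -leNgt => p1 /negP; rewrite -leNgt => p2; apply/eqP; rewrite eq_le p1 p2.
- by move=> a b p1 p2; have := lt_trans p1 p2; rewrite ltxx.
- by move=> a b; exact: cvgr_lt (cx a b) _.
- by move=> a b; exact: cvgr_lt (cy a b) _.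
- by move=> a b; exact: cvgr_gt (cx a b) _.
- by move=> a b; exact: cvgr_gt (cy a b) _.
Qed.

(** The separating set consists of the quasi-momenta where the form is nonnegative but not definite;
    there [psd_posdef] forces the determinant to vanish. *)
Lemma posdef_many_lines v x y : low v -> posdef s1 s2 v x y -> many_lines (fun x y => D v x y = 0).
Proof.
move=> /low_notpos lv pd.
apply: (many_lines_sub _ (many_lines_separation (N := notpos s1 s2 v) (P := posdef s1 s2 v) _ _ _ _ _ lv pd)).
- by move=> a b [np npd]; apply/eqP; apply: contrapT => /negP/(psd_posdef np).
- by move=> a b; exact: notpos_posdef.
- by move=> a b; exact: notpos_openx.
- by move=> a b; exact: notpos_openy.
- by move=> a b; exact: posdef_openx.
- by move=> a b; exact: posdef_openy.
Qed.

(** At or below the bottom, the form is definite wherever the determinant is nonzero. One such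
    quasi-momentum stays definite under perturbation, so if the bottom does move below the energy,
    [posdef_many_lines] applies. *)
Lemma not_low_robust v : ~ low v -> exists2 e : R, 0 < e &
  forall v', close_to v e v' -> low v' -> many_lines (fun x y => D v' x y = 0).
Proof.
move=> nl; have [x [y D0]] := det_neq0 v.
have [c c0 hc] := psd_posdef (@not_low_psd v x y nl) D0.
exists (c / 2); first by rewrite divr_gt0.
move=> v' hv lv; apply: (posdef_many_lines (x := x) (y := y) lv).
apply: (posdef_near hc (d := c / 2)).
  by move=> m; have := hv m; rewrite ltr_norml => /andP[]; lra.
by rewrite !trig_distxx; lra.
Qed.

(** The premise is goodness at a single energy. Being an implication, it also covers energies
    outside the spectrum or at an edge, which the perturbed spectrum may reach; these are the two
    [not_low_robust] cases. *)
Lemma many_lines_robust v :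
  (low v -> low (fun m => - v m) -> many_lines (fun x y => D v x y = 0)) ->
  exists2 e : R, 0 < e & forall v', close_to v e v' ->
    low v' -> low (fun m => - v' m) -> many_lines (fun x y => D v' x y = 0).
Proof.
move=> hz; have [l1|nl] := pselect (low v); last first.
  by have [e e0 h] := not_low_robust nl; exists e => // v' hv l _; exact: h.
have [l2|nl] := pselect (low (fun m => - v m)); last first.
  have [e e0 h] := not_low_robust nl; exists e => // v' hv _ l.
  apply: many_lines_shift_pi; apply: h => // m.
  by rewrite opprK addrC distrC; exact: hv.
have [[x [y h1]] [x' [y' h2]]] := signs (hz l1 l2).
have [e e0 he] := @bloch_det_robust v x y (fun t => t < 0) (lt_nbhsl h1).
have [e' e0' he'] := @bloch_det_robust v x' y' (fun t => 0 < t) (lt_nbhsr h2).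
exists (Num.min e e'); first by rewrite lt_min e0.
move=> v' hv _ _; apply: (@signs_many_lines v' x y x' y').
  by apply: he => m; have := hv m; rewrite lt_min => /andP[].
by apply: he' => m; have := hv m; rewrite lt_min => /andP[].
Qed.

End Low.

(** * Periodic potentials on the lattice *)

Lemma le_sqrtM_quad (R : realType) (A B S : R) : 0 <= A -> 0 <= B ->
  (forall t, 0 <= A - 2 * t * S + t ^+ 2 * B) -> S <= Num.sqrt A * Num.sqrt B.
Proof.
move=> A0 B0 h; have [S0|S0] := leP S 0.
  by apply: le_trans S0 _; rewrite mulr_ge0 ?sqrtr_ge0.
have : S ^+ 2 <= A * B.
  have [B1|B1] := leP B 0.
    have B00 : B = 0 by apply/eqP; rewrite eq_le B1 B0.
    (* With [B = 0] the polynomial is affine in [t], and this [t] gives it the value -1. *)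
    have := h ((A + 1) / (2 * S)); rewrite B00 mulr0 addr0.
    have -> : 2 * ((A + 1) / (2 * S)) * S = A + 1 by field; rewrite gt_eqF.
    lra.
  have := h (S / B).
  have -> : A - 2 * (S / B) * S + (S / B) ^+ 2 * B = (A * B - S ^+ 2) / B.
    by field; rewrite gt_eqF.
  by rewrite pmulr_lge0 ?invr_gt0 // subr_ge0.
move=> /ler_wsqrtr; rewrite sqrtr_sqr sqrtrM // => h'.
exact: le_trans (ler_norm _) h'.
Qed.

Section Cover.
Variables (R : realType) (T T' : finType).
Variables (s1 s2 : {perm T}) (s1' s2' : {perm T'}) (pr : T' -> T).
Hypothesis pr1 : forall m, pr (s1' m) = s1 (pr m).
Hypothesis pr2 : forall m, pr (s2' m) = s2 (pr m).
Hypothesis pr_surj : forall m, exists m', pr m' = m.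
Implicit Types v : T -> R.

(** Phases are attached to single hops and not to whole cells, so a Bloch solution pulls back to the
    larger torus at the same quasi-momentum. *)
Lemma cover_many_lines v : many_lines (fun x y => bloch_det s1 s2 v x y = 0) ->
  many_lines (fun x y => bloch_det s1' s2' (v \o pr) x y = 0).
Proof.
apply: many_lines_sub => x y /bloch_det0P[phi [[m pm] h]]; apply/bloch_det0P.
exists (phi \o pr); split.
  by have [m' mm] := pr_surj m; exists m'; rewrite /= mm.
have pV (s : {perm T}) (s' : {perm T'}) : (forall m, pr (s' m) = s (pr m)) ->
    forall m, pr (s'^-1 m)%g = (s^-1 (pr m))%g.
  by move=> E k; rewrite -{2}(permKV s' k) E permK.
by move=> k; rewrite /bloch /= (pV _ _ pr1) (pV _ _ pr2) pr1 pr2; exact: h.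
Qed.

(* Periodization by the square root of the sum of squares preserves the potential
   term and, by Cauchy-Schwarz, increases the hopping terms. *)
Lemma cover_low v : low s1' s2' (v \o pr) -> low s1 s2 v.
Proof.
move=> [f hf]; pose F m := \sum_(m' | pr m' == m) f m' ^+ 2.
have F0 m : 0 <= F m by apply: sumr_ge0 => k _; exact: sqr_ge0.
exists (fun m => Num.sqrt (F m)).
have hop (s : {perm T}) (s' : {perm T'}) : (forall m, pr (s' m) = s (pr m)) ->
    \sum_m f m * f (s' m) <= \sum_m Num.sqrt (F m) * Num.sqrt (F (s m)).
  move=> E; rewrite (partition_big pr predT) //=; apply: ler_sum => m _.
  have -> : F (s m) = \sum_(m' | pr m' == m) f (s' m') ^+ 2.
    rewrite /F (reindex_inj (@perm_inj _ s')) /=; apply: eq_bigl => k.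
    by rewrite E (inj_eq (@perm_inj _ s)).
  apply: le_sqrtM_quad => //; first by apply: sumr_ge0 => k _; exact: sqr_ge0.
  move=> t; rewrite /F !mulr_sumr -sumrB -big_split /=; apply: sumr_ge0 => k _.
  by rewrite (_ : _ + _ = (f k - t * f (s' k)) ^+ 2) ?sqr_ge0 //; ring.
apply: le_lt_trans hf.
have -> : \sum_m v m * Num.sqrt (F m) ^+ 2 = \sum_m v (pr m) * f m ^+ 2.
  rewrite [RHS](partition_big pr predT) //=; apply: eq_bigr => m _.
  by rewrite sqr_sqrtr // /F mulr_sumr; apply: eq_bigr => k /eqP ->.
have := hop _ _ pr1; have := hop _ _ pr2 => /=; lra.
Qed.

End Cover.

Section Shifts.
Variables a b : nat.
Local Notation T := ('I_a * 'I_b)%type.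

Lemma shift1_inj : injective (fun m : T => (ordS m.1, m.2)).
Proof.
move=> [i j] [i' j'] /= e.
by have := congr1 fst e; have := congr1 snd e => /= -> /(can_inj (@ordSK a)) ->.
Qed.

Lemma shift2_inj : injective (fun m : T => (m.1, ordS m.2)).
Proof.
move=> [i j] [i' j'] /= e.
by have := congr1 fst e; have := congr1 snd e => /= /(can_inj (@ordSK b)) -> ->.
Qed.

Definition shift1 : {perm T} := perm shift1_inj.
Definition shift2 : {perm T} := perm shift2_inj.

Lemma shift1E m : shift1 m = (ordS m.1, m.2).
Proof. by rewrite permE. Qed.

Lemma shift2E m : shift2 m = (m.1, ordS m.2).
Proof. by rewrite permE. Qed.

Lemma dvd_ordS (n : nat) (i : 'I_n) : (n %| (ordS i)%:Z - i%:Z - 1)%Z.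
Proof.
rewrite /=; apply/dvdzP; exists (- ((i.+1 %/ n)%N)%:Z).
have := divn_eq i.+1 n; lia.
Qed.

Lemma dvdz_opp (d : nat) (x y : int) : (d %| x - y - 1)%Z -> (d %| y - x + 1)%Z.
Proof. by move=> h; rewrite (_ : y - x + 1 = - (x - y - 1)) ?rpredN //; lia. Qed.

Lemma hop1_dvd (o : hop) (m : T) :
  (a %| ((hop_perm shift1 shift2 o m).1 : nat)%:Z - (m.1 : nat)%:Z - hop1 o)%Z.
Proof.
have h0 (x : int) : (a %| x - x - 0)%Z by rewrite subrr subr0 dvdz0.
case: o => -[|[|[|[|[|]]]]] // ?; rewrite /hop_perm /hop1 /= ?perm1 //.
- by rewrite shift1E; exact: dvd_ordS.
- move: (permKV shift1 m); move: (shift1^-1%g m) => m' <-; rewrite shift1E opprK.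
  by apply: dvdz_opp; exact: dvd_ordS.
- by rewrite shift2E.
- by move: (permKV shift2 m); move: (shift2^-1%g m) => m' <-; rewrite shift2E.
Qed.

Lemma hop2_dvd (o : hop) (m : T) :
  (b %| ((hop_perm shift1 shift2 o m).2 : nat)%:Z - (m.2 : nat)%:Z - hop2 o)%Z.
Proof.
have h0 (x : int) : (b %| x - x - 0)%Z by rewrite subrr subr0 dvdz0.
case: o => -[|[|[|[|[|]]]]] // ?; rewrite /hop_perm /hop2 /= ?perm1 //.
- by rewrite shift1E.
- by move: (permKV shift1 m); move: (shift1^-1%g m) => m' <-; rewrite shift1E.
- by rewrite shift2E; exact: dvd_ordS.
- move: (permKV shift2 m); move: (shift2^-1%g m) => m' <-; rewrite shift2E opprK.
  by apply: dvdz_opp; exact: dvd_ordS.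
Qed.

Definition emb (m : T) : Z2 := ((m.1 : nat)%:Z, (m.2 : nat)%:Z).

End Shifts.

Section Reduction.
Variables a b : nat.
Hypotheses (a0 : (0 < a)%N) (b0 : (0 < b)%N).
Local Notation T := ('I_a * 'I_b)%type.

Lemma modz_ord (n : nat) (k : int) : (0 < n)%N -> (`|(k %% n)%Z|%N < n)%N.
Proof. by move=> n0; have := ltz_pmod k (d := n); have := modz_ge0 k (d := n); lia. Qed.

Definition red (n : Z2) : T := (Ordinal (modz_ord n.1 a0), Ordinal (modz_ord n.2 b0)).

Lemma red_emb m : red (emb m) = m.
Proof.
by case: m => i j; congr (_, _); apply: val_inj; rewrite /= modz_nat absz_nat modn_small.
Qed.

Lemma ordS_mod (n : nat) (n0 : (0 < n)%N) (k : int) :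
  Ordinal (modz_ord (k + 1) n0) = ordS (Ordinal (modz_ord k n0)).
Proof.
apply: val_inj => /=; apply/eqP; rewrite -eqz_nat -modz_nat -addn1 PoszD.
have kk l : (`|(l %% n)%Z|%N)%:Z = (l %% n)%Z by rewrite gez0_abs // modz_ge0 //; lia.
by rewrite !kk modzDml.
Qed.

Lemma red_shift1 n : red (n.1 + 1, n.2) = shift1 a b (red n).
Proof. by rewrite permE /red /= ordS_mod. Qed.

Lemma red_shift2 n : red (n.1, n.2 + 1) = shift2 a b (red n).
Proof. by rewrite permE /red /= ordS_mod. Qed.

Lemma red_congr (n n' : Z2) : (a %| n.1 - n'.1)%Z -> (b %| n.2 - n'.2)%Z -> red n = red n'.
Proof.
by rewrite -!eqz_mod_dvd => /eqP h1 /eqP h2; congr (_, _); apply: val_inj; rewrite /= ?h1 ?h2.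
Qed.

Lemma periodic_red (R : realType) (W : Z2 -> R) n : ab_periodic a b W -> W n = W (emb (red n)).
Proof.
move=> per.
have p1 (k : nat) x y : W (x + k%:Z * a%:Z, y) = W (x, y).
  elim: k => [|k IH]; first by rewrite mul0r addr0.
  by rewrite (_ : x + k.+1%:Z * a%:Z = x + k%:Z * a%:Z + a%:Z) ?(per _ _).1 //; lia.
have p2 (k : nat) x y : W (x, y + k%:Z * b%:Z) = W (x, y).
  elim: k => [|k IH]; first by rewrite mul0r addr0.
  by rewrite (_ : y + k.+1%:Z * b%:Z = y + k%:Z * b%:Z + b%:Z) -?(per _ _).2 //; lia.
have q1 (k : int) x y : W (x + k * a%:Z, y) = W (x, y).
  case: k => k; first exact: p1.
  by rewrite -(p1 k.+1) NegzE; congr W; congr (_, _); lia.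
have q2 (k : int) x y : W (x, y + k * b%:Z) = W (x, y).
  case: k => k; first exact: p2.
  by rewrite -(p2 k.+1) NegzE; congr W; congr (_, _); lia.
case: n => x y; rewrite /emb /= !gez0_abs ?modz_ge0 //; try lia.
rewrite -[RHS](q1 (x %/ a)%Z) -[RHS](q2 (y %/ b)%Z); congr W; congr (_, _).
  by rewrite addrC -divz_eq.
by rewrite addrC -divz_eq.
Qed.

End Reduction.

(** * Good periodic potentials *)

Section Good.
Variable R : realType.
Implicit Types W : Z2 -> R.

Definition cell (a b : nat) W (E : R) : 'I_a * 'I_b -> R := fun m => W (emb m) - E.

Definition cell_low (a b : nat) (v : 'I_a * 'I_b -> R) := low (shift1 a b) (shift2 a b) v.
Definition cell_many_lines (a b : nat) (v : 'I_a * 'I_b -> R) :=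
  many_lines (fun x y => bloch_det (shift1 a b) (shift2 a b) v x y = 0).

(** The two [cell_low] premises place [E] strictly above the bottom and strictly below the top: for
    the negated cell, the form at [(pi, pi)] is the opposite of the original form at [(0, 0)]. *)
Definition good (a b : nat) W : Prop := forall E,
  cell_low (cell (a := a) (b := b) W E) -> cell_low (fun m => - cell (a := a) (b := b) W E m) ->
  cell_many_lines (cell (a := a) (b := b) W E).

(** Test functions descend to the smaller torus by [cover_low], and zeros of the determinant lift
    back by [cover_many_lines]. *)
Lemma good_refine a b a' b' W : (0 < a)%N -> (0 < b)%N -> (0 < a')%N -> (0 < b')%N ->
  (a %| a')%N -> (b %| b')%N ->
  ab_periodic a b W -> good a b W -> good a' b' W.
Proof.
move=> a0 b0 a0' b0' da db per g E.
pose pr (m : 'I_a' * 'I_b') := red a0 b0 (emb m).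
have pr1 m : pr (shift1 a' b' m) = shift1 a b (pr m).
  rewrite /pr -red_shift1; apply: red_congr => /=; last by rewrite permE /= subrr dvdz0.
  rewrite permE; apply: dvdz_trans (_ : a%:Z %| a'%:Z)%Z _ => //.
  by rewrite opprD addrA; exact: dvd_ordS.
have pr2 m : pr (shift2 a' b' m) = shift2 a b (pr m).
  rewrite /pr -red_shift2; apply: red_congr => /=; first by rewrite permE /= subrr dvdz0.
  rewrite permE; apply: dvdz_trans (_ : b%:Z %| b'%:Z)%Z _ => //.
  by rewrite opprD addrA; exact: dvd_ordS.
have pr_surj m : exists m', pr m' = m.
  case: m => i j; have ia : (i < a')%N by apply: leq_trans (ltn_ord i) (dvdn_leq a0' da).
  have jb : (j < b')%N by apply: leq_trans (ltn_ord j) (dvdn_leq b0' db).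
  by exists (Ordinal ia, Ordinal jb); rewrite /pr -[RHS](red_emb a0 b0).
have cE : cell W E = cell W E \o pr by apply/funext => m; rewrite /cell /= /pr -periodic_red.
rewrite cE => l1 l2; apply: (cover_many_lines pr1 pr2 pr_surj); apply: g.
  exact: (cover_low pr1 pr2 l1).
exact: (cover_low pr1 pr2 (v := fun m => - cell W E m) l2).
Qed.

Lemma good_one : good 1 1 (fun=> 0).
Proof.
move=> E l1 l2.
have sum1 (V : nmodType) (f : 'I_1 * 'I_1 -> V) : \sum_m f m = f (ord0, ord0).
  by apply: big_pred1 => -[i j]; rewrite (ord1 i) (ord1 j) /= eqxx.
have sh (s : {perm 'I_1 * 'I_1}) m : s m = m.
  by case: (s m) => i j; case: m => i' j'; rewrite (ord1 i) (ord1 j) (ord1 i') (ord1 j').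
apply: (posdef_many_lines l1 (x := 0) (y := 0)).
case: l2 => f; rewrite !sum1 !sh /cell; set t := f _ => ht.
(* On a single site at quasi-momentum [(0, 0)] the operator is multiplication by [4 - E]; the second
   premise of goodness makes this positive. *)
exists (4 - E).
  by rewrite ltNge; apply/negP => h; have := sqr_ge0 t; move: ht; nra.
move=> phi; rewrite formE /norm2 !sum1 !sh expi0 !mul1r !rdotzz; lra.
Qed.

Lemma good_robust a b W E : (0 < a)%N -> (0 < b)%N -> coprime a b -> good a b W ->
  exists2 e : R, 0 < e & forall W' E',
    (forall m : 'I_a * 'I_b, `|W' (emb m) - W (emb m)| < e) -> `|E' - E| < e ->
    cell_low (cell (a := a) (b := b) W' E') ->
    cell_low (fun m => - cell (a := a) (b := b) W' E' m) ->
    cell_many_lines (cell (a := a) (b := b) W' E').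
Proof.
move=> a0 b0 ab g.
have cT : #|{: 'I_a * 'I_b}| = (a * b)%N by rewrite card_prod !card_ord.
have := @many_lines_robust R _ _ _
  (bloch_det_signs cT a0 b0 ab (@hop1_dvd a b) (@hop2_dvd a b))
  (bloch_det_neq0 cT a0 b0 ab (@hop1_dvd a b) (@hop2_dvd a b)) _ (g E).
move=> [e e0 h]; exists (e / 2); first by rewrite divr_gt0.
move=> W' E' hW hE; apply: h => m; rewrite /cell.
have := hW m; move: hE; rewrite !ltr_norml => /andP[h1 h2] /andP[h3 h4].
by apply/andP; split; lra.
Qed.

End Good.

(** * Choice of the sizes by compactness *)

Lemma cvg_sum_seq (R : realType) (I : Type) (F : set_system I) (FF : Filter F) (r : seq nat)
  (f : nat -> I -> R) (l : nat -> R) : (forall s, f s i @[i --> F] --> l s) ->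
  \sum_(s <- r) f s i @[i --> F] --> \sum_(s <- r) l s.
Proof. by move=> h; apply: (cvg_big add_continuous (Ff := f)). Qed.

Section Steps.
Variables (R : realType) (p q : nat).
Hypotheses (p0 : (0 < p)%N) (q0 : (0 < q)%N) (pq : coprime p q).
Implicit Types (V : nat -> Z2 -> R) (U W : Z2 -> R) (d : nat -> R).

Definition partial V (t : nat) (n : Z2) : R := \sum_(1 <= s < t.+1) V s n.

Definition admissible d (t : nat) V := forall s, (1 <= s <= t)%N ->
  ab_periodic (p ^ s) (q ^ s) (V s) /\ forall n, `|V s n| <= d s.

Lemma ab_periodic_dvd (a b a' b' : nat) W : (a %| a')%N -> (b %| b')%N ->
  ab_periodic a b W -> ab_periodic a' b' W.
Proof.
move=> /dvdnP[k ->] /dvdnP[l ->] per n1 n2.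
have p1 (j : nat) x y : W (x + j%:Z * a%:Z, y) = W (x, y).
  elim: j => [|j IH]; first by rewrite mul0r addr0.
  by rewrite (_ : x + j.+1%:Z * a%:Z = x + j%:Z * a%:Z + a%:Z) ?(per _ _).1 //; lia.
have p2 (j : nat) x y : W (x, y + j%:Z * b%:Z) = W (x, y).
  elim: j => [|j IH]; first by rewrite mul0r addr0.
  by rewrite (_ : y + j.+1%:Z * b%:Z = y + j%:Z * b%:Z + b%:Z) -?(per _ _).2 //; lia.
by rewrite !PoszM p1 p2.
Qed.

Lemma ab_periodicD (a b : nat) U W :
  ab_periodic a b U -> ab_periodic a b W -> ab_periodic a b (fun n => U n + W n).
Proof.
move=> hU hW n1 n2; have [u1 u2] := hU n1 n2; have [w1 w2] := hW n1 n2.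
by rewrite u1 w1 -u2 -w2.
Qed.

Lemma partialS V t n : partial V t.+1 n = partial V t n + V t.+1 n.
Proof. by rewrite /partial big_nat_recr. Qed.

Lemma partial_periodic d t V : admissible d t V -> ab_periodic (p ^ t) (q ^ t) (partial V t).
Proof.
elim: t => [|t IH] adm n1 n2; first by rewrite /partial !big_nil.
rewrite !partialS; apply: (@ab_periodicD _ _ (partial V t) (V t.+1)).
  apply: (@ab_periodic_dvd (p ^ t) (q ^ t)); rewrite ?dvdn_exp2l //.
  by apply: IH => s /andP[s1 st]; apply: adm; rewrite s1 ltnW.
by have [] := adm t.+1 (leqnn _ : (1 <= t.+1 <= t.+1)%N).
Qed.

Lemma exp_coprime t : coprime (p ^ t) (q ^ t).
Proof. by rewrite coprimeXl // coprimeXr. Qed.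

Let pt0 t : (0 < p ^ t)%N. Proof. by rewrite expn_gt0 p0. Qed.
Let qt0 t : (0 < q ^ t)%N. Proof. by rewrite expn_gt0 q0. Qed.

Let X := prod_topology (fun _ : nat * Z2 => R).

(* Admissible sequences are parametrized by the points of a compact box. *)
Let Vof (w : X) (s : nat) (n : Z2) : R := w (s, emb (red (pt0 s) (qt0 s) n)).
Let box d : set X := [set w : X | forall i, `[- `|d i.1|, `|d i.1|]%classic (w i)].

Let box_compact d : compact (box d).
Proof.
by apply: (@tychonoff (nat * Z2)%type (fun=> R) (fun i => `[- `|d i.1|, `|d i.1|]%classic)) => i; exact: segment_compact.
Qed.

Let Vof_adm d t w : (forall s, 0 <= d s) -> box d w -> admissible d t (Vof w).
Proof.
move=> d0 bw s _; split.
  move=> n1 n2; rewrite /Vof; split; congr (w (_, emb _)); apply: red_congr => /=; rewrite ?subrr ?dvdz0 //.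
    by rewrite addrAC subrr add0r dvdzz.
  by rewrite opprD addrA subrr sub0r rpredN dvdzz.
move=> n; have := bw (s, emb (red (pt0 s) (qt0 s) n)); rewrite /= in_itv /= /Vof.
by rewrite -ler_norml (ger0_norm (d0 s)).
Qed.

Let partial_cvg (w : X) t n : partial (Vof w') t n @[w' --> w] --> partial (Vof w) t n.
Proof.
have hs i : (fun w' : X => w' i) @ w --> w i by exact: (@proj_continuous _ (fun=> R) i w).
pose g s : nat * Z2 := (s, emb (red (pt0 s) (qt0 s) n)).
have gE w' : partial (Vof w') t n = \sum_(1 <= s < t.+1) w' (g s) by [].
rewrite gE (_ : (fun w' : X => _) = (fun w' : X => \sum_(1 <= s < t.+1) w' (g s))); last exact/funext.
clear gE; move: g => g.
have := @cvg_sum_seq R X (nbhs w) _ (index_iota 1 t.+1) (fun s w' => w' (g s)) (fun s => w (g s)) (fun s => hs (g s)).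
by apply; exact: nbhs_filter.
Qed.

(** Outside this window goodness is vacuous, so the energy ranges over a compact segment. *)
Lemma cell_low_bound (a b : nat) W E M : cell_low (cell (a := a) (b := b) W E) ->
  cell_low (fun m => - cell (a := a) (b := b) W E m) ->
  (forall n, `|W n| <= M) -> `|E| <= M + 4.
Proof.
move=> /low_bound[m hm] /low_bound[m' hm'] hM; move: hm hm'; rewrite /cell.
have := hM (emb m); have := hM (emb m'); rewrite !ler_norml => /andP[a1 a2] /andP[a3 a4].
by move=> h1 h2; apply/andP; split; lra.
Qed.

Lemma partial_bound d t V : admissible d t V -> forall n,
  `|partial V t n| <= \sum_(1 <= s < t.+1) d s.
Proof.
move=> adm n; rewrite /partial (le_trans (ler_norm_sum _ _ _)) //.
rewrite !big_nat; apply: ler_sum => s /andP[s1 st].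
by have [] := adm s; rewrite ?s1.
Qed.

(** [good_robust] gives a size depending on the potentials and on the energy; compactness of the box
    of admissible sequences times an energy segment makes it uniform. *)
Lemma good_step d t : (forall s, 0 <= d s) ->
  (forall V, admissible d t V -> good (p ^ t) (q ^ t) (partial V t)) ->
  exists2 e : R, 0 < e & forall V U, admissible d t V ->
    ab_periodic (p ^ t.+1) (q ^ t.+1) U -> (forall n, `|U n| <= e) ->
    good (p ^ t.+1) (q ^ t.+1) (fun n => partial V t n + U n).
Proof.
move=> d0 hg.
(* The sum bounds [partial V t], the 1 bounds [U] because [e] will be taken at most 1, and the 4 is
   the hopping bound of [cell_low_bound]. *)
pose M := \sum_(1 <= s < t.+1) d s + 1 + 4.
pose K : set (X * R) := box d `*` `[- M, M]%classic.
have cK : compact K by apply: compact_setX; [exact: box_compact|exact: segment_compact].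
pose P (e : R) (wE : X * R) := forall U : Z2 -> R, (forall n, `|U n| <= e) ->
  let W n := partial (Vof wE.1) t n + U n in
  cell_low (cell (a := p ^ t.+1) (b := q ^ t.+1) W wE.2) ->
  cell_low (fun m => - cell (a := p ^ t.+1) (b := q ^ t.+1) W wE.2 m) ->
  cell_many_lines (cell (a := p ^ t.+1) (b := q ^ t.+1) W wE.2).
have local_P wE : K wE -> \forall wE' \near wE & e \near (0 : R)^'+, P e wE'.
  case: wE => w E [/= bw _].
  have adm := Vof_adm (t := t) d0 bw.
  have g : good (p ^ t.+1) (q ^ t.+1) (partial (Vof w) t).
    apply: (good_refine (pt0 t) (qt0 t)) => //; rewrite ?dvdn_exp2l //.
      exact: partial_periodic adm.
    exact: hg.
  have [e e0 he] := good_robust E (pt0 t.+1) (qt0 t.+1) (exp_coprime t.+1) g.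
  have near1 : \forall w' \near w, forall m : 'I_(p ^ t.+1) * 'I_(q ^ t.+1),
      `|partial (Vof w') t (emb m) - partial (Vof w) t (emb m)| < e / 2.
    apply: (@filter_forall X _ (fun (m : 'I_(p ^ t.+1) * 'I_(q ^ t.+1)) (w' : X) =>
      `|partial (Vof w') t (emb m) - partial (Vof w) t (emb m)| < e / 2) (nbhs w)) => m.
    have /cvgrPdist_lt/(_ (e / 2)) := @partial_cvg w t (emb m).
    rewrite divr_gt0 // => /(_ isT); apply: filterS => w'.
    by rewrite distrC.
  have near2 : \forall E' \near E, `|E' - E| < e.
    by apply/nbhs_ballP; exists e => // E'; rewrite /ball /= distrC.
  near=> wE' e' => U hU W l1 l2.
  apply: he l1 l2 => /=; last first.
    near: wE'; exists (setT, [set E' | `|E' - E| < e]); last by move=> [? ?] [].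
    by split => //; exact: filterT.
  move=> m; rewrite /W addrAC.
  have h1 : `|partial (Vof wE'.1) t (emb m) - partial (Vof w) t (emb m)| < e / 2.
    move: m; near: wE'; exists ([set w' | forall m : 'I_(p ^ t.+1) * 'I_(q ^ t.+1),
      `|partial (Vof w') t (emb m) - partial (Vof w) t (emb m)| < e / 2], setT).
      by split => //; exact: filterT.
    by move=> [? ?] [].
  have h2 : `|U (emb m)| < e / 2.
    apply: le_lt_trans (hU _) _ => /=; near: e'; apply: nbhs_right_lt; by rewrite divr_gt0.
  by apply: (le_lt_trans (ler_normD _ _)); lra.
have /compact_near_coveringP/(_ R ((0 : R)^'+) P _ local_P) nearP := cK.
have [e [eP [e0 e1]]] : exists e, K `<=` P e /\ 0 < e /\ e <= 1.
  apply: (@filter_ex _ ((0 : R)^'+)); near=> e; split; first by near: e.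
  split; first by near: e; exact: nbhs_right_gt.
  by near: e; apply: nbhs_right_le.
exists e => // V U adm perU hU E l1 l2.
(* [V] is unconstrained beyond level [t]; the value 0 keeps the point in the box without changing
   [partial V t]. *)
pose w : X := fun i => if (1 <= i.1 <= t)%N then V i.1 i.2 else 0.
have bw : box d w.
  move=> i; rewrite /= in_itv /= -ler_norml /w; case: ifP => [h|_]; last by rewrite normr0.
  by rewrite (ger0_norm (d0 _)); have [] := adm _ h.
have wV : partial (Vof w) t = partial V t.
  apply/funext => n; rewrite /partial !big_nat; apply: eq_bigr => s /andP[s1 st].
  have h : (1 <= s <= t)%N by rewrite s1.
  rewrite /Vof /w /= h; have [per _] := adm s h.
  by rewrite [RHS](periodic_red (pt0 s) (qt0 s)).
have EM : K (w, E).
  split => //=; rewrite in_itv /= -ler_norml.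
  apply: (cell_low_bound l1 l2) => n; apply: le_trans (ler_normD _ _) _.
  by rewrite lerD ?(partial_bound adm) // (le_trans (hU n)).
by have := eP _ EM U hU; rewrite /= wV; apply.
Unshelve. all: by end_near. Qed.

Lemma admissible_eq d d' t V : (forall s, (s <= t)%N -> d s = d' s) ->
  admissible d t V -> admissible d' t V.
Proof. by move=> dd adm s hs; rewrite -dd; [exact: adm | case/andP: hs]. Qed.

Lemma good_deltas : exists d : nat -> R, [/\ forall t, (1 <= t)%N -> 0 < d t,
  forall t, d t <= 2^-1 ^+ t &
  forall t V, admissible d t V -> good (p ^ t) (q ^ t) (partial V t)].
Proof.
pose step_ok d t (e : R) := forall V U, admissible d t V ->
    ab_periodic (p ^ t.+1) (q ^ t.+1) U -> (forall n, `|U n| <= e) ->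
    good (p ^ t.+1) (q ^ t.+1) (fun n => partial V t n + U n).
pose all_good d t := forall V, admissible d t V -> good (p ^ t) (q ^ t) (partial V t).
(* Pairs that fail the premises receive the dummy value 1, so the choice is a total function that
   the recursion below can call. *)
have [x|e he] := @choice _ _ (fun (x : (nat -> R) * nat) (e : R) => 0 < e /\
     ((forall s, 0 <= x.1 s) -> all_good x.1 x.2 -> step_ok x.1 x.2 e)).
  case: x => d t /=.
  have [[d0 g]|ng] := pselect ((forall s, 0 <= d s) /\ all_good d t).
    by have [e e0 h] := good_step d0 g; exists e.
  by exists 1; split => // d0 g; case: ng.
have half0 t : 0 < (2^-1 : R) ^+ t by rewrite exprn_gt0 // invr_gt0.
(* [D t] holds the sizes chosen up to level [t] and is 0 beyond; each new size depends on the
   earlier ones only. The diagonal [d] is the common extension. *)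
pose D := fix D t : nat -> R := if t is t'.+1 then
  fun s => if s == t'.+1 then Num.min (2^-1 ^+ t'.+1) (e (D t', t')) else D t' s
  else fun=> 0.
pose d t := D t t.
have Dd t s : (s <= t)%N -> D t s = d s.
  elim: t => [|t IH]; first by rewrite leqn0 => /eqP ->.
  rewrite leq_eqVlt => /orP[/eqP -> //|st] /=.
  by rewrite ltn_eqF // IH.
have D0 t s : 0 <= D t s.
  elim: t s => [|t IH] s //=; case: ifP => // _.
  by rewrite le_min !ltW //; have [] := he (D t, t).
have dS t : d t.+1 = Num.min (2^-1 ^+ t.+1) (e (D t, t)) by rewrite /d /= eqxx.
exists d; split.
- by case=> // t _; rewrite dS lt_min half0; have [] := he (D t, t).
- case=> [|t]; first by rewrite expr0 /d /= ler01.
  by rewrite dS ge_min lexx.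
elim=> [|t IH] V adm.
  have -> : partial V 0 = fun=> 0 by apply/funext => n; rewrite /partial big_nil.
  exact: good_one.
have adm' : admissible (D t) t V.
  apply: (@admissible_eq d) => [s st|s /andP[s1 st]]; first by rewrite Dd.
  by apply: adm; rewrite s1 ltnW.
have -> : partial V t.+1 = fun n => partial V t n + V t.+1 n.
  by apply/funext => n; rewrite partialS.
have [perV hV] := adm t.+1 (leqnn _ : (1 <= t.+1 <= t.+1)%N).
have [_ ok] := he (D t, t); apply: ok => //=.
  by move=> W /(@admissible_eq _ d) hW; apply: IH; apply: hW => s; exact: Dd.
by move=> n; apply: le_trans (hV n) _; rewrite dS ge_min lexx orbT.
Qed.

End Steps.

(** * Real summation over a countable index *)

Section Lsum.
Variables (R : realType) (K : choiceType).
Implicit Types (f g h : K -> R) (s : seq K).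

Definition fin_bound f (M : R) := forall s, uniq s -> \sum_(n <- s) f n <= M.
Definition summ f := exists M, fin_bound (fun n => `|f n|) M.
Definition total f : \bar R := (\esum_(n in [set: K]) (f n)%:E)%E.

Lemma total_le f M : fin_bound f M -> (total f <= M%:E)%E.
Proof.
move=> hM; apply: ge_ereal_sup => _ [A [fA _] <-].
by rewrite fsbig_finite //= sumEFin lee_fin; apply: hM; exact: finmap.fset_uniq.
Qed.

Lemma le_total f s : uniq s -> ((\sum_(n <- s) f n)%:E <= total f)%E.
Proof.
move=> us; apply: esum_ge; exists [set` s]; first by split.
by rewrite -fsbig_seq // sumEFin.
Qed.

Definition nsum f : R := fine (total f).

Lemma totalE f : (forall n, 0 <= f n) -> summ f -> total f = (nsum f)%:E.
Proof.
move=> f0 [M hM]; rewrite fineK // ge0_fin_numE; last by apply: esum_ge0 => n _; rewrite lee_fin.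
apply: le_lt_trans (ltry M); apply: total_le => s us.
by apply: le_trans (hM s us); apply: ler_sum => n _; exact: ler_norm.
Qed.

Lemma summ_total f : (forall n, 0 <= f n) -> (total f < +oo)%E -> summ f.
Proof.
move=> f0 tf.
have t0 : (0 <= total f)%E by apply: esum_ge0 => n _; rewrite lee_fin.
have tE : total f = (nsum f)%:E by rewrite /nsum fineK // ge0_fin_numE.
exists (nsum f) => s us; under eq_bigr do rewrite ger0_norm //.
by rewrite -lee_fin -tE; exact: le_total.
Qed.

Lemma summ_bound f M : (forall n, 0 <= f n) -> fin_bound f M -> summ f.
Proof. by move=> f0 hM; exists M => s us; under eq_bigr do rewrite ger0_norm //; exact: hM. Qed.

Lemma summ_le f g : (forall n, `|f n| <= g n) -> summ g -> summ f.
Proof.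
move=> fg [M hM]; exists M => s us; apply: le_trans (hM s us).
by apply: ler_sum => n _; apply: le_trans (fg n) (ler_norm _).
Qed.

Lemma summD f g : summ f -> summ g -> summ (fun n => f n + g n).
Proof.
move=> [M hM] [N hN]; exists (M + N) => s us.
apply: le_trans (lerD (hM s us) (hN s us)); rewrite -big_split.
by apply: ler_sum => n _; exact: ler_normD.
Qed.

Lemma summZ (c : R) f : summ f -> summ (fun n => c * f n).
Proof.
move=> [M hM]; exists (`|c| * M) => s us; under eq_bigr do rewrite normrM.
by rewrite -mulr_sumr ler_wpM2l // hM.
Qed.

Lemma summ0 : summ (fun=> 0).
Proof. by exists 0 => s _; rewrite big1 // => n _; rewrite normr0. Qed.

Lemma summ_norm f : summ f -> summ (fun n => `|f n|).
Proof. by move=> [M hM]; exists M => s us; under eq_bigr do rewrite normr_id; exact: hM. Qed.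

Lemma nsumD f g : (forall n, 0 <= f n) -> (forall n, 0 <= g n) -> summ f -> summ g ->
  nsum (fun n => f n + g n) = nsum f + nsum g.
Proof.
move=> f0 g0 sf sg; apply: EFin_inj; rewrite EFinD -!totalE //; last exact: summD.
  by rewrite /total -esumD //; move=> n _; rewrite lee_fin.
by move=> n; rewrite addr_ge0.
Qed.

Lemma nsum_ge0 f : (forall n, 0 <= f n) -> 0 <= nsum f.
Proof. by move=> f0; rewrite fine_ge0 // esum_ge0 // => n _; rewrite lee_fin. Qed.

Lemma nsum_le f M : (forall n, 0 <= f n) -> fin_bound f M -> nsum f <= M.
Proof.
move=> f0 hM; rewrite -lee_fin -totalE //; first exact: total_le.
exact: summ_bound hM.
Qed.

Lemma nsum_ge f s : (forall n, 0 <= f n) -> summ f -> uniq s -> \sum_(n <- s) f n <= nsum f.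
Proof. by move=> f0 sf us; rewrite -lee_fin -totalE //; exact: le_total. Qed.

Lemma nsumZ (c : R) f : 0 <= c -> (forall n, 0 <= f n) -> summ f ->
  nsum (fun n => c * f n) = c * nsum f.
Proof.
have le (c' : R) g : 0 <= c' -> (forall n, 0 <= g n) -> summ g -> nsum (fun n => c' * g n) <= c' * nsum g.
  move=> c0 g0 sg; apply: nsum_le => [n|s us]; first by rewrite mulr_ge0.
  by rewrite -mulr_sumr ler_wpM2l // nsum_ge.
move=> c0 f0 sf; apply/eqP; rewrite eq_le le //=.
have [->|cn0] := eqVneq c 0; first by rewrite mul0r nsum_ge0 // => n; rewrite mul0r.
have cp : 0 < c by rewrite lt0r cn0.
rewrite -ler_pdivlMl //; have h := le c^-1 (fun n => c * f n).
apply: le_trans (h _ _ _); rewrite ?invr_ge0 //.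
- by apply/eqP/eqP; rewrite le_eqVlt; apply/orP; left; apply/eqP; congr nsum; apply/funext => n; rewrite mulrA mulVf ?mul1r.
- by move=> n; rewrite mulr_ge0.
- exact: summZ.
Qed.

Lemma nsum_reindex (t : K -> K) f : bijective t -> nsum (fun n => f (t n)) = nsum f.
Proof.
move=> bt; rewrite /nsum /total; congr fine; symmetry.
rewrite (@reindex_esum _ _ _ [set: K] [set: K] t) //.
by rewrite setTT_bijective.
Qed.

Definition pos f n := Num.max (f n) 0.
(** [nsum] passes through an extended real sum and is meaningful for nonnegative summable families,
    hence the split of a signed family. *)
Definition lsum f : R := nsum (pos f) - nsum (pos (fun n => - f n)).

Lemma pos_ge0 f n : 0 <= pos f n.
Proof. by rewrite le_max lexx orbT. Qed.

Lemma pos_le f n : `|pos f n| <= `|f n|.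
Proof. by rewrite ger0_norm ?pos_ge0 // ge_max ler_norm normr_ge0. Qed.

Lemma posE f n : f n = pos f n - pos (fun n => - f n) n.
Proof. by rewrite /pos; case: (leP (f n) 0); case: (leP (- f n) 0); lra. Qed.

Lemma summ_pos f : summ f -> summ (pos f).
Proof. by move=> /summ_norm; apply: summ_le; exact: pos_le. Qed.

Lemma summN f : summ f -> summ (fun n => - f n).
Proof. by move=> /summ_norm; apply: summ_le => n; rewrite normrN. Qed.

(** The sum does not depend on the decomposition into nonnegative parts; linearity of [lsum] follows
    by choosing convenient ones. *)
Lemma lsum_decomp f g h : (forall n, 0 <= g n) -> (forall n, 0 <= h n) -> summ g -> summ h ->
  (forall n, f n = g n - h n) -> lsum f = nsum g - nsum h.
Proof.
move=> g0 h0 sg sh fgh.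
have sf : summ f.
  apply: (@summ_le _ (fun n => g n + h n)); last exact: summD.
  by move=> n; rewrite fgh (le_trans (ler_normB _ _)) // !ger0_norm.
have : nsum (fun n => pos f n + h n) = nsum (fun n => g n + pos (fun n => - f n) n).
  by congr nsum; apply/funext => n; have := posE f n; rewrite fgh; lra.
have s1 := summ_pos sf; have s2 := summ_pos (summN sf).
by rewrite !nsumD //; try exact: pos_ge0; rewrite /lsum; lra.
Qed.

Lemma lsum_nn f : (forall n, 0 <= f n) -> summ f -> lsum f = nsum f.
Proof.
move=> f0 sf; rewrite (@lsum_decomp f f (fun=> 0)) //; last by move=> n; rewrite subr0.
  by rewrite [X in _ - X](_ : _ = 0) ?subr0 // /nsum /total esum1.
exact: summ0.
Qed.

Lemma lsumD f g : summ f -> summ g -> lsum (fun n => f n + g n) = lsum f + lsum g.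
Proof.
move=> sf sg.
have s1 := summ_pos sf; have s2 := summ_pos (summN sf).
have s3 := summ_pos sg; have s4 := summ_pos (summN sg).
rewrite (@lsum_decomp _ (fun n => pos f n + pos g n)
  (fun n => pos (fun n => - f n) n + pos (fun n => - g n) n)).
- rewrite !nsumD //; try exact: pos_ge0.
  by rewrite /lsum; ring.
- by move=> n; rewrite addr_ge0 ?pos_ge0.
- by move=> n; rewrite addr_ge0 ?pos_ge0.
- exact: summD.
- exact: summD.
- by move=> n; rewrite {1}(posE f) {1}(posE g); ring.
Qed.

Lemma lsumZ (c : R) f : summ f -> lsum (fun n => c * f n) = c * lsum f.
Proof.
move=> sf; have s1 := summ_pos sf; have s2 := summ_pos (summN sf).
have [c0|c0] := leP 0 c.
  rewrite (@lsum_decomp _ (fun n => c * pos f n) (fun n => c * pos (fun n => - f n) n)).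
  - by rewrite !nsumZ //; [rewrite /lsum; ring|exact: pos_ge0|exact: pos_ge0].
  - by move=> n; rewrite mulr_ge0 ?pos_ge0.
  - by move=> n; rewrite mulr_ge0 ?pos_ge0.
  - exact: summZ.
  - exact: summZ.
  - by move=> n; rewrite {1}(posE f); ring.
have c0' : 0 <= - c by rewrite oppr_ge0 ltW.
rewrite (@lsum_decomp _ (fun n => - c * pos (fun n => - f n) n) (fun n => - c * pos f n)).
- by rewrite !nsumZ //; [rewrite /lsum; ring|exact: pos_ge0|exact: pos_ge0].
- by move=> n; rewrite mulr_ge0 ?pos_ge0.
- by move=> n; rewrite mulr_ge0 ?pos_ge0.
- exact: summZ.
- exact: summZ.
- by move=> n; rewrite {1}(posE f); ring.
Qed.

Lemma lsumN f : summ f -> lsum (fun n => - f n) = - lsum f.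
Proof.
move=> sf; rewrite -mulN1r -lsumZ //; congr lsum; apply/funext => n.
by rewrite mulN1r.
Qed.

Lemma lsumB f g : summ f -> summ g -> lsum (fun n => f n - g n) = lsum f - lsum g.
Proof. by move=> sf sg; rewrite lsumD ?lsumN //; exact: summN. Qed.

Lemma lsum_ge0 f : (forall n, 0 <= f n) -> summ f -> 0 <= lsum f.
Proof. by move=> f0 sf; rewrite lsum_nn // nsum_ge0. Qed.

Lemma ler_lsum f g : summ f -> summ g -> (forall n, f n <= g n) -> lsum f <= lsum g.
Proof.
move=> sf sg fg; rewrite -subr_ge0 -lsumB //; apply: lsum_ge0.
  by move=> n; rewrite subr_ge0.
by apply: summD => //; exact: summN.
Qed.

Lemma lsum_reindex (t : K -> K) f : bijective t -> lsum (fun n => f (t n)) = lsum f.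
Proof. by move=> bt; rewrite /lsum (nsum_reindex (pos f)) // (nsum_reindex (pos (fun n => - f n))). Qed.

Lemma summ_reindex (t : K -> K) f : injective t -> summ f -> summ (fun n => f (t n)).
Proof.
move=> it [M hM]; exists M => s us; rewrite -(big_map t predT (fun n => `|f n|)).
by apply: hM; rewrite map_inj_uniq.
Qed.

Lemma summ_sum (I : Type) (r : seq I) (F : I -> K -> R) :
  (forall i, summ (F i)) -> summ (fun n => \sum_(i <- r) F i n).
Proof.
move=> sF; elim: r => [|i r IH].
  have -> : (fun n => \sum_(i <- [::]) F i n) = fun=> 0 by apply/funext => n; rewrite big_nil.
  exact: summ0.
have -> : (fun n => \sum_(j <- i :: r) F j n) = (fun n => F i n + \sum_(i <- r) F i n).
  by apply/funext => n; rewrite big_cons.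
exact: summD.
Qed.

Lemma lsum_sum (I : Type) (r : seq I) (F : I -> K -> R) :
  (forall i, summ (F i)) -> lsum (fun n => \sum_(i <- r) F i n) = \sum_(i <- r) lsum (F i).
Proof.
move=> sF; elim: r => [|i r IH].
  have -> : (fun n => \sum_(i <- [::]) F i n) = fun=> 0 by apply/funext => n; rewrite big_nil.
  by rewrite big_nil lsum_nn //; [rewrite /nsum /total esum1|exact: summ0].
rewrite big_cons -IH -lsumD //; last exact: summ_sum.
by congr lsum; apply/funext => n; rewrite big_cons.
Qed.

Lemma lsum_ge_fin f s : (forall n, 0 <= f n) -> summ f -> uniq s -> \sum_(n <- s) f n <= lsum f.
Proof. by move=> f0 sf us; rewrite lsum_nn // nsum_ge. Qed.

Lemma lsum_ge_term f n : (forall n, 0 <= f n) -> summ f -> f n <= lsum f.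
Proof. by move=> f0 sf; rewrite -[f n](big_seq1 +%R n f) lsum_ge_fin. Qed.

Lemma lsum_le_fin f M : (forall n, 0 <= f n) -> fin_bound f M -> lsum f <= M.
Proof. by move=> f0 hM; rewrite lsum_nn ?nsum_le //; exact: summ_bound hM. Qed.

End Lsum.

(** * Square-summable sequences *)

Section L2.
Variable R : realType.
Local Notation C := R[i].
Implicit Types (u v f g : Z2 -> C) (c z : C) (W : Z2 -> C).

Local Notation sq u := (fun n => nsq (u n)).
Definition sqsum u : R := lsum (sq u).
Definition dot u v : R := lsum (fun n => rdot (u n) (v n)).

Lemma l2P u : l2 u <-> summ (sq u).
Proof.
have E : sqr_sum u = total (sq u) by apply: eq_esum => n _; rewrite nsqE.
rewrite /l2 /= E; split; first by apply: summ_total => n; exact: nsq_ge0.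
by move=> s; rewrite (totalE _ s) ?ltry // => n; exact: nsq_ge0.
Qed.

Lemma l2normE u : l2 u -> l2norm u = Num.sqrt (sqsum u).
Proof.
move=> /l2P su; rewrite /l2norm /sqsum lsum_nn //; last by move=> n; exact: nsq_ge0.
by congr Num.sqrt; rewrite /nsum; congr fine; apply: eq_esum => n _; rewrite nsqE.
Qed.

Lemma summ_rdot u v : l2 u -> l2 v -> summ (fun n => rdot (u n) (v n)).
Proof.
move=> /l2P su /l2P sv; apply: summ_le (summZ 2^-1 (summD su sv)) => n.
by rewrite mulrC; exact: rdot_le.
Qed.

Lemma nsqD_le z (w : C) : nsq (z + w) <= 2 * (nsq z + nsq w).
Proof.
case: z w => [a b] [c d]; rewrite /nsq /=.
have := (sqr_ge0 (a - c), sqr_ge0 (b - d)); rewrite !expr2 => -[]; lra.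
Qed.

Lemma l2D u v : l2 u -> l2 v -> l2 (fun n => u n + v n).
Proof.
move=> /l2P su /l2P sv; apply/l2P; apply: summ_le (summZ 2 (summD su sv)) => n.
by rewrite ger0_norm ?nsq_ge0 ?nsqD_le.
Qed.

Lemma l2M u W (M : R) : (forall n, nsq (W n) <= M) -> l2 u -> l2 (fun n => W n * u n).
Proof.
move=> hM /l2P su; apply/l2P; apply: summ_le (summZ M su) => n.
by rewrite ger0_norm ?nsq_ge0 // nsqM ler_wpM2r ?nsq_ge0.
Qed.

Lemma l2Z u c : l2 u -> l2 (fun n => c * u n).
Proof. by move=> lu; apply: (l2M (W := fun=> c) (M := nsq c)). Qed.

Lemma l2N u : l2 u -> l2 (fun n => - u n).
Proof. by move=> /(l2Z (-1)); congr l2; apply/funext => n; rewrite mulN1r. Qed.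

Lemma l2B u v : l2 u -> l2 v -> l2 (fun n => u n - v n).
Proof. by move=> lu lv; apply: l2D => //; exact: l2N. Qed.

Lemma l20 : l2 (fun=> 0 : C).
Proof.
apply/l2P; rewrite (_ : (fun _ => _) = fun=> 0); first exact: summ0.
by apply/funext => n; rewrite /nsq /= expr0n addr0.
Qed.

Lemma sqsum_ge0 u : l2 u -> 0 <= sqsum u.
Proof. by move=> /l2P su; apply: lsum_ge0 => // n; exact: nsq_ge0. Qed.

Lemma sqsum_term u n : l2 u -> nsq (u n) <= sqsum u.
Proof. by move=> /l2P su; apply: (lsum_ge_term n (f := sq u)) => // k; exact: nsq_ge0. Qed.

Lemma sqsum_eq0 u : l2 u -> sqsum u <= 0 -> u = fun=> 0.
Proof.
move=> lu u0; apply/funext => n; apply/eqP; rewrite -nsq_eq0 eq_le nsq_ge0 andbT.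
exact: le_trans (sqsum_term n lu) u0.
Qed.

Lemma sqsum_dot u : sqsum u = dot u u.
Proof. by congr lsum; apply/funext => n; rewrite rdotzz. Qed.

Lemma sqsumD u v (t : R) : l2 u -> l2 v ->
  sqsum (fun n => u n + t%:C * v n) = sqsum u + 2 * t * dot u v + t ^+ 2 * sqsum v.
Proof.
move=> lu lv; have su := (l2P u).1 lu; have sv := (l2P v).1 lv; have suv := summ_rdot lu lv.
rewrite /sqsum /dot -!lsumZ // -!lsumD //; try by [exact: summZ|exact: summD (summZ _ _)].
  by congr lsum; apply/funext => n; case: (u n) (v n) => [a b] [c d]; rewrite /nsq /rdot /=; ring.
Qed.

Lemma dot_le u v : l2 u -> l2 v -> dot u v <= Num.sqrt (sqsum u) * Num.sqrt (sqsum v).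
Proof.
move=> lu lv; apply: le_sqrtM_quad; rewrite ?sqsum_ge0 // => t.
have := sqsumD (- t) lu lv; rewrite mulrN mulNr sqrrN => <-.
by apply/sqsum_ge0/l2D => //; exact: l2Z.
Qed.

Lemma sqrt_sqsumD u v : l2 u -> l2 v ->
  Num.sqrt (sqsum (fun n => u n + v n)) <= Num.sqrt (sqsum u) + Num.sqrt (sqsum v).
Proof.
move=> lu lv; rewrite -[leRHS]ger0_norm ?addr_ge0 ?sqrtr_ge0 // -sqrtr_sqr ler_wsqrtr //.
have := sqsumD 1 lu lv; rewrite expr1n mulr1 mul1r.
have -> : (fun n => u n + 1%:C * v n) = fun n => u n + v n.
  by apply/funext => n; rewrite mul1r.
move=> ->; rewrite sqrrD !sqr_sqrtr ?sqsum_ge0 //.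
by have := dot_le lu lv; lra.
Qed.


Definition op W u : Z2 -> C := fun n => laplacian u n + W n * u n.

Lemma l2_shift u (a b : int) : l2 u -> l2 (fun n => u (n.1 + a, n.2 + b)).
Proof.
move=> /l2P su; apply/l2P; apply: (@summ_reindex _ _ (fun n : Z2 => (n.1 + a, n.2 + b)) (sq u)) => //.
by move=> [x y] [x' y'] [/addIr -> /addIr ->].
Qed.

Lemma laplacian_shift u : laplacian u = fun n =>
  (u (n.1 + -1, n.2 + 0) + u (n.1 + 1, n.2 + 0)) + (u (n.1 + 0, n.2 + -1) + u (n.1 + 0, n.2 + 1)).
Proof. by apply/funext => n; rewrite /laplacian !addr0. Qed.

Lemma l2_op W u (M : R) : (forall n, nsq (W n) <= M) -> l2 u -> l2 (op W u).
Proof.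
move=> hM lu; apply: l2D; last exact: l2M hM lu.
rewrite laplacian_shift.
by apply: l2D; apply: l2D; exact: l2_shift.
Qed.

Lemma sqsum_shift u (a b : int) : sqsum (fun n => u (n.1 + a, n.2 + b)) = sqsum u.
Proof.
rewrite /sqsum; apply: (@lsum_reindex _ _ (fun n : Z2 => (n.1 + a, n.2 + b)) (sq u)).
by exists (fun n => (n.1 - a, n.2 - b)) => -[x y] /=; rewrite ?addrK ?subrK.
Qed.

Lemma sqsumD_le u v : l2 u -> l2 v ->
  sqsum (fun n => u n + v n) <= 2 * (sqsum u + sqsum v).
Proof.
move=> lu lv; have su := (l2P u).1 lu; have sv := (l2P v).1 lv.
rewrite /sqsum -lsumD // -lsumZ; last exact: summD.
apply: ler_lsum => [||n]; [exact/l2P/l2D|by apply: summZ; exact: summD|exact: nsqD_le].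
Qed.

Lemma sqsumM_le u W (M : R) : (forall n, nsq (W n) <= M) -> l2 u ->
  sqsum (fun n => W n * u n) <= M * sqsum u.
Proof.
move=> hM lu; have su := (l2P u).1 lu.
rewrite /sqsum -lsumZ //; apply: ler_lsum => [||n]; [exact/l2P/(l2M hM)|exact: summZ|].
by rewrite nsqM ler_wpM2r ?nsq_ge0.
Qed.

(** Two uses of [sqsumD_le] on the four shifts give the factor 16 for the Laplacian; a third, adding
    the potential, doubles both contributions. *)
Lemma sqsum_op W u (M : R) : (forall n, nsq (W n) <= M) -> l2 u ->
  sqsum (op W u) <= (32 + 2 * M) * sqsum u.
Proof.
move=> hM lu.
have ls a b := l2_shift a b lu.
have lap : l2 (laplacian u).
  rewrite laplacian_shift.
  by apply: l2D; apply: l2D.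
have lapn : sqsum (laplacian u) <= 16 * sqsum u.
  rewrite laplacian_shift.
  apply: le_trans (sqsumD_le (l2D (ls _ _) (ls _ _)) (l2D (ls _ _) (ls _ _))) _.
  have := sqsumD_le (ls (-1) 0) (ls 1 0); have := sqsumD_le (ls 0 (-1)) (ls 0 1).
  by rewrite !sqsum_shift; lra.
apply: le_trans (sqsumD_le lap (l2M hM lu)) _.
have := sqsumM_le hM lu; lra.
Qed.

Lemma dotC u v : dot u v = dot v u.
Proof. by congr lsum; apply/funext => n; rewrite rdotC. Qed.

Lemma dotDr u v f : l2 u -> l2 v -> l2 f -> dot u (fun n => v n + f n) = dot u v + dot u f.
Proof.
move=> lu lv lf; rewrite /dot -lsumD; try exact: summ_rdot.
by congr lsum; apply/funext => n; rewrite rdotDr.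
Qed.

Lemma dot_shift u v (a b : int) :
  dot (fun n => u (n.1 + a, n.2 + b)) v = dot u (fun n => v (n.1 - a, n.2 - b)).
Proof.
rewrite /dot.
have bij : bijective (fun n : Z2 => (n.1 - a, n.2 - b)).
  by exists (fun n => (n.1 + a, n.2 + b)) => -[x y] /=; rewrite ?addrK ?subrK.
rewrite -(lsum_reindex _ bij); congr lsum; apply/funext => -[x y] /=.
by rewrite !subrK.
Qed.

Lemma dot_op W u v (M : R) : (forall n, nsq (W n) <= M) -> l2 u -> l2 v ->
  dot (op W u) v = dot u (op (fun n => (W n)^*) v).
Proof.
move=> hM lu lv.
have ls a b := l2_shift a b lu; have ls' a b := l2_shift a b lv.
have hM' n : nsq (W n)^* <= M by case: (W n) (hM n) => a b; rewrite /nsq /= sqrrN.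
have lW := l2M hM lu; have lW' := l2M hM' lv.
have E (f : Z2 -> C) X : op X f = (fun n =>
   ((f (n.1 + -1, n.2 + 0) + f (n.1 + 1, n.2 + 0)) + (f (n.1 + 0, n.2 + -1) + f (n.1 + 0, n.2 + 1)))
   + X n * f n) by apply/funext => n; rewrite /op laplacian_shift.
rewrite dotC !E !dotDr //; do ?apply: l2D => //.
rewrite !(dotC v) !dot_shift !opprK !oppr0 [X in X + _ + _]addrC [X in _ + X + _]addrC.
congr (_ + _).
by congr lsum; apply/funext => n; case: (W n) (u n) (v n) => [a b] [c d] [e f]; rewrite /rdot /=; ring.
Qed.

Lemma op_lin W u v c n : op W (fun n => c * u n + v n) n = c * op W u n + op W v n.
Proof. by rewrite /op /laplacian; ring. Qed.

End L2.

(** * A resolvent criterion *)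

Section PointwiseLimits.
Variable R : realType.
Local Notation C := R[i].

(** Pointwise convergence, combined with the norm bound [pcvg_l2], stands in for completeness of l2.
    It suffices because the operators involve finitely many sites at a time. *)
Definition pcvg (u_ : nat -> Z2 -> C) (u : Z2 -> C) := forall n,
  complex.Re (u_ k n) @[k --> \oo] --> complex.Re (u n) /\
  complex.Im (u_ k n) @[k --> \oo] --> complex.Im (u n).

Lemma ReD (z w : C) : complex.Re (z + w) = complex.Re z + complex.Re w.
Proof. by case: z w => a b []. Qed.
Lemma ImD (z w : C) : complex.Im (z + w) = complex.Im z + complex.Im w.
Proof. by case: z w => a b []. Qed.
Lemma ReM (z w : C) : complex.Re (z * w) = complex.Re z * complex.Re w - complex.Im z * complex.Im w.
Proof. by case: z w => a b []. Qed.
Lemma ImM (z w : C) : complex.Im (z * w) = complex.Re z * complex.Im w + complex.Im z * complex.Re w.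
Proof. by case: z w => a b [c d] /=; rewrite addrC; congr (_ + _); rewrite mulrC. Qed.

Lemma pcvgD u_ u v_ v : pcvg u_ u -> pcvg v_ v -> pcvg (fun k n => u_ k n + v_ k n) (fun n => u n + v n).
Proof.
move=> hu hv n; have [u1 u2] := hu n; have [v1 v2] := hv n; rewrite ReD ImD.
by split; [under eq_cvg do rewrite ReD|under eq_cvg do rewrite ImD]; exact: cvgD.
Qed.

Lemma pcvgM u_ u (W : Z2 -> C) : pcvg u_ u -> pcvg (fun k n => W n * u_ k n) (fun n => W n * u n).
Proof.
move=> hu n; have [u1 u2] := hu n; rewrite ReM ImM.
split; [under eq_cvg do rewrite ReM|under eq_cvg do rewrite ImM].
  by apply: cvgB; apply: cvgM => //; exact: cvg_cst.
by apply: cvgD; apply: cvgM => //; exact: cvg_cst.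
Qed.

Lemma pcvg_op u_ u (W : Z2 -> C) : pcvg u_ u -> pcvg (fun k => op W (u_ k)) (op W u).
Proof.
move=> hu; apply: pcvgD; last exact: pcvgM.
by apply: pcvgD; apply: pcvgD => n; exact: hu.
Qed.

Lemma pcvg_cst u : pcvg (fun=> u) u.
Proof. by move=> n; split; exact: cvg_cst. Qed.

Lemma pcvg_unique u_ u v : pcvg u_ u -> pcvg u_ v -> u = v.
Proof.
move=> hu hv; apply/funext => n; have [u1 u2] := hu n; have [v1 v2] := hv n.
apply/eqP; rewrite eq_complex; apply/andP; split; apply/eqP.
  exact: (cvg_unique _ u1 v1).
exact: (cvg_unique _ u2 v2).
Qed.

Lemma pcvg_shift u_ u : pcvg u_ u -> pcvg (fun k => u_ k.+1) u.
Proof.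
move=> hu n; have [u1 u2] := hu n; split.
  by rewrite -(cvg_shiftS (fun k => complex.Re (u_ k n))) in u1.
by rewrite -(cvg_shiftS (fun k => complex.Im (u_ k n))) in u2.
Qed.

(** Fatou's lemma: every finite partial sum passes to the limit with the same bound. *)
Lemma pcvg_l2 u_ u (M : R) : (forall k, l2 (u_ k)) -> (forall k, sqsum (u_ k) <= M) ->
  pcvg u_ u -> l2 u /\ sqsum u <= M.
Proof.
move=> lu hM hu.
have fb : fin_bound (fun n => nsq (u n)) M.
  move=> s us; have h : \sum_(n <- s) nsq (u_ k n) @[k --> \oo] --> \sum_(n <- s) nsq (u n).
    elim: s {us} => [|n s IH].
      by rewrite big_nil; under eq_cvg do rewrite big_nil; exact: cvg_cst.
    rewrite big_cons; under eq_cvg do rewrite big_cons.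
    have [u1 u2] := hu n.
    by apply: cvgD => //; apply: cvgD; rewrite expr2; under eq_cvg do rewrite expr2; exact: cvgM.
  rewrite -(cvg_lim _ h) //; apply: limr_le; first by apply: cvgP h.
  apply: nearW => k; apply: le_trans (hM k); apply: lsum_ge_fin => // [n|]; first exact: nsq_ge0.
  exact/l2P.
split; last by apply: lsum_le_fin => // n; exact: nsq_ge0.
by apply/l2P; apply: summ_bound fb => n; exact: nsq_ge0.
Qed.

Lemma cvg_geometric_steps (a : nat -> R) (c rho : R) : 0 <= c -> 0 <= rho < 1 ->
  (forall k, `|a k.+1 - a k| <= c * rho ^+ k) -> cvgn a.
Proof.
move=> c0 /andP[r0 r1] h.
have cs : cvgn (series (telescope a)).
  apply: normed_cvg; apply: (@series_le_cvg _ _ (geometric c rho)).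
  - by move=> k /=; exact: normr_ge0.
  - by move=> k /=; rewrite mulr_ge0 ?exprn_ge0.
  - by move=> k /=; exact: h.
  - by apply: is_cvg_geometric_series; rewrite ger0_norm.
have -> : a = fun k => a 0%N + series (telescope a) k.
  by apply/funext => k; exact: eq_sum_telescope.
by apply: is_cvgD => //; exact: is_cvg_cst.
Qed.

Lemma pcvg_exists (u_ : nat -> Z2 -> C) (c rho : R) : 0 <= c -> 0 <= rho < 1 ->
  (forall k n, nsq (u_ k.+1 n - u_ k n) <= (c * rho ^+ k) ^+ 2) -> exists u, pcvg u_ u.
Proof.
move=> c0 r01 h.
have b0 k : 0 <= c * rho ^+ k by case/andP: r01 => r0 _; rewrite mulr_ge0 ?exprn_ge0.
have sq (x y b : R) : 0 <= b -> x ^+ 2 + y ^+ 2 <= b ^+ 2 -> `|x| <= b /\ `|y| <= b.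
  move=> hb hxy; split; rewrite -(ler_pXn2r (ltn0Sn 1)) ?nnegrE // real_normK ?num_real //.
    by apply: le_trans hxy; rewrite lerDl sqr_ge0.
  by apply: le_trans hxy; rewrite lerDr sqr_ge0.
have hk n k : `|complex.Re (u_ k.+1 n) - complex.Re (u_ k n)| <= c * rho ^+ k /\
    `|complex.Im (u_ k.+1 n) - complex.Im (u_ k n)| <= c * rho ^+ k.
  by have := h k n; case: (u_ k.+1 n) (u_ k n) => [a b] [a' b']; rewrite /nsq /=; apply: sq.
exists (fun n => limn (fun k => complex.Re (u_ k n)) +i* limn (fun k => complex.Im (u_ k n))) => n /=.
by split; apply: (cvg_geometric_steps c0 r01) => k; have [] := hk n k.
Qed.

End PointwiseLimits.

Lemma conjc_realB (R : realType) (t : R) (w : R[i]) : (t%:C - w)^* = t%:C - w^*.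
Proof. by case: w => x y; simpc. Qed.

(** * Inverting a normal operator that is bounded below *)

Section Resolvent.
Variables (R : realType).
Local Notation C := R[i].
Variables (a a' : Z2 -> C) (k0 : C) (m : R).
Hypothesis a'E : a' = fun n => (a n)^*.
Hypothesis a'D : forall n, a' n = k0 + a n.
Hypothesis a_bound : forall n, nsq (a n) <= m.
Implicit Types (u v f g : Z2 -> C).

Let aE : a = fun n => (a' n)^*.
Proof. by rewrite a'E; apply/funext => n; symmetry; exact: conjcK. Qed.

Let a'_bound n : nsq (a' n) <= m.
Proof. by rewrite a'E; move: (a_bound n); rewrite /nsq; case: (a n) => x y /=; rewrite sqrrN. Qed.

Let M := 32 + 2 * m.

Let l2a u : l2 u -> l2 (op a u). Proof. exact: l2_op a_bound. Qed.
Let l2a' u : l2 u -> l2 (op a' u). Proof. exact: l2_op a'_bound. Qed.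

Let sqa' u : l2 u -> sqsum (op a' u) <= M * sqsum u. Proof. exact: sqsum_op a'_bound. Qed.

Let dota u v : l2 u -> l2 v -> dot (op a u) v = dot u (op a' v).
Proof. by rewrite a'E; exact: dot_op a_bound. Qed.
Let dota' u v : l2 u -> l2 v -> dot (op a' u) v = dot u (op a v).
Proof. by rewrite [in RHS]aE; exact: dot_op a'_bound. Qed.

Let commute u : op a' (op a u) = op a (op a' u).
Proof.
have E f : op a' f = fun n => k0 * f n + op a f n.
  by apply/funext => n; rewrite /op a'D; ring.
by apply/funext => n; rewrite !E op_lin.
Qed.

(** [op a'] is the adjoint of [op a] and differs from it by the scalar [k0], so the operator is
    normal. The lower bound assumed below therefore passes to the adjoint. *)
Lemma sqsum_adjoint u : l2 u -> sqsum (op a' u) = sqsum (op a u).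
Proof.
move=> lu; have h1 := dota' lu (l2a' lu); have h2 := dota lu (l2a lu).
by rewrite !sqsum_dot h1 h2 commute.
Qed.

Variable d : R.
Hypothesis d0 : 0 < d.
Hypothesis lower : forall u, l2 u -> d * sqsum u <= sqsum (op a u).

Let S u := op a' (op a u).

Let S_lin u v (c : C) : S (fun n => c * u n + v n) = fun n => c * S u n + S v n.
Proof.
rewrite /S (_ : op a (fun n => c * u n + v n) = fun n => c * op a u n + op a v n).
  by apply/funext => n; rewrite op_lin.
by apply/funext => n; rewrite op_lin.
Qed.

Let l2S u : l2 u -> l2 (S u). Proof. by move=> lu; apply/l2a'/l2a. Qed.

Let op_inj u : l2 u -> op a u = (fun=> 0) -> u = fun=> 0.
Proof.
move=> lu E; apply: sqsum_eq0 => //; have := lower lu; rewrite E.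
rewrite (_ : sqsum (fun=> 0) = 0); first by rewrite pmulr_rle0.
by apply/eqP; rewrite eq_le sqsum_ge0 ?andbT; [apply: lsum_le_fin => [n|s _]; rewrite ?nsq_ge0 //; rewrite big1 // => n _; rewrite /nsq /= expr0n addr0|exact: l20].
Qed.

Let op'_inj u : l2 u -> op a' u = (fun=> 0) -> u = fun=> 0.
Proof.
move=> lu E; apply: sqsum_eq0 => //; have := lower lu; rewrite -sqsum_adjoint // E.
rewrite (_ : sqsum (fun=> 0) = 0); first by rewrite pmulr_rle0.
by apply/eqP; rewrite eq_le sqsum_ge0 ?andbT; [apply: lsum_le_fin => [n|s _]; rewrite ?nsq_ge0 //; rewrite big1 // => n _; rewrite /nsq /= expr0n addr0|exact: l20].
Qed.

(** The maximum with [d] ensures [s * d <= 1], so the contraction factor [r] is nonnegative and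
    [rho] is its genuine square root. *)
Let M' := Num.max M d.
Let s := M'^-1.
Let T u : Z2 -> C := fun n => u n + (- s)%:C * S u n.

Let M'0 : 0 < M'. Proof. by rewrite lt_max d0 orbT. Qed.
Let s0 : 0 < s. Proof. by rewrite invr_gt0. Qed.
Let r := 1 - s * d.

Let r01 : 0 <= r < 1.
Proof.
rewrite /r subr_ge0 ltrBlDl ltrDr mulr_gt0 // andbT.
by rewrite /s ler_pdivrMl // mulr1 le_max lexx orbT.
Qed.

Let l2T u : l2 u -> l2 (T u).
Proof. by move=> lu; apply: l2D => //; apply/l2Z/l2S. Qed.

(* Since |S u|^2 <= M' |op a u|^2 and <S u, u> = |op a u|^2, the map T = 1 - S/M'
   is a strict contraction of l2. *)
Let T_contract u : l2 u -> sqsum (T u) <= r * sqsum u.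
Proof.
move=> lu; rewrite sqsumD //; last exact: l2S.
have -> : dot u (S u) = sqsum (op a u) by rewrite /S -dota ?sqsum_dot //; exact: l2a.
have h1 : sqsum (S u) <= M' * sqsum (op a u).
  apply: le_trans (sqa' (l2a lu)) _; rewrite ler_wpM2r ?sqsum_ge0 //; first exact: l2a.
  by rewrite le_max lexx.
have h2 := lower lu.
have h3 : s ^+ 2 * sqsum (S u) <= s * sqsum (op a u).
  by rewrite expr2 -mulrA ler_pM2l // ler_pdivrMl.
have h4 : s * (d * sqsum u) <= s * sqsum (op a u) by rewrite ler_wpM2l // ltW.
rewrite sqrrN /r; lra.
Qed.

Let T_sub u v : T (fun n => u n - v n) = fun n => T u n - T v n.
Proof.
have E (X Y : Z2 -> C) : (fun n => X n - Y n) = fun n => (-1) * Y n + X n.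
  by apply/funext => n; ring.
rewrite E /T S_lin; apply/funext => n; ring.
Qed.

Let pcvg_T (u_ : nat -> Z2 -> C) u : pcvg u_ u -> pcvg (fun k => T (u_ k)) (T u).
Proof.
move=> hu; apply: (pcvgD hu); apply: pcvgM.
exact: (@pcvg_op _ _ _ a' (@pcvg_op _ _ _ a hu)).
Qed.

Let rho := Num.sqrt r.
Let rho01 : 0 <= rho < 1.
Proof.
case/andP: r01 => r0 r1; rewrite sqrtr_ge0 /= -sqrtr1 ltr_sqrt //.
Qed.

Let c := (1 - rho)^-1.

(** Iterating [v = f + T v] converges geometrically to a fixed point [g]. Since [T = 1 - s S], the
    fixed point satisfies [s S g = f], so the solution is [s g]; [c] is the sum of the geometric
    series of [rho]. *)
Lemma neumann f : l2 f -> exists g, [/\ l2 g, S g = f & sqsum g <= (s * c) ^+ 2 * sqsum f].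
Proof.
move=> lf; case/andP: r01 => r0 r1; case/andP: rho01 => rho0 rho1.
pose v := fix v k : Z2 -> C := if k is k'.+1 then fun n => f n + T (v k') n else fun=> 0.
have lv k : l2 (v k) by elim: k => [|k IH] /=; [exact: l20|apply: l2D => //; exact: l2T].
have f0 := sqsum_ge0 lf.
have step k : sqsum (fun n => v k.+1 n - v k n) <= r ^+ k * sqsum f.
  elim: k => [|k IH].
    rewrite expr0 mul1r /= (_ : (fun n => _) = fun n => f n) //; apply/funext => n.
    by rewrite /T /S /op /laplacian; ring.
  rewrite (_ : (fun n => _) = T (fun n => v k.+1 n - v k n)).
    apply: le_trans (T_contract _) _; first exact: l2B.
    by rewrite exprS -mulrA ler_wpM2l.
  by rewrite T_sub; apply/funext => n /=; ring.
have bound k : Num.sqrt (sqsum (v k)) <= c * Num.sqrt (sqsum f).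
  have c1 : 1 + rho * c = c by rewrite /c; field; rewrite subr_eq0 gt_eqF.
  have cge : 0 <= c by rewrite invr_ge0 subr_ge0 ltW.
  elim: k => [|k IH].
    rewrite (_ : sqsum (v 0%N) = 0) ?sqrtr0 ?mulr_ge0 ?sqrtr_ge0 //.
    by apply/eqP; rewrite eq_le sqsum_ge0 ?andbT; [apply: lsum_le_fin => [n|s' _]; rewrite ?nsq_ge0 //; rewrite big1 // => n _; rewrite /nsq /= expr0n addr0|exact: l20].
  apply: le_trans (sqrt_sqsumD lf (l2T (lv k))) _.
  rewrite -c1 mulrDl mul1r lerD2l.
  apply: le_trans (ler_wsqrtr (T_contract (lv k))) _.
  by rewrite sqrtrM // -/rho -mulrA ler_wpM2l.
have [g hg] : exists g, pcvg v g.
  apply: (@pcvg_exists _ v (Num.sqrt (sqsum f)) rho); [exact: sqrtr_ge0|exact: rho01|].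
  move=> k n; apply: le_trans (sqsum_term n (l2B (lv k.+1) (lv k))) _.
  by apply: le_trans (step k) _; rewrite exprMn sqr_sqrtr // exprAC sqr_sqrtr // mulrC.
have [lg ng] : l2 g /\ sqsum g <= (c * Num.sqrt (sqsum f)) ^+ 2.
  apply: pcvg_l2 hg => // k; have := bound k.
  rewrite -(ler_pXn2r (ltn0Sn 1)) ?nnegrE ?sqrtr_ge0 ?sqr_sqrtr ?sqsum_ge0 //.
  by rewrite mulr_ge0 ?sqrtr_ge0 // invr_ge0 subr_ge0 ltW.
have fix_g : g = fun n => f n + T g n.
  apply: (@pcvg_unique _ (fun k => v k.+1)); first exact: pcvg_shift.
  by apply: pcvgD; [exact: pcvg_cst|exact: pcvg_T].
have Sz : S (fun=> 0) = fun=> 0.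
  by apply/funext => n; rewrite /S /op /laplacian; ring.
have sg : (fun n => s%:C * g n) = fun n => s%:C * g n + 0 by apply/funext => n; rewrite addr0.
exists (fun n => s%:C * g n); split; first exact: l2Z.
  rewrite sg S_lin Sz; apply/funext => n.
  have := congr1 (fun h => h n) fix_g; rewrite /T rmorphN => E; rewrite addr0.
  by apply: (addrI (g n - s%:C * S g n)); rewrite subrK {1}E; ring.
have nsq_s (n : Z2) : nsq (s%:C : C) <= s ^+ 2 by rewrite /nsq /= expr0n addr0.
apply: le_trans (sqsumM_le nsq_s lg) _.
have -> : (s * c) ^+ 2 * sqsum f = s ^+ 2 * (c * Num.sqrt (sqsum f)) ^+ 2.
  by rewrite -{1}(sqr_sqrtr f0); ring.
by rewrite ler_wpM2l ?sqr_ge0.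
Qed.

Lemma S_inj g h : l2 g -> l2 h -> S g = S h -> g = h.
Proof.
move=> lg lh E.
have E0 : S (fun n => (-1) * h n + g n) = fun=> 0.
  by rewrite S_lin E; apply/funext => n; ring.
have lgh : l2 (fun n => (-1) * h n + g n) by apply: l2D => //; exact: l2Z.
have := op_inj lgh (op'_inj (l2a lgh) E0) => /(congr1 (fun h n => h n)) E1.
apply/funext => n; have := congr1 (fun h => h n) E1 => /= E2.
by apply/eqP; rewrite -subr_eq0 -mulN1r addrC; apply/eqP.
Qed.

(** With [A] for [op a], [S] is the adjoint of [A] composed with [A], and [B] is the inverse of [S]
    applied after the adjoint. It is a left inverse by injectivity of [S], and a right inverse
    because the adjoint is injective. [B0] is merely chosen, so linearity also comes from
    [S_inj]. *)
Lemma inverse_of_lower : exists B : (Z2 -> C) -> (Z2 -> C),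
  bounded_operator B /\ forall u, l2 u -> B (op a u) = u /\ op a (B u) = u.
Proof.
have [B0 hB0] : exists B0, forall f, l2 f ->
    [/\ l2 (B0 f), S (B0 f) = f & sqsum (B0 f) <= (s * c) ^+ 2 * sqsum f].
  have [f|B0 hB0] := @choice _ _ (fun f g => l2 f ->
    [/\ l2 g, S g = f & sqsum g <= (s * c) ^+ 2 * sqsum f]).
    have [/neumann[g hg]|nf] := pselect (l2 f); first by exists g.
    by exists f.
  by exists B0.
pose B u := B0 (op a' u).
have lB u : l2 u -> l2 (B u) by move=> lu; have [] := hB0 _ (l2a' lu).
have SB u : l2 u -> S (B u) = op a' u by move=> lu; have [] := hB0 _ (l2a' lu).
exists B; split; first split.
- exact: lB.
- move=> k u v lu lv.
  have lkuv : l2 (fun n => k * u n + v n) by apply: l2D => //; exact: l2Z.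
  apply: S_inj; [exact: lB|by apply: l2D; [apply/l2Z/lB|exact: lB]|].
  by rewrite SB // S_lin !SB //; apply/funext => n; rewrite op_lin.
- exists (Num.sqrt ((s * c) ^+ 2 * M)) => u lu.
  have [h1 _ h3] := hB0 _ (l2a' lu).
  rewrite !l2normE // -sqrtrM; last first.
    rewrite mulr_ge0 ?sqr_ge0 // /M addr_ge0 // mulr_ge0 //.
    exact: le_trans (nsq_ge0 _) (a_bound 0).
  apply: ler_wsqrtr; apply: le_trans h3 _; rewrite -[leRHS]mulrA ler_wpM2l ?sqr_ge0 //.
  exact: sqa'.
- move=> u lu; split.
    rewrite /B; have [h1 h2 _] := hB0 _ (l2S lu).
    exact: S_inj.
  have E : op a' (fun n => (-1) * u n + op a (B u) n) = fun=> 0.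
    have := SB u lu; rewrite /S => E.
    by apply/funext => n; rewrite op_lin E; ring.
  have lw : l2 (fun n => (-1) * u n + op a (B u) n) by apply: l2D; [exact: l2Z|apply/l2a/lB].
  have E1 := op'_inj lw E.
  apply/funext => n; have := congr1 (fun h => h n) E1 => /= E2.
  by apply/eqP; rewrite -subr_eq0 -mulN1r addrC; apply/eqP.
Qed.

End Resolvent.

Lemma resolvent_of_lower (R : realType) (V : Z2 -> R) (K : R) (z : R[i]) (d : R) :
  (forall n, `|V n| <= K) -> 0 < d ->
  (forall u, l2 u -> d * sqsum u <= sqsum (op (fun n => (V n)%:C - z) u)) ->
  resolvent_set (schrodinger V) z.
Proof.
move=> VK d0 lower; pose a n := (V n)%:C - z.
have opE u : (fun n => schrodinger V u n - z * u n) = op a u.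
  by apply/funext => n; rewrite /schrodinger /op /a; ring.
have a_bound n : nsq (a n) <= 2 * (K ^+ 2 + nsq z).
  apply: le_trans (nsqD_le _ _) _; rewrite ler_pM2l // lerD //.
    rewrite /nsq /= expr0n addr0 -[leLHS]real_normK ?num_real // lerXn2r ?nnegrE //.
    exact: le_trans (VK n).
  by rewrite /nsq; case: (z) => x y /=; rewrite !sqrrN.
have aD n : (a n)^* = (z - z^*) + a n by rewrite /a conjc_realB; ring.
have [B [hB hB']] := inverse_of_lower (a' := fun n => (a n)^*) erefl aD a_bound d0 lower.
by exists B; split => // u /hB'; rewrite !opE.
Qed.

(** * Periodization of test functions *)

Section RealPotential.
Variable R : realType.
Local Notation C := R[i].
Implicit Types (u v : Z2 -> C) (W : Z2 -> R).

Definition rop W u : Z2 -> C := op (fun n => (W n)%:C) u.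
Definition translate (a b : int) u : Z2 -> C := fun n => u (n.1 + a, n.2 + b).
Definition bounded_by W (K : R) := forall n, `|W n| <= K.

Lemma nsq_real (t : R) : nsq (t%:C : C) = t ^+ 2.
Proof. by rewrite /nsq /= expr0n addr0. Qed.

Lemma bounded_nsq W K : bounded_by W K -> forall n, nsq ((W n)%:C : C) <= K ^+ 2.
Proof.
move=> h n; rewrite nsq_real -[leLHS]real_normK ?num_real // lerXn2r ?nnegrE //.
exact: le_trans (h n).
Qed.

Lemma l2_rop W K u : bounded_by W K -> l2 u -> l2 (rop W u).
Proof. by move=> /bounded_nsq; exact: l2_op. Qed.

Lemma dot_rop_sym W K u v : bounded_by W K -> l2 u -> l2 v -> dot (rop W u) v = dot u (rop W v).
Proof.
move=> /bounded_nsq h lu lv; rewrite (dot_op h) //; congr dot; congr op.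
by apply/funext => n; exact: conjc_real.
Qed.

Lemma dot_rop W K u : bounded_by W K -> l2 u -> dot u (rop W u) =
  lsum (fun n => W n * nsq (u n)) + 2 * dot u (translate 1 0 u) + 2 * dot u (translate 0 1 u).
Proof.
move=> hW lu; have hM := bounded_nsq hW.
have ls a b : l2 (translate a b u) := l2_shift a b lu.
have lW := l2M hM lu.
have E : rop W u = fun n => ((translate (-1) 0 u n + translate 1 0 u n) +
  (translate 0 (-1) u n + translate 0 1 u n)) + (W n)%:C * u n.
  by apply/funext => n; rewrite /rop /op laplacian_shift.
have sym a b : dot u (translate (- a) (- b) u) = dot u (translate a b u).
  by rewrite -[RHS]dotC /translate dot_shift.
rewrite E dotDr //; last by apply: l2D; apply: l2D.
rewrite !dotDr //; try by apply: l2D.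
have -> : dot u (translate (-1) 0 u) = dot u (translate 1 0 u) by rewrite -sym oppr0.
have -> : dot u (translate 0 (-1) u) = dot u (translate 0 1 u) by rewrite -(sym 0 1) oppr0.
have -> : dot u (fun n => (W n)%:C * u n) = lsum (fun n => W n * nsq (u n)).
  by congr lsum; apply/funext => n; case: (u n) => a b; rewrite /rdot /nsq /=; ring.
ring.
Qed.

Lemma summ_bounded W K f : bounded_by W K -> summ f -> summ (fun n => W n * f n).
Proof.
move=> h sf; apply: summ_le (summZ K (summ_norm sf)) => n.
by rewrite normrM ler_wpM2r.
Qed.

Lemma dot_rop_dist W W' K K' (e : R) u : bounded_by W K -> bounded_by W' K' ->
  (forall n, `|W n - W' n| <= e) -> l2 u ->
  `|dot u (rop W u) - dot u (rop W' u)| <= e * sqsum u.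
Proof.
move=> hW hW' he lu; rewrite (dot_rop hW) // (dot_rop hW') //.
have su := (l2P u).1 lu; have sW := summ_bounded hW su; have sW' := summ_bounded hW' su.
have -> : forall x y z t : R, x + y + z - (t + y + z) = x - t by move=> *; ring.
have b n : `|W n * nsq (u n) - W' n * nsq (u n)| <= e * nsq (u n).
  by rewrite -mulrBl normrM (ger0_norm (nsq_ge0 _)) ler_wpM2r ?nsq_ge0.
rewrite -lsumB // ler_norml /sqsum -lsumZ // -lsumN; last exact: summZ.
apply/andP; split; apply: ler_lsum; do ?[exact: summZ|by apply: summN; exact: summZ|by apply: summD => //; exact: summN].
  by move=> n; have := b n; rewrite ler_norml => /andP[].
by move=> n; have := b n; rewrite ler_norml => /andP[].
Qed.

Lemma dot_rop_shift W K u (z z' : R) : bounded_by W K -> l2 u ->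
  dot u (rop (fun n => W n - z) u) = dot u (rop (fun n => W n - z') u) - (z - z') * sqsum u.
Proof.
move=> hW lu.
have hb t : bounded_by (fun n => W n - t) (K + `|t|).
  by move=> n; apply: le_trans (ler_normB _ _) _; rewrite lerD.
have su := (l2P u).1 lu; have s' := summ_bounded (hb z') su.
rewrite (dot_rop (hb z)) // (dot_rop (hb z')) // /sqsum -lsumZ //.
have -> : lsum (fun n => (W n - z) * nsq (u n)) =
    lsum (fun n => (W n - z') * nsq (u n)) - lsum (fun n => (z - z') * nsq (u n)).
  rewrite -lsumB //; last exact: summZ.
  by congr lsum; apply/funext => n; ring.
ring.
Qed.

End RealPotential.

Section Periodize.
Variables (R : realType) (a b : nat).
Hypotheses (a0 : (0 < a)%N) (b0 : (0 < b)%N).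
Local Notation C := R[i].
Local Notation T := ('I_a * 'I_b)%type.
Local Notation red := (red a0 b0).
Variables (v : T -> R) (u : Z2 -> C).
Hypothesis lu : l2 u.

Let ind (m : T) (n : Z2) : R := (red n == m)%:R.
Let P m := lsum (fun n => ind m n * nsq (u n)).

Let ind_bound m : bounded_by (ind m) 1.
Proof. by move=> n; rewrite /ind; case: eqP => _; rewrite ?normr0 ?normr1. Qed.

Let ind_ge0 m n : 0 <= ind m n.
Proof. by rewrite /ind; case: eqP. Qed.

Let summP m f : summ f -> summ (fun n => ind m n * f n).
Proof. exact: summ_bounded (ind_bound m). Qed.

Let lsum_partition f : summ f -> lsum f = \sum_m lsum (fun n => ind m n * f n).
Proof.
move=> sf; rewrite -lsum_sum; last by move=> m; exact: summP.
congr lsum; apply/funext => n; rewrite (bigD1 (red n)) //= /ind eqxx mul1r big1 ?addr0 //.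
by move=> m /negPf; rewrite eq_sym => ->; rewrite mul0r.
Qed.

Let P0 m : 0 <= P m.
Proof.
apply: lsum_ge0 => [n|]; last by apply: summP; exact/l2P.
by rewrite mulr_ge0 ?nsq_ge0.
Qed.

Let hop_bound (s : {perm T}) (c d : int) :
  (forall n, red (n.1 + c, n.2 + d) = s (red n)) ->
  `|dot u (translate c d u)| <= \sum_m Num.sqrt (P m) * Num.sqrt (P (s m)).
Proof.
move=> hs.
have lt : l2 (translate c d u) := l2_shift c d lu.
have st := (l2P _).1 lt; have su := (l2P u).1 lu; have sd := summ_rdot lu lt.
rewrite /dot lsum_partition //; apply: le_trans (ler_norm_sum _ _ _) _.
apply: ler_sum => m _.
have PE : P (s m) = lsum (fun n => ind m n * nsq (translate c d u n)).
  rewrite /P -(@lsum_reindex _ _ (fun n : Z2 => (n.1 + c, n.2 + d))).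
    by congr lsum; apply/funext => n; rewrite /ind hs (inj_eq (@perm_inj _ s)).
  by exists (fun n => (n.1 - c, n.2 - d)) => -[x y] /=; rewrite ?addrK ?subrK.
(* The sign [e] makes one quadratic argument yield both halves of the absolute value. *)
have quad (e : R) : `|e| = 1 ->
    e * lsum (fun n => ind m n * rdot (u n) (translate c d u n)) <= Num.sqrt (P m) * Num.sqrt (P (s m)).
  move=> e1; apply: le_sqrtM_quad => // t.
  have -> : P m - 2 * t * (e * lsum (fun n => ind m n * rdot (u n) (translate c d u n))) + t ^+ 2 * P (s m)
     = lsum (fun n => ind m n * nsq (u n + (- t * e)%:C * translate c d u n)).
    have E n : ind m n * nsq (u n + (- t * e)%:C * translate c d u n) =
       ind m n * nsq (u n) + (- (2 * t * e) * (ind m n * rdot (u n) (translate c d u n))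
         + t ^+ 2 * (ind m n * nsq (translate c d u n))).
      have e2 : e ^+ 2 = 1 by rewrite -[LHS]real_normK ?num_real // e1 expr1n.
      have -> : t ^+ 2 = t ^+ 2 * e ^+ 2 by rewrite e2 mulr1.
      by case: (u n) (translate c d u n) => [x y] [x' y']; rewrite /nsq /rdot /=; ring.
    rewrite (funext E).
    have s1 := summP m su; have s2 := summP m sd; have s3 := summP m st.
    by rewrite !lsumD ?lsumZ // -?PE -/(P m); [ring|exact: summZ|exact: summZ|apply: summD; exact: summZ].
  apply: lsum_ge0 => [n|]; first by rewrite mulr_ge0 ?nsq_ge0.
  by apply: summP; apply/l2P/l2D => //; exact: l2Z.
rewrite ler_norml; apply/andP; split.
  by have := quad (-1); rewrite normrN1 mulN1r => /(_ erefl); lra.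
by have := quad 1; rewrite normr1 mul1r => /(_ erefl).
Qed.

Let W n := v (red n).

Let W_bound : exists K, bounded_by W K.
Proof.
exists (\sum_m `|v m|) => n; rewrite /W (bigD1 (red n)) //= lerDl.
by apply: sumr_ge0.
Qed.

Let potential : \sum_m v m * Num.sqrt (P m) ^+ 2 = lsum (fun n => W n * nsq (u n)).
Proof.
have [K hK] := W_bound; have su := (l2P u).1 lu.
rewrite lsum_partition; last exact: summ_bounded hK su.
apply: eq_bigr => m _; rewrite sqr_sqrtr // /P -lsumZ; last exact: summP.
congr lsum; apply/funext => n; rewrite /ind /W; case: eqP => [->|_]; last by rewrite !mul0r mulr0.
by rewrite !mul1r.
Qed.

Let hop_bound1 : `|dot u (translate 1 0 u)| <= \sum_m Num.sqrt (P m) * Num.sqrt (P (shift1 a b m)).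
Proof. by apply: hop_bound => n; rewrite addr0 red_shift1. Qed.
Let hop_bound2 : `|dot u (translate 0 1 u)| <= \sum_m Num.sqrt (P m) * Num.sqrt (P (shift2 a b m)).
Proof. by apply: hop_bound => n; rewrite addr0 red_shift2. Qed.

Lemma periodize_low : dot u (rop W u) < 0 -> cell_low v.
Proof.
have [K hK] := W_bound; rewrite (dot_rop hK) // => h.
exists (fun m => Num.sqrt (P m)); rewrite potential.
move: hop_bound1 hop_bound2; rewrite !ler_norml => /andP[h1 _] /andP[h2 _]; lra.
Qed.

Lemma periodize_high : 0 < dot u (rop W u) -> cell_low (fun m => - v m).
Proof.
have [K hK] := W_bound; rewrite (dot_rop hK) // => h.
exists (fun m => Num.sqrt (P m)).
under eq_bigr do rewrite mulNr.
rewrite sumrN potential.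
move: hop_bound1 hop_bound2; rewrite !ler_norml => /andP[_ h1] /andP[_ h2]; lra.
Qed.

End Periodize.

(** * Approximate eigenfunctions *)

Section Weight.
Variable R : realType.
Local Notation C := R[i].

Definition weight (r : R) (n : Z2) : R := r ^+ (`|n.1|%N + `|n.2|%N).

Lemma geometric_le (r : R) N : 0 <= r < 1 -> \sum_(i < N) r ^+ i <= (1 - r)^-1.
Proof.
move=> /andP[r0 r1]; rewrite -[leRHS]mul1r ler_pdivlMr ?subr_gt0 //.
rewrite -opprB mulrN mulrC -subrX1 opprB gerDl oppr_le0 exprn_ge0 //.
Qed.

(** The bound is a product of two geometric series, times 4 for the possible signs of the
    coordinates. *)
Lemma weight_summ (r : R) : 0 <= r < 1 -> summ (weight r).
Proof.
move=> r01; have /andP[r0 r1] := r01.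
apply: (@summ_bound _ _ _ (4 * ((1 - r)^-1 * (1 - r)^-1))) => [n|s us].
  by rewrite exprn_ge0.
pose N := (\sum_(n <- s) (`|n.1|%N + `|n.2|%N))%N.
have hN n : n \in s -> (`|n.1|%N + `|n.2|%N <= N)%N.
  by move=> ns; rewrite /N (big_rem n) //= leq_addr.
clearbody N.
(* Absolute values and signs embed the finite sequence in a finite product, over which the sum
   factors. *)
pose code (n : Z2) : ('I_N.+1 * 'I_N.+1) * (bool * bool) :=
  ((inord `|n.1|%N, inord `|n.2|%N), ((n.1 < 0), (n.2 < 0))).
have codeE n : n \in s -> weight r n = r ^+ (code n).1.1 * r ^+ (code n).1.2.
  move=> /hN h; rewrite /weight exprD /code /= !inordK //; move: h; move: (absz n.1) (absz n.2) => i j; lia.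
have uc : uniq (map code s).
  rewrite map_inj_in_uniq // => -[x y] [x' y'] /hN h /hN h' /= e.
  have := congr1 (fun c => val c.1.1) e; have := congr1 (fun c => val c.1.2) e.
  have := congr1 (fun c => c.2.1) e; have := congr1 (fun c => c.2.2) e.
  move: h h' => /= h h'; rewrite /= !inordK; try lia.
  by move=> e1 e2 e3 e4; congr (_, _); lia.
have -> : \sum_(n <- s) weight r n = \sum_(c <- map code s) r ^+ c.1.1 * r ^+ c.1.2.
  by rewrite big_map big_seq [RHS]big_seq; apply: eq_bigr => n /codeE.
rewrite big_uniq //=; apply: (@le_trans _ _ (\sum_(c : ('I_N.+1 * 'I_N.+1) * (bool * bool)) r ^+ c.1.1 * r ^+ c.1.2)).
  rewrite [leRHS](bigID (fun c => c \in map code s)) /= lerDl.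
  by apply: sumr_ge0 => c _; rewrite mulr_ge0 ?exprn_ge0.
rewrite -(pair_bigA _ (fun (x : 'I_N.+1 * 'I_N.+1) (y : bool * bool) => r ^+ x.1 * r ^+ x.2)) /=.
under eq_bigr do rewrite sumr_const card_prod card_bool.
rewrite sumrMnl -[leLHS]mulr_natl; apply: ler_wpM2l => //.
rewrite -(pair_bigA _ (fun (x y : 'I_N.+1) => r ^+ x * r ^+ y)) /=.
under eq_bigr do rewrite -mulr_sumr.
rewrite -mulr_suml ler_pM ?sumr_ge0 ?geometric_le // => i _; exact: exprn_ge0.
Qed.

Lemma weight_gt0 (r : R) n : 0 < r -> 0 < weight r n.
Proof. by move=> r0; rewrite exprn_gt0. Qed.

Lemma l2_weight (r : R) (psi : Z2 -> C) (K : R) : 0 <= r < 1 -> (forall n, nsq (psi n) <= K) ->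
  l2 (fun n => (weight r n)%:C * psi n).
Proof.
move=> /[dup] r01 /andP[r0 r1] hK; apply/l2P.
have r2 : 0 <= r ^+ 2 < 1 by rewrite exprn_ge0 // exprn_ilt1.
apply: summ_le (summZ K (weight_summ r2)) => n.
rewrite ger0_norm ?nsq_ge0 // nsqM nsq_real mulrC /weight -exprM mulnC exprM.
by rewrite ler_wpM2r // ?exprn_ge0 // exprn_ge0.
Qed.

(** Between neighbours the relative variation is [r^-1 - 1] when moving outwards to [n'], and
    [1 - r], which is smaller, when moving inwards. *)
Lemma weight_edge (r : R) (n n' : Z2) : 0 < r -> r < 1 ->
  ((`|n'.1| + `|n'.2|).+1 = `|n.1| + `|n.2| \/ `|n'.1| + `|n'.2| = (`|n.1| + `|n.2|).+1)%N ->
  `|weight r n' - weight r n| <= (r^-1 - 1) * weight r n'.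
Proof.
move=> r0 r1 []; rewrite /weight.
  move=> <-; set k := (_ + _)%N.
  have w0 : 0 <= r ^+ k by rewrite exprn_ge0 // ltW.
  rewrite exprS ger0_norm; last by rewrite subr_ge0 ler_piMl // ltW.
  have h : 0 <= r^-1 - 1 - (1 - r).
    have -> : r^-1 - 1 - (1 - r) = (1 - r) ^+ 2 / r by field; rewrite gt_eqF.
    by rewrite divr_ge0 ?sqr_ge0 // ltW.
  have -> : r ^+ k - r * r ^+ k = (1 - r) * r ^+ k by ring.
  by rewrite ler_wpM2r // -subr_ge0.
move=> ->; set k := (_ + _)%N.
have w0 : 0 <= r ^+ k by rewrite exprn_ge0 // ltW.
have -> : (r^-1 - 1) * r ^+ k.+1 = (1 - r) * r ^+ k.
  by rewrite exprS; field; rewrite gt_eqF.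
have -> : r ^+ k.+1 - r ^+ k = - ((1 - r) * r ^+ k) by rewrite exprS; ring.
by rewrite normrN ger0_norm // mulr_ge0 // subr_ge0 ltW.
Qed.

Lemma nsqD4_le (z1 z2 z3 z4 : C) :
  nsq ((z1 + z2) + (z3 + z4)) <= 4 * ((nsq z1 + nsq z2) + (nsq z3 + nsq z4)).
Proof.
have := nsqD_le (z1 + z2) (z3 + z4); have := nsqD_le z1 z2; have := nsqD_le z3 z4; lra.
Qed.

(* Damping a bounded solution by a slowly decaying exponential weight gives an
   approximate eigenfunction. *)
Lemma damped_solution (W : Z2 -> R) (psi : Z2 -> C) (K e : R) : 0 < e ->
  (forall n, nsq (psi n) <= K) -> (exists n, psi n != 0) ->
  (forall n, rop W psi n = 0) ->
  exists u, [/\ l2 u, 0 < sqsum u & l2 (rop W u) -> sqsum (rop W u) <= e * sqsum u].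
Proof.
move=> e0 hK [n0 psi0] sol.
(* The final bound is [16 * k ^+ 2]: one factor 4 comes from [nsqD4_le], the other from summing over
   the four neighbours. [r] is then chosen so that [r^-1 - 1 = k]. *)
pose k := Num.sqrt (e / 16).
have k0 : 0 < k by rewrite sqrtr_gt0 divr_gt0.
pose r := (1 + k)^-1.
have r0 : 0 < r by rewrite invr_gt0 addr_gt0.
have r1 : r < 1 by rewrite invf_lt1 ?ltrDl ?addr_gt0.
have rk : r^-1 - 1 = k by rewrite /r invrK addrC addKr.
pose u : Z2 -> C := fun n => (weight r n)%:C * psi n.
have lu : l2 u by apply: l2_weight hK; rewrite ltW.
have su := (l2P u).1 lu.
exists u; split => //.
  apply: lt_le_trans (sqsum_term n0 lu); rewrite lt0r nsq_ge0 andbT nsq_eq0 mulf_neq0 //.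
  by rewrite -nsq_eq0 nsq_real sqrf_eq0 gt_eqF // weight_gt0.
move=> lr.
pose near n := (nsq (u (n.1 + -1, n.2 + 0)) + nsq (u (n.1 + 1, n.2 + 0))) +
  (nsq (u (n.1 + 0, n.2 + -1)) + nsq (u (n.1 + 0, n.2 + 1))).
have edge n n' : ((`|n'.1| + `|n'.2|).+1 = `|n.1| + `|n.2| \/ `|n'.1| + `|n'.2| = (`|n.1| + `|n.2|).+1)%N ->
    nsq (u n' - (weight r n)%:C * psi n') <= k ^+ 2 * nsq (u n').
  move=> h; have -> : u n' - (weight r n)%:C * psi n' = (weight r n' - weight r n)%:C * psi n'.
    by rewrite rmorphB mulrBl.
  rewrite !nsqM !nsq_real mulrA ler_wpM2r ?nsq_ge0 // -[leLHS]real_normK ?num_real //.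
  have w0 := weight_gt0 n' r0; have hw := weight_edge r0 r1 h; rewrite rk in hw.
  by rewrite -exprMn ler_pXn2r // nnegrE mulr_ge0 // ltW.
(* Subtracting the weight at [n] times the vanishing [rop W psi n] cancels the potential term and
   leaves only differences of weights along the four edges. *)
have pt n : nsq (rop W u n) <= 4 * k ^+ 2 * near n.
  have -> : rop W u n = rop W u n - (weight r n)%:C * rop W psi n by rewrite sol mulr0 subr0.
  have -> : rop W u n - (weight r n)%:C * rop W psi n =
    ((u (n.1 + -1, n.2 + 0) - (weight r n)%:C * psi (n.1 + -1, n.2 + 0)) +
     (u (n.1 + 1, n.2 + 0) - (weight r n)%:C * psi (n.1 + 1, n.2 + 0))) +
    ((u (n.1 + 0, n.2 + -1) - (weight r n)%:C * psi (n.1 + 0, n.2 + -1)) +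
     (u (n.1 + 0, n.2 + 1) - (weight r n)%:C * psi (n.1 + 0, n.2 + 1))).
    by rewrite /rop /op !laplacian_shift {5}/u; ring.
  apply: le_trans (nsqD4_le _ _ _ _) _; rewrite -[leRHS]mulrA ler_pM2l // /near.
  have dist (x1 x2 x3 x4 t : R) : t * ((x1 + x2) + (x3 + x4)) = (t * x1 + t * x2) + (t * x3 + t * x4) by ring.
  by rewrite dist; apply: lerD; apply: lerD; apply: edge => /=; lia.
have ss x y : summ (fun n => nsq (u (n.1 + x, n.2 + y))) by apply/l2P/l2_shift.
have snear : lsum near = 4 * sqsum u.
  have E x y : lsum (fun n => nsq (u (n.1 + x, n.2 + y))) = sqsum u := sqsum_shift u x y.
  have -> : 4 * sqsum u = (lsum (fun n => nsq (u (n.1 + -1, n.2 + 0))) + lsum (fun n => nsq (u (n.1 + 1, n.2 + 0))))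
    + (lsum (fun n => nsq (u (n.1 + 0, n.2 + -1))) + lsum (fun n => nsq (u (n.1 + 0, n.2 + 1)))).
    by rewrite !E; ring.
  by rewrite -[X in _ = X + _]lsumD // -[X in _ = _ + X]lsumD // -lsumD //; exact: summD.
have sn : summ near by apply: summD; apply: summD.
apply: (@le_trans _ _ (lsum (fun n => 4 * k ^+ 2 * near n))).
  by apply: ler_lsum => //; [exact/l2P|exact: summZ].
have k2 : k ^+ 2 = e / 16 by rewrite sqr_sqrtr // divr_ge0 // ltW.
by rewrite lsumZ // snear k2 le_eqVlt; apply/orP; left; apply/eqP; field.
Qed.

End Weight.

Section BlochWave.
Variables (R : realType) (a b : nat).
Hypotheses (a0 : (0 < a)%N) (b0 : (0 < b)%N).
Local Notation C := R[i].
Local Notation T := ('I_a * 'I_b)%type.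
Local Notation red := (red a0 b0).

Lemma red_unshift1 n : red (n.1 - 1, n.2) = ((shift1 a b)^-1 (red n))%g.
Proof.
have := red_shift1 a0 b0 (n.1 - 1, n.2); rewrite /= subrK -surjective_pairing => ->.
by rewrite permK.
Qed.

Lemma red_unshift2 n : red (n.1, n.2 - 1) = ((shift2 a b)^-1 (red n))%g.
Proof.
have := red_shift2 a0 b0 (n.1, n.2 - 1); rewrite /= subrK -surjective_pairing => ->.
by rewrite permK.
Qed.

(** A kernel vector on the torus, extended periodically and multiplied by the plane wave of phase
    [n1 x + n2 y], undoes the gauge change. *)
Lemma bloch_wave (v : T -> R) x y : bloch_det (shift1 a b) (shift2 a b) v x y = 0 ->
  exists psi : Z2 -> C, [/\ exists K, forall n, nsq (psi n) <= K, exists n, psi n != 0 &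
    forall n, rop (fun n => v (red n)) psi n = 0].
Proof.
move=> /bloch_det0P[phi [[m pm] h]].
pose ph (n : Z2) := (n.1)%:~R * x + (n.2)%:~R * y.
exists (fun n => expi (ph n) * phi (red n)); split.
- exists (\sum_m nsq (phi m)) => n; rewrite nsq_expi (bigD1 (red n)) //= lerDl.
  by apply: sumr_ge0 => k _; exact: nsq_ge0.
- by exists (emb m); rewrite mulf_neq0 ?expi_neq0 // red_emb.
move=> n; rewrite /rop /op /laplacian red_unshift1 red_unshift2 red_shift1 red_shift2.
have e1 : ph (n.1 - 1, n.2) = - x + ph n by rewrite /ph /= rmorphB; ring.
have e2 : ph (n.1 + 1, n.2) = x + ph n by rewrite /ph /= rmorphD; ring.
have e3 : ph (n.1, n.2 - 1) = - y + ph n by rewrite /ph /= rmorphB; ring.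
have e4 : ph (n.1, n.2 + 1) = y + ph n by rewrite /ph /= rmorphD; ring.
rewrite e1 e2 e3 e4 (expiD (- x)) (expiD x) (expiD (- y)) (expiD y) -[RHS](mulr0 (expi (ph n))) -(h (red n)) /bloch; ring.
Qed.

End BlochWave.

(** * The spectrum and the sign of the quadratic form *)

Section Spectrum.
Variables (R : realType) (V : Z2 -> R) (K : R).
Hypothesis VK : bounded_by V K.
Local Notation C := R[i].
Implicit Types (u : Z2 -> C) (x y z : R).

Let sub_bound z : bounded_by (fun n => V n - z) (K + `|z|).
Proof. by move=> n; apply: le_trans (ler_normB _ _) _; rewrite lerD. Qed.

Lemma lower_of_resolvent z : resolvent_set (schrodinger V) z%:C -> exists2 M : R, 0 <= M &
  forall u, l2 u -> sqsum u <= M * sqsum (rop (fun n => V n - z) u).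
Proof.
move=> [B [[lB _ [M hM]] hB]]; exists (M ^+ 2); first exact: sqr_ge0.
move=> u lu; have lr := l2_rop (sub_bound z) lu.
have [h1 _] := hB u lu.
have E : (fun n => schrodinger V u n - z%:C * u n) = rop (fun n => V n - z) u.
  by apply/funext => n; rewrite /schrodinger /rop /op rmorphB; ring.
have := hM _ lr; rewrite -{1}E h1 !l2normE // => h.
have N0 := sqsum_ge0 lu; have N1 := sqsum_ge0 lr.
rewrite -(sqr_sqrtr N0) -(sqr_sqrtr N1) -exprMn.
by rewrite lerXn2r ?nnegrE ?sqrtr_ge0 // (le_trans (sqrtr_ge0 _) h).
Qed.

Lemma spectrum_approx (z : C) (d : R) : 0 < d -> spectrum (schrodinger V) z ->
  exists2 u, l2 u & sqsum (op (fun n => (V n)%:C - z) u) < d * sqsum u.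
Proof.
move=> d0 sp; apply: contrapT => none; apply: sp; apply: (resolvent_of_lower VK d0) => u lu.
by rewrite leNgt; apply/negP => h; apply: none; exists u.
Qed.

(** For [z = x + i y] the squared norm of [(H - z) u] is that of [(H - x) u] plus [y ^+ 2] times
    that of [u], so [y != 0] gives a lower bound. *)
Lemma spectrum_real (z : C) : spectrum (schrodinger V) z -> complex.Im z = 0.
Proof.
case: z => x y sp /=; apply/eqP; apply/negPn/negP => y0.
have y2 : 0 < y ^+ 2 by rewrite lt0r sqrf_eq0 y0 sqr_ge0.
have [u lu] := spectrum_approx y2 sp; rewrite ltNge => /negP; apply.
pose X := rop (fun n => V n - x) u; pose u' : Z2 -> C := fun n => (0 -i* 1) * u n.
have lX : l2 X := l2_rop (sub_bound x) lu.
have lu' : l2 u' by exact: l2Z.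
have E : op (fun n => (V n)%:C - (x +i* y)) u = fun n => X n + y%:C * u' n.
  apply/funext => n; rewrite /op /X /rop /op /u'.
  have -> : x +i* y = x%:C - y%:C * (0 -i* 1) by simpc; congr (_ +i* _); ring.
  by rewrite rmorphB; ring.
(* Here [u'] is [- i u], and the cross term vanishes because [H - x] is symmetric and commutes with
   multiplication by [- i]. *)
have XX : dot X u' = - dot X u'.
  have E' : rop (fun n => V n - x) u' = fun n => (0 -i* 1) * X n.
    apply/funext => n; rewrite /X /rop /op /laplacian /u'; ring.
  rewrite {1}(dot_rop_sym (sub_bound x)) // E' -lsumN; last exact: summ_rdot.
  congr lsum; apply/funext => n; rewrite /u'.
  by case: (u n) (X n) => [c d] [c' d']; rewrite /rdot /=; ring.
rewrite E sqsumD // (_ : dot X u' = 0); last by lra.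
have -> : sqsum u' = sqsum u.
  by congr lsum; apply/funext => n; rewrite nsqM {1}/nsq /= expr0n sqrrN expr1n add0r mul1r.
by rewrite mulr0 addr0 lerDr sqsum_ge0.
Qed.

(** An approximate eigenfunction at [x] with error half the distance to [z] gives the form at energy
    [z] the sign of [x - z]. *)
Lemma spectrum_side x z : x != z -> spectrum (schrodinger V) x%:C ->
  exists u, [/\ l2 u, 0 < sqsum u &
    `|dot u (rop (fun n => V n - x) u)| <= `|x - z| / 2 * sqsum u].
Proof.
move=> xz sp; have d0 : 0 < `|x - z| / 2 by rewrite divr_gt0 // normr_gt0 subr_eq0.
have [u lu h] := spectrum_approx (exprn_gt0 2 d0) sp.
have E : op (fun n => (V n)%:C - x%:C) u = rop (fun n => V n - x) u.
  by apply/funext => n; rewrite /rop /op rmorphB.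
rewrite E in h; have lX := l2_rop (sub_bound x) lu.
have N0 := sqsum_ge0 lu.
have Np : 0 < sqsum u.
  rewrite lt0r N0 andbT; apply/eqP => N00; move: h; rewrite N00 mulr0.
  by rewrite ltNge sqsum_ge0.
exists u; split => //.
have key : Num.sqrt (sqsum u) * Num.sqrt (sqsum (rop (fun n => V n - x) u)) <= `|x - z| / 2 * sqsum u.
  rewrite -sqrtrM // -[leRHS]ger0_norm ?mulr_ge0 ?(ltW d0) // -sqrtr_sqr ler_wsqrtr //.
  by rewrite exprMn [X in _ <= _ * X]expr2 mulrA [leRHS]mulrC ler_wpM2l // ltW.
rewrite ler_norml; apply/andP; split; last exact: le_trans (dot_le lu lX) key.
rewrite lerNl; apply: le_trans key.
have := dot_le (l2N lu) lX.
have -> : dot (fun n => - u n) (rop (fun n => V n - x) u) = - dot u (rop (fun n => V n - x) u).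
  rewrite /dot -lsumN; last exact: summ_rdot.
  by congr lsum; apply/funext => n; case: (u n) (rop _ _ n) => [c d] [c' d']; rewrite /rdot /=; ring.
have -> // : sqsum (fun n => - u n) = sqsum u.
by congr lsum; apply/funext => n; case: (u n) => c d; rewrite /nsq /= !sqrrN.
Qed.

Lemma spectrum_below x z : x < z -> spectrum (schrodinger V) x%:C ->
  exists2 u, l2 u & dot u (rop (fun n => V n - z) u) < 0.
Proof.
move=> xz /(spectrum_side (z := z))[|u [lu Np h]]; first by rewrite lt_eqF.
exists u => //; rewrite (dot_rop_shift _ x VK lu).
move: h; rewrite ler_norml (@ltr0_norm _ (x - z)) ?subr_lt0 // => /andP[_ h].
have : 0 < (z - x) / 2 * sqsum u by rewrite mulr_gt0 // divr_gt0 // subr_gt0.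
lra.
Qed.

Lemma spectrum_above x z : z < x -> spectrum (schrodinger V) x%:C ->
  exists2 u, l2 u & 0 < dot u (rop (fun n => V n - z) u).
Proof.
move=> xz /(spectrum_side (z := z))[|u [lu Np h]]; first by rewrite gt_eqF.
exists u => //; rewrite (dot_rop_shift _ x VK lu).
move: h; rewrite ler_norml (@gtr0_norm _ (x - z)) ?subr_gt0 // => /andP[h _].
have : 0 < (x - z) / 2 * sqsum u by rewrite mulr_gt0 // divr_gt0 // subr_gt0.
lra.
Qed.

(* The test functions r^(|n1|+|n2|) and (-1)^(n1+n2) r^(|n1|+|n2|) see the same
   potential energy but opposite hopping energies. *)
Lemma exists_between : exists z u u', [/\ l2 u, l2 u',
  dot u (rop (fun n => V n - z) u) < 0 & 0 < dot u' (rop (fun n => V n - z) u')].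
Proof.
pose r : R := 2^-1.
have r01 : 0 <= r < 1 by rewrite invr_ge0 ler0n invf_lt1 ?ltr1n.
have r0 : 0 < r by rewrite invr_gt0.
pose sg (n : Z2) : C := (-1) ^ (n.1 + n.2).
have sg2 n : nsq (sg n) = 1.
  rewrite /sg; case: (_ + _) => k; rewrite ?NegzE -?exprnN -?exprnP.
    by elim: k => [|k IH]; rewrite ?expr0 ?exprS ?nsqM ?IH /nsq /= ?oppr0 ?expr0n /= ?sqrrN ?expr1n ?addr0 ?mulr1.
  rewrite -exprVn invrN1; elim: k.+1 => [|j IH]; rewrite ?expr0 ?exprS ?nsqM ?IH /nsq /= ?oppr0 ?expr0n /= ?sqrrN ?expr1n ?addr0 ?mulr1 //.
pose w : Z2 -> C := fun n => (weight r n)%:C * 1.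
pose w' : Z2 -> C := fun n => (weight r n)%:C * sg n.
have lw : l2 w by apply: (l2_weight (K := 1)) => // n; rewrite nsq_real expr1n.
have lw' : l2 w' by apply: (l2_weight (K := 1)) => // n; rewrite sg2.
pose P := lsum (fun n => V n * nsq (w n)).
pose H1 := dot w (translate 1 0 w); pose H2 := dot w (translate 0 1 w).
have hop_gt0 a b : 0 < dot w (translate a b w).
  have t0 n : 0 < rdot (w n) (translate a b w n).
    have -> : rdot (w n) (translate a b w n) = weight r n * weight r (n.1 + a, n.2 + b).
      by rewrite /rdot /translate /w /=; ring.
    by rewrite mulr_gt0 // weight_gt0.
  apply: lt_le_trans (lsum_ge_term (0, 0) (f := fun n => rdot (w n) (translate a b w n)) _ _); first exact: t0.
    by move=> n; exact: ltW.
  exact: summ_rdot lw (l2_shift _ _ lw).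
have nsq1 : nsq (1 : C) = 1 by rewrite /nsq /= expr1n expr0n addr0.
have e12 n : nsq (w' n) = nsq (w n) by rewrite /w' /w !nsqM sg2 nsq1.
have hopN a b : (forall n : Z2, sg (n.1 + a, n.2 + b) = - sg n) ->
    dot w' (translate a b w') = - dot w (translate a b w).
  move=> hs; rewrite /dot -lsumN; last exact: summ_rdot lw (l2_shift _ _ lw).
  congr lsum; apply/funext => n; rewrite /translate /w' /w hs.
  have : nsq (sg n) = 1 by [].
  case: (sg n) => c d; rewrite /nsq /rdot /= => cd.
  set p := weight r n; set q := weight r _.
  have -> : (p * c - 0 * d) * (q * - c - 0 * - d) + (p * d + 0 * c) * (q * - d + 0 * - c) =
    - (p * q * (c ^+ 2 + d ^+ 2)) by ring.
  by rewrite cd; ring.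
have sgS n : (-1 : C) ^ (n + 1) = - (-1) ^ n by rewrite expfzDr ?oppr_eq0 ?oner_eq0 // expr1z mulrN1.
have n1 := hopN 1 0 (fun n => etrans (congr1 _ (_ : n.1 + 1 + (n.2 + 0) = (n.1 + n.2) + 1)) (sgS _)).
have n2 := hopN 0 1 (fun n => etrans (congr1 _ (_ : n.1 + 0 + (n.2 + 1) = (n.1 + n.2) + 1)) (sgS _)).
have Np : 0 < sqsum w.
  apply: lt_le_trans (sqsum_term 0 lw).
  by rewrite /w mulr1 nsq_real exprn_gt0 // weight_gt0.
(* The energy at which the potential contribution cancels for both test functions, leaving only the
   hopping terms. *)
pose z := P / sqsum w.
have sw := (l2P w).1 lw.
have pot u : (forall n, nsq (u n) = nsq (w n)) -> lsum (fun n => (V n - z) * nsq (u n)) = 0.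
  move=> hu; have -> : (fun n => (V n - z) * nsq (u n)) = fun n => V n * nsq (w n) - z * nsq (w n).
    by apply/funext => n; rewrite hu; ring.
  rewrite lsumB ?lsumZ //; [|exact: summ_bounded VK sw|exact: summZ].
  by rewrite -/P -/(sqsum w) /z divfK ?subrr // gt_eqF.
have h1 := hop_gt0 1 0; have h2 := hop_gt0 0 1.
exists z, w', w; split => //; rewrite (dot_rop (sub_bound z)) // pot // add0r.
  rewrite n1 ?n2; try by move=> n; ring.
  lra.
lra.
Qed.

End Spectrum.

(** * The spectrum of the limit operator *)

Section LimitPeriodic.
Variables (R : realType) (V : Z2 -> R) (K : R).
Hypothesis VK : bounded_by V K.
Hypothesis approx : forall e : R, 0 < e -> exists W a b,
  [/\ (0 < a)%N, (0 < b)%N, ab_periodic a b W, good a b W & forall n, `|V n - W n| <= e].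
Implicit Types (z : R).

Lemma mem_spectrum z u u' : l2 u -> l2 u' ->
  dot u (rop (fun n => V n - z) u) < 0 -> 0 < dot u' (rop (fun n => V n - z) u') ->
  spectrum (schrodinger V) z%:C.
Proof.
move=> lu lu' hu hu' /(lower_of_resolvent VK)[M M0 hM].
have N0 := sqsum_ge0 lu; have N0' := sqsum_ge0 lu'.
(* Chosen so that the resolvent bound finally gives [sqsum f <= 4 * (eps * M) * sqsum f], at most
   half of [sqsum f], a contradiction. *)
pose eps : R := (8 * (M + 1))^-1.
have M1 : 0 < M + 1 by rewrite ltr_wpDl.
have eps0 : 0 < eps by rewrite invr_gt0 mulr_gt0.
have epsM : eps * (M + 1) = 8^-1 by rewrite /eps; field; rewrite gt_eqF.
(* An approximation within [e1], and within [e2] below, changes each form by at most half of its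
   value, so both signs persist; the [+ 1] avoids a vanishing denominator. *)
pose e1 := - dot u (rop (fun n => V n - z) u) / (2 * (sqsum u + 1)).
pose e2 := dot u' (rop (fun n => V n - z) u') / (2 * (sqsum u' + 1)).
have e10 : 0 < e1 by rewrite divr_gt0 ?oppr_gt0 // mulr_gt0 // ltr_wpDl.
have e20 : 0 < e2 by rewrite divr_gt0 // mulr_gt0 // ltr_wpDl.
(* The bound [e <= 1] turns the squared error [e ^+ 2] into at most [e], hence at most [eps]. *)
have [e [e0 [el1 [ee [ee1 ee2]]]]] : exists e : R, 0 < e /\ e <= 1 /\ e <= eps /\ e <= e1 /\ e <= e2.
  exists (Num.min (Num.min 1 eps) (Num.min e1 e2)).
  by rewrite !lt_min !ge_min ltr01 eps0 e10 e20 !lexx !orbT.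
have [W [a [b [a0 b0 per g hW]]]] := approx e0.
have WK : bounded_by W (K + e).
  move=> n; rewrite -[W n](subKr (V n)); apply: le_trans (ler_normB _ _) _.
  by rewrite lerD.
have bz X L : bounded_by X L -> bounded_by (fun n => X n - z) (L + `|z|).
  by move=> hX n; apply: le_trans (ler_normB _ _) _; rewrite lerD.
have dist n : `|(V n - z) - (W n - z)| <= e by rewrite opprB addrA subrK.
pose v := cell (a := a) (b := b) W z.
have WE : (fun n => W n - z) = fun n => v (red a0 b0 n).
  by apply/funext => n; rewrite /v /cell -periodic_red.
have half (t N : R) : 0 <= N -> t / (2 * (N + 1)) * N <= t / 2 \/ t <= 0.
  move=> NN; have [t0|t0] := leP t 0; [by right|left].
  have -> : t / (2 * (N + 1)) * N = t / 2 * (N / (N + 1)).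
    by field; rewrite gt_eqF // ltr_wpDl.
  have NN1 : N / (N + 1) <= 1 by rewrite ler_pdivrMr ?ltr_wpDl // mul1r lerDl.
  by apply: ler_piMr => //; rewrite divr_ge0 // ltW.
have low_v : cell_low v.
  apply: (@periodize_low R a b a0 b0 v u lu); rewrite -WE.
  have := dot_rop_dist (bz _ _ VK) (bz _ _ WK) dist lu.
  rewrite ler_norml => /andP[h _].
  have : e * sqsum u <= e1 * sqsum u by rewrite ler_wpM2r.
  by case: (half (- dot u (rop (fun n => V n - z) u)) (sqsum u) N0); rewrite /e1; lra.
have low_Nv : cell_low (fun m => - v m).
  apply: (@periodize_high R a b a0 b0 v u' lu'); rewrite -WE.
  have := dot_rop_dist (bz _ _ VK) (bz _ _ WK) dist lu'.
  rewrite ler_norml => /andP[_ h].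
  have : e * sqsum u' <= e2 * sqsum u' by rewrite ler_wpM2r.
  by case: (half (dot u' (rop (fun n => V n - z) u')) (sqsum u') N0'); rewrite /e2; lra.
have [x [y Dxy]] : exists x y, bloch_det (shift1 a b) (shift2 a b) v x y = 0.
  by case: (g z low_v low_Nv) => m; have [[|w s] [_ //= _ h]] := m 1%N;
    have [x [y [_ hxy]]] := h w (mem_head _ _); exists x, y.
have [psi [[L hL] psi0 sol]] := bloch_wave a0 b0 Dxy.
have [f [lf f0 hf]] := damped_solution eps0 hL psi0 sol.
rewrite -WE in hf.
have lr := l2_rop (bz _ _ WK) lf.
pose dV n := V n - W n.
have ldV : l2 (fun n => (dV n)%:C * f n) := l2M (bounded_nsq hW) lf.
have E : rop (fun n => V n - z) f = fun n => rop (fun n => W n - z) f n + (dV n)%:C * f n.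
  by apply/funext => n; rewrite /rop /op /dV !rmorphB; ring.
have h1 := hM f lf; rewrite E in h1.
have h2 := sqsumD_le lr ldV.
have h3 : sqsum (fun n => (dV n)%:C * f n) <= eps * sqsum f.
  apply: le_trans (sqsumM_le (bounded_nsq hW) lf) _.
  by rewrite ler_wpM2r ?(ltW f0) // expr2 (le_trans _ ee) // ler_piMl // ltW.
have h4 : M * sqsum (fun n => rop (fun n => W n - z) f n + (dV n)%:C * f n) <= M * (4 * eps * sqsum f).
  by rewrite ler_wpM2l //; have := hf lr; lra.
have h5 : sqsum f <= 4 * (eps * M) * sqsum f by apply: le_trans h1 (le_trans h4 _); lra.
have h6 : eps * M <= 8^-1 by rewrite -epsM ler_pM2l // lerDl.
have : 4 * (eps * M) * sqsum f <= 4 * 8^-1 * sqsum f.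
  by rewrite ler_wpM2r ?(ltW f0) // ler_wpM2l.
move: f0 h5; lra.
Qed.

Lemma spectrum_interval : is_real_interval (spectrum (schrodinger V)).
Proof.
exists [set x : R | spectrum (schrodinger V) x%:C]; split.
- move=> x y sx sy z /andP[xz zy] /=.
  move: xz; rewrite le_eqVlt => /orP[/eqP <- //|xz].
  move: zy; rewrite le_eqVlt => /orP[/eqP -> //|zy].
  have [u lu hu] := spectrum_below VK xz sx.
  have [u' lu' hu'] := spectrum_above VK zy sy.
  exact: mem_spectrum hu hu'.
- have [z [u [u' [lu lu' hu hu']]]] := exists_between VK.
  by exists z; exact: mem_spectrum hu hu'.
apply/seteqP; split => [z sz|_ [x sx <-] //].
have := spectrum_real VK sz; case: z sz => x y sz /= y0.
have e : x%:C = x +i* y by rewrite y0.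
by exists x => /=; rewrite e.
Qed.

End LimitPeriodic.

Lemma supnorm_le (R : realType) (V : Z2 -> R) (d : R) :
  (supnorm V <= d%:E)%E -> forall n, `|V n| <= d.
Proof.
move=> h n; rewrite -lee_fin; apply: le_trans h; apply: ereal_sup_ubound.
by exists n.
Qed.

(** * Geometric tails of the series of potentials *)

Section Tail.
Variables (R : realType) (V : nat -> Z2 -> R).
Hypothesis hV : forall t n, (1 <= t)%N -> `|V t n| <= 2^-1 ^+ t.

Let psum n N := \sum_(1 <= t < N) V t n.

(** The sum telescopes. The shifted exponent matches tails that start just after index [a], since
    [partial V a] already contains the term [a]. *)
Lemma half_sum (a N : nat) : \sum_(a <= t < a + N) (2^-1 : R) ^+ t.+1 <= 2^-1 ^+ a.
Proof.
have E : \sum_(a <= t < a + N) (2^-1 : R) ^+ t.+1 = 2^-1 ^+ a - 2^-1 ^+ (a + N).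
  elim: N => [|N IH]; first by rewrite addn0 big_geq // subrr.
  by rewrite addnS big_nat_recr ?leq_addr //= IH !exprS; field.
by rewrite E gerDl oppr_le0 exprn_ge0 // invr_ge0.
Qed.

Lemma tail_bound n t N : (t.+1 <= N)%N -> `|psum n N - partial V t n| <= 2^-1 ^+ t.
Proof.
move=> tN; have -> : psum n N - partial V t n = \sum_(t.+1 <= s < N) V s n.
  by rewrite /psum (big_cat_nat (n := t.+1)) //= /partial; ring.
rewrite big_add1.
have -> : N.-1 = (t + (N.-1 - t))%N by lia.
apply: le_trans (ler_norm_sum _ _ _) (le_trans _ (half_sum t (N.-1 - t))).
by apply: ler_sum => s _; exact: hV.
Qed.

Lemma cvg_partial n : cvgn (psum n).
Proof.
apply: (@cvg_geometric_steps _ _ 1 2^-1) => //.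
  by apply/andP; split; rewrite ?invr_ge0 // invf_lt1 ?ltr1n.
case=> [|k]; first by rewrite /psum !big_geq // subrr normr0 mulr_ge0.
have -> : psum n k.+2 - psum n k.+1 = V k.+1 n by rewrite /psum big_nat_recr //=; ring.
by rewrite mul1r hV.
Qed.

Lemma limit_tail n t : `|limn (psum n) - partial V t n| <= 2^-1 ^+ t.
Proof.
have h : `|psum n N - partial V t n| @[N --> \oo] --> `|limn (psum n) - partial V t n|.
  by apply: cvg_norm; apply: cvgB; [exact: cvg_partial|exact: cvg_cst].
rewrite -(cvg_lim _ h) //; apply: limr_le; first by apply: cvgP h.
by near=> N; apply: tail_bound; near: N; exact: nbhs_infty_ge.
Unshelve. all: by end_near. Qed.

End Tail.

Theorem theorem7p1 (R : realType) (p q : nat) (hp : (2 <= p)%N) (hq : (2 <= q)%N)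
    (hpq : coprime p q) :
  exists delta : nat -> R,
    [/\ forall t : nat, (1 <= t)%N -> 0 < delta t,
        (\sum_(1 <= t <oo) (delta t)%:E < +oo)%E
      & forall V : nat -> Z2 -> R,
          (forall t : nat, (1 <= t)%N ->
             ab_periodic (p ^ t)%N (q ^ t)%N (V t) /\
             (supnorm (V t) <= (delta t)%:E)%E) ->
          is_real_interval
            (spectrum (schrodinger (fun n => limn (fun N : nat => \sum_(1 <= t < N) V t n))))].
Proof.
have p0 : (0 < p)%N by exact: ltnW.
have q0 : (0 < q)%N by exact: ltnW.
have [d [d0 dle hgood]] := good_deltas R p0 q0 hpq.
exists d; split => //.
  apply: (@le_lt_trans _ _ 1%:E); last exact: ltry.
  apply: lime_le; first by apply: is_cvg_nneseries => t t1 _; rewrite lee_fin ltW // d0.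
  near=> N; have N1 : (1 <= N)%N by near: N; exact: nbhs_infty_ge.
  rewrite sumEFin lee_fin; apply: le_trans (half_sum R 0 (N - 1)); rewrite add0n.
  by rewrite big_add1 subn1; apply: ler_sum => t _; exact: dle.
move=> V hV.
have hV' t n : (1 <= t)%N -> `|V t n| <= d t.
  by move=> t1; have [_ /supnorm_le] := hV t t1; apply.
have hV2 t n : (1 <= t)%N -> `|V t n| <= 2^-1 ^+ t.
  by move=> t1; apply: le_trans (hV' t n t1) (dle t).
have adm t : admissible p q d t V.
  by move=> s /andP[s1 _]; split=> [|n]; [have [] := hV s s1|exact: hV'].
(* The bound 1 on the total potential is [limit_tail] at [t = 0], where the partial sum is empty. *)
apply: (@spectrum_interval _ _ 1) => [n|e e0].
  by have := limit_tail hV2 n 0; rewrite /partial big_geq // subr0 expr0.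
have [t ht] : exists t, (2^-1 : R) ^+ t <= e.
  have : (2^-1 : R) ^+ t @[t --> \oo] --> 0.
    by apply: cvg_expr; rewrite ger0_norm ?invr_ge0 // invf_lt1 ?ltr1n.
  move=> /cvgr_le/(_ e e0) h; apply: (@filter_ex _ \oo) h.
exists (partial V t), (p ^ t)%N, (q ^ t)%N; split.
- by rewrite expn_gt0 p0.
- by rewrite expn_gt0 q0.
- exact: partial_periodic (adm t).
- exact: hgood (adm t).
- by move=> n; apply: le_trans ht; exact: limit_tail.
Unshelve. all: by end_near. Qed.
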